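(* Let $a>0$, $x>0$, $0<\theta<1$, let $k\geq 2$ be an even integer, and let $\nu\in\mathbb{C}$ with $\Re(\nu)>0$. Then \begin{align*} &\left(\frac{a^2x}{4}\right)^{\frac{\nu}{2}+k+1}\sum_{n=1}^{\infty} n^{\nu/2}K_{\nu}(a\sqrt{nx})\sum_{d\mid n}d^k\sin\left(\frac{2\pi n\theta}{d}\right) =\frac{(-1)^{k/2}2^k\pi^{k+1}}{4}\Gamma(\nu+k+1)\bigl(\zeta(-k,\theta)-\zeta(-k,1-\theta)\bigr)\\ &\quad+\frac{(-1)^{k/2}}{4}(2\pi)^{k+1}\Gamma(\nu+k+1)\sum_{r=1}^{\infty}\sum_{m=0}^{\infty}\left\{\frac{(m+\theta)^k}{\left(1+\frac{16\pi^2r}{a^2x}(m+\theta)\right)^{1+\nu+k}}-\frac{(m+1-\theta)^k}{\left(1+\frac{16\pi^2r}{a^2x}(m+1-\theta)\right)^{1+\nu+k}}\right\}. \end{align*}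
   Context: $K_\nu$ denotes the modified Bessel function of the second kind of order $\nu$. $\zeta(s,\alpha)=\sum_{n=0}^\infty (n+\alpha)^{-s}$ (for $\Re s>1$, $0<\alpha\le 1$) is the Hurwitz zeta function, meromorphically continued to $\mathbb{C}$. *)

(* Defs.v *)
From Stdlib Require Import Reals ClassicalEpsilon.
From Coquelicot Require Export Coquelicot.
Open Scope R_scope.

Definition cexp (z : C) : C :=
  (exp (Re z) * cos (Im z), exp (Re z) * sin (Im z)).

Definition cpow (b : R) (s : C) : C := cexp (s * RtoC (ln b)).

Definition ccosh (z : C) : C := ((cexp z + cexp (- z)) / 2)%C.

Definition CInt_0_oo (F : (R -> Prop) -> Prop) (f : R -> C) : C :=
  (RInt_gen (fun t => Re (f t)) F (Rbar_locally p_infty),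
   RInt_gen (fun t => Im (f t)) F (Rbar_locally p_infty)).

Definition Gamma (s : C) : C :=
  CInt_0_oo (at_right 0) (fun t => (cpow t (s - 1) * RtoC (exp (- t)))%C).

Definition BesselK (nu : C) (z : R) : C :=
  CInt_0_oo (at_point 0)
    (fun t => (RtoC (exp (- z * cosh t)) * ccosh (nu * RtoC t))%C).

Definition C_differentiable (f : C -> C) (w : C) : Prop :=
  exists l : C, filterlim (fun h => ((f (w + h) - f w) / h)%C)
                          (locally' (RtoC 0)) (locally l).

Definition hurwitz_continuation (alpha : R) (f : C -> C) : Prop :=
  (forall w : C, w <> RtoC 1 -> C_differentiable f w) /\
  (forall s : C, 1 < Re s ->
     is_series (fun n : nat => cpow (INR n + alpha) (- s)) (f s)).

(* Hurwitz zeta function zeta(s, alpha), 0 < alpha <= 1, via the (unique)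
   continuation *)
Definition hurwitz_zeta (s : C) (alpha : R) : C :=
  epsilon (inhabits (fun _ : C => RtoC 0)) (hurwitz_continuation alpha) s.

Definition divsum (k : nat) (theta : R) (n : nat) : R :=
  sum_n (fun j : nat =>
           if Nat.eqb (n mod (j + 1)) 0
           then INR (j + 1) ^ k * sin (2 * PI * INR n * theta / INR (j + 1))
           else 0) (n - 1).

(* Main.v *)
(** Writing n = d m and using K_nu(z) = 1/2 (z/2)^(-nu) int_0^oo t^(nu-1) e^(-t - z^2/(4t)) dt, the
    left-hand series becomes a Mellin integral of the Lambert series
    Phi(y) = sum_n e^(-n y) sum_(d | n) d^k sin(2 pi n theta / d) at y = A / t, where A = a^2 x / 4.
    Summing over d first with the Lipschitz formula
    sum_(m >= 0) (m + x)^k e^(-c (m + x)) = sum_(n in Z) k! e^(2 pi i n x) / (c + 2 pi i n)^(k+1)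
    at x = 0, exchanging the two sums, and applying the same formula backwards at x = theta and
    x = 1 - theta gives the transformation law of Phi; its constant term is a sine series, the
    Fourier series of the Bernoulli polynomial B_(k+1).  Integrating termwise against
    t^(nu-1) e^(-t) turns each exponential into a power times Gamma(nu + k + 1).

    All Fourier expansions rest on Fejer's theorem.  Since hurwitz_zeta is chosen among all
    complex differentiable continuations, its value needs both existence of a continuation (by the
    recursion behind [zeta_reg]) and uniqueness (Goursat's theorem in logarithmic polar
    coordinates shows that the Fourier coefficients on circles do not depend on the radius). *)

Require Import Defs.
From Stdlib Require Import Reals ZArith Lra Lia Psatz ClassicalEpsilon.
From Coquelicot Require Import Coquelicot.
Open Scope R_scope.

(** * Real series, continuity and integrals *)

(** Exchanging the two sums requires a product majorant: |m y + 2 pi i n|^2 is at least 4 pi m n y,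
    so the power k + 1 >= 3 leaves (m n)^(-3/2); this is where k >= 2 enters. For even k the factor
    i^(k+1) is imaginary and cancels the i of exp (2 pi i m theta) - exp (- 2 pi i m theta), so that
    a real sine multiplies a real part, exactly what the Lipschitz formula at 0 produces. The Mellin
    integral is improper at both ends. Termwise integration rests on an explicit rate: every term is
    bounded by c_n times one fixed function with a known antiderivative, so cutting the integrals
    off costs c_n times a defect common to all terms. On the right-hand side Re nu > 0 is spent in
    two halves, one on integrability at 0, the other on summability over m. The zeta continuation is
    built from averages in the second argument because at s = 1 - m its recursion closes up within
    polynomials: the Bernoulli polynomials appear together with their derivatives and unit-step
    integrals, hence with the Fourier coefficients that match the constant term. *)

Lemma sum_n_S_R (a : nat -> R) (n : nat) : sum_n a (S n) = sum_n a n + a (S n).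
Proof. rewrite sum_Sn. reflexivity. Qed.

Lemma is_series_decr_R (a : nat -> R) (l : R) :
  is_series (fun n => a (S n)) l -> is_series a (a O + l).
Proof.
  intros H. apply (is_series_decr_1 (K := R_AbsRing) (V := R_NormedModule) a).
  refine (eq_ind l (is_series (fun n => a (S n))) H _ _).
  change (l = a O + l + - a O). ring.
Qed.

(** The operations of a general normed module are convertible to the real ones but not syntactically
    equal to them. This and the following restatements fix the instances, so that [ring], [lra] and
    unification meet plain real arithmetic. *)
Lemma is_series_plus_R (a b : nat -> R) (la lb : R) :
  is_series a la -> is_series b lb -> is_series (fun n => a n + b n) (la + lb).
Proof. exact (is_series_plus (K := R_AbsRing) (V := R_NormedModule) a b la lb). Qed.

Lemma is_series_minus_R (a b : nat -> R) (la lb : R) :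
  is_series a la -> is_series b lb -> is_series (fun n => a n - b n) (la - lb).
Proof. exact (is_series_minus (K := R_AbsRing) (V := R_NormedModule) a b la lb). Qed.

Lemma is_series_scal_R (c : R) (a : nat -> R) (l : R) :
  is_series a l -> is_series (fun n => c * a n) (c * l).
Proof. exact (is_series_scal_l (K := R_AbsRing) (V := R_NormedModule) c a l). Qed.

Lemma is_series_ext_R (a b : nat -> R) (l : R) :
  (forall n, a n = b n) -> is_series a l -> is_series b l.
Proof. exact (is_series_ext (K := R_AbsRing) (V := R_NormedModule) a b l). Qed.

Lemma ex_series_le_R (a b : nat -> R) :
  (forall n, Rabs (a n) <= b n) -> ex_series b -> ex_series a.
Proof. exact (ex_series_le (K := R_AbsRing) (V := R_CompleteNormedModule) a b). Qed.

Lemma continuous_plus_R (f g : R -> R) (t : R) :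
  continuous f t -> continuous g t -> continuous (fun t => f t + g t) t.
Proof. exact (continuous_plus (V := R_NormedModule) f g t). Qed.

Lemma continuous_minus_R (f g : R -> R) (t : R) :
  continuous f t -> continuous g t -> continuous (fun t => f t - g t) t.
Proof. exact (continuous_minus (V := R_NormedModule) f g t). Qed.

Lemma continuous_mult_R (f g : R -> R) (t : R) :
  continuous f t -> continuous g t -> continuous (fun t => f t * g t) t.
Proof. exact (continuous_mult (K := R_AbsRing) f g t). Qed.

Lemma continuous_ext_R (f g : R -> R) (t : R) :
  (forall u, f u = g u) -> continuous f t -> continuous g t.
Proof. exact (continuous_ext f g t). Qed.

Lemma ex_derive_continuous_R (f : R -> R) (t : R) : ex_derive f t -> continuous f t.
Proof. exact (ex_derive_continuous (V := R_NormedModule) f t). Qed.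

Lemma is_RInt_ext_R (f g : R -> R) (a b l : R) : a <= b ->
  (forall t, a < t < b -> f t = g t) -> is_RInt f a b l -> is_RInt g a b l.
Proof.
  intros hab H. apply (is_RInt_ext (V := R_NormedModule) f g). intros t.
  rewrite Rmin_left, Rmax_right by assumption. apply H.
Qed.

Lemma is_RInt_eq_R (f g : R -> R) (a b l : R) :
  (forall t, f t = g t) -> is_RInt f a b l -> is_RInt g a b l.
Proof. intros H. apply (is_RInt_ext (V := R_NormedModule) f g). intros t _. apply H. Qed.

Lemma is_RInt_plus_R (f g : R -> R) (a b lf lg : R) :
  is_RInt f a b lf -> is_RInt g a b lg -> is_RInt (fun t => f t + g t) a b (lf + lg).
Proof. exact (is_RInt_plus (V := R_NormedModule) f g a b lf lg). Qed.

Lemma is_RInt_minus_R (f g : R -> R) (a b lf lg : R) :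
  is_RInt f a b lf -> is_RInt g a b lg -> is_RInt (fun t => f t - g t) a b (lf - lg).
Proof. exact (is_RInt_minus (V := R_NormedModule) f g a b lf lg). Qed.

Lemma is_RInt_scal_R (f : R -> R) (a b c l : R) :
  is_RInt f a b l -> is_RInt (fun t => c * f t) a b (c * l).
Proof. exact (is_RInt_scal (V := R_NormedModule) f a b c l). Qed.

Lemma is_RInt_const_R (c a b : R) : is_RInt (fun _ => c) a b ((b - a) * c).
Proof. exact (is_RInt_const (V := R_NormedModule) a b c). Qed.

Lemma RInt_correct_R (f : R -> R) (a b : R) : ex_RInt f a b -> is_RInt f a b (RInt f a b).
Proof. exact (RInt_correct (V := R_CompleteNormedModule) f a b). Qed.

Lemma continuous_ex_RInt (f : R -> R) (a b : R) :
  (forall t, continuous f t) -> ex_RInt f a b.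
Proof. intros H. apply (ex_RInt_continuous (V := R_CompleteNormedModule)). auto. Qed.

Lemma continuous_is_RInt (f : R -> R) (a b : R) :
  (forall t, continuous f t) -> is_RInt f a b (RInt f a b).
Proof. intros H. apply RInt_correct_R, continuous_ex_RInt, H. Qed.

Lemma continuous_on_ex_RInt (f : R -> R) (a b : R) :
  a <= b -> (forall t, a <= t <= b -> continuous f t) -> ex_RInt f a b.
Proof.
  intros hab H. apply (ex_RInt_continuous (V := R_CompleteNormedModule)).
  intros t. rewrite Rmin_left, Rmax_right by assumption. apply H.
Qed.

Lemma continuous_on_is_RInt (f : R -> R) (a b : R) :
  a <= b -> (forall t, a <= t <= b -> continuous f t) -> is_RInt f a b (RInt f a b).
Proof. intros hab H. apply RInt_correct_R, continuous_on_ex_RInt; assumption. Qed.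

Lemma is_RInt_derive_R (f df : R -> R) (a b : R) : a <= b ->
  (forall t, a <= t <= b -> is_derive f t (df t)) ->
  (forall t, a <= t <= b -> continuous df t) -> is_RInt df a b (f b - f a).
Proof.
  intros hab H1 H2. apply (is_RInt_derive (V := R_CompleteNormedModule) f df);
  intros t; rewrite Rmin_left, Rmax_right by assumption; auto.
Qed.

Lemma is_RInt_abs_le (f g : R -> R) (a b lf lg : R) : a <= b ->
  (forall t, a <= t <= b -> Rabs (f t) <= g t) ->
  is_RInt f a b lf -> is_RInt g a b lg -> Rabs lf <= lg.
Proof. exact (norm_RInt_le (V := R_NormedModule) f g a b lf lg). Qed.

Lemma is_RInt_unique_R (f : R -> R) (a b l : R) : is_RInt f a b l -> RInt f a b = l.
Proof. exact (is_RInt_unique (V := R_CompleteNormedModule) f a b l). Qed.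

Lemma is_RInt_Chasles_R (f : R -> R) (a b c l1 l2 : R) :
  is_RInt f a b l1 -> is_RInt f b c l2 -> is_RInt f a c (l1 + l2).
Proof. exact (is_RInt_Chasles (V := R_NormedModule) f a b c l1 l2). Qed.

Lemma is_RInt_0_R (a b : R) : is_RInt (fun _ => 0) a b 0.
Proof.
  refine (eq_ind _ (is_RInt (fun _ => 0) a b) (is_RInt_const_R 0 a b) _ _).
  apply Rmult_0_r.
Qed.

Lemma RInt_ext_R (f g : R -> R) (a b : R) : (forall t, f t = g t) -> RInt f a b = RInt g a b.
Proof. intros H. apply (RInt_ext (V := R_CompleteNormedModule)). intros t _. apply H. Qed.

Lemma is_series_0_R : is_series (fun _ : nat => 0) 0.
Proof.
  change (is_lim_seq (sum_n (fun _ => 0)) 0). apply (is_lim_seq_ext (fun _ => 0)).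
  - intros n. symmetry. induction n. apply sum_O. rewrite sum_n_S_R, IHn. apply Rplus_0_r.
  - apply is_lim_seq_const.
Qed.

Lemma sum_n_scal_R (c : R) (v : nat -> R) (n : nat) : sum_n (fun j => c * v j) n = c * sum_n v n.
Proof.
  induction n. rewrite !sum_O; reflexivity. rewrite !sum_n_S_R, IHn.
  symmetry. apply Rmult_plus_distr_l.
Qed.

(** * Fejer's theorem *)

Lemma sin_sq_le_1 (x : R) : sin x * sin x <= 1.
Proof. pose proof (sin2_cos2 x) as H. unfold Rsqr in H. nra. Qed.

(** The sum of exp (2 pi i j u) over |j| <= n. It is written through the sum that starts at j = 0,
    so that integration against a function yields partial sums of [cos_coeff]. *)
Definition dirichlet_kernel (u : R) (n : nat) : R :=
  1 + 2 * (sum_n (fun j => cos (2 * PI * INR j * u)) n - 1).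

(** Not normalised: this is n + 1 times the usual Fejer kernel, with integral n + 1. The division
    takes place in the Cesaro means. *)
Definition fejer_kernel (u : R) (n : nat) : R := sum_f_R0 (dirichlet_kernel u) n.

Lemma dirichlet_kernel_sin (u : R) (n : nat) :
  dirichlet_kernel u n * sin (PI * u) = sin ((2 * INR n + 1) * (PI * u)).
Proof.
  unfold dirichlet_kernel. induction n as [|n IH].
  - rewrite sum_O. simpl. replace (2 * PI * 0 * u) with 0 by ring. rewrite cos_0.
    replace ((2 * 0 + 1) * (PI * u)) with (PI * u) by ring. ring.
  - rewrite sum_n_S_R.
    replace ((1 + 2 * (sum_n (fun j : nat => cos (2 * PI * INR j * u)) n
      + cos (2 * PI * INR (S n) * u) - 1)) * sin (PI * u))
      with (sin ((2 * INR n + 1) * (PI * u)) + 2 * cos (2 * PI * INR (S n) * u) * sin (PI * u))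
      by (rewrite <- IH; ring).
    rewrite S_INR.
    set (v := PI * u).
    replace (2 * PI * (INR n + 1) * u) with ((2 * INR n + 2) * v) by (unfold v; ring).
    replace ((2 * INR n + 1) * v) with ((2 * INR n + 2) * v - v) by ring.
    replace ((2 * (INR n + 1) + 1) * v) with ((2 * INR n + 2) * v + v) by ring.
    rewrite sin_minus, sin_plus. ring.
Qed.

Lemma fejer_kernel_sin (u : R) (n : nat) :
  fejer_kernel u n * (sin (PI * u) * sin (PI * u))
  = sin (INR (S n) * (PI * u)) * sin (INR (S n) * (PI * u)).
Proof.
  unfold fejer_kernel. induction n as [|n IH].
  - unfold dirichlet_kernel. simpl sum_f_R0. rewrite sum_O. simpl.
    replace (2 * PI * 0 * u) with 0 by ring. rewrite cos_0.
    replace (1 * (PI * u)) with (PI * u) by ring. ring.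
  - simpl sum_f_R0. rewrite Rmult_plus_distr_r, IH, <- (Rmult_assoc (dirichlet_kernel u (S n))), dirichlet_kernel_sin.
    rewrite !S_INR.
    set (v := PI * u). set (w := INR n + 1).
    replace ((2 * w + 1) * v) with (w * v + (w + 1) * v) by ring.
    replace ((2 * (INR n + 1) + 1) * v) with (w * v + (w + 1) * v) by (unfold w; ring).
    (* With A = w v and B = (w + 1) v the new summand is sin (B - A) sin (B + A) = sin^2 B - sin^2
       A, so the sum telescopes. *)
    replace (sin v) with (sin ((w + 1) * v - w * v)) by (f_equal; ring).
    rewrite sin_minus, sin_plus.
    pose proof (sin2_cos2 (w * v)). pose proof (sin2_cos2 ((w + 1) * v)).
    unfold Rsqr in *.
    set (a := sin (w * v)) in *. set (b := cos (w * v)) in *.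
    set (c := sin ((w + 1) * v)) in *. set (d := cos ((w + 1) * v)) in *.
    replace ((a * d + b * c) * (c * b - d * a)) with (c * c * (b * b) - a * a * (d * d)) by ring.
    replace (b * b) with (1 - a * a) by lra. replace (d * d) with (1 - c * c) by lra. ring.
Qed.

(** At integers the closed form degenerates to 0 = 0; positivity of the Fejer kernel there has to
    come from the value itself. *)
Lemma dirichlet_kernel_sin0 (u : R) (n : nat) :
  sin (PI * u) = 0 -> dirichlet_kernel u n = 2 * INR n + 1.
Proof.
  intros H. unfold dirichlet_kernel. induction n as [|n IH].
  - rewrite sum_O. simpl. replace (2 * PI * 0 * u) with 0 by ring. rewrite cos_0. ring.
  - rewrite sum_n_S_R.
    assert (E : cos (2 * PI * INR (S n) * u) = 1).
    { replace (2 * PI * INR (S n) * u) with (2 * (INR (S n) * (PI * u))) by ring.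
      rewrite cos_2a_sin.
      assert (Z : forall m, sin (INR m * (PI * u)) = 0).
      { induction m. simpl. rewrite Rmult_0_l. apply sin_0.
        rewrite S_INR. rewrite Rmult_plus_distr_r, sin_plus, Rmult_1_l, IHm, H. ring. }
      rewrite Z. ring. }
    rewrite E, S_INR. lra.
Qed.

Lemma fejer_kernel_pos (u : R) (n : nat) : 0 <= fejer_kernel u n.
Proof.
  destruct (Req_dec (sin (PI * u)) 0) as [H|H].
  - unfold fejer_kernel. apply cond_pos_sum. intros m. rewrite dirichlet_kernel_sin0 by assumption.
    pose proof (pos_INR m). lra.
  - pose proof (fejer_kernel_sin u n) as E.
    assert (0 < sin (PI * u) * sin (PI * u)) by nra.
    apply Rmult_le_reg_r with (sin (PI * u) * sin (PI * u)). assumption.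
    rewrite E. nra.
Qed.

Lemma continuous_cos_shift (c x0 t : R) : continuous (fun t => cos (c * (x0 - t))) t.
Proof.
  apply (ex_derive_continuous (V := R_NormedModule)). auto_derive. auto.
Qed.

Lemma RInt_cos_shift (x0 : R) (n : nat) :
  RInt (fun t => cos (2 * PI * INR (S n) * (x0 - t))) 0 1 = 0.
Proof.
  apply is_RInt_unique.
  set (c := 2 * PI * INR (S n)).
  assert (hc : c <> 0).
  { unfold c. pose proof PI_RGT_0. pose proof (lt_0_INR (S n) ltac:(lia)). nra. }
  replace 0 with (minus (- sin (c * (x0 - 1)) / c) (- sin (c * (x0 - 0)) / c)) at 2.
  - apply (is_RInt_derive (fun t => - sin (c * (x0 - t)) / c)).
    + intros t _. auto_derive. auto. unfold Rminus. field. assumption.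
    + intros t _. apply continuous_cos_shift.
  - unfold minus, plus, opp; simpl.
    replace (c * (x0 - 1)) with (c * (x0 - 0) - c) by ring.
    assert (S0 : sin c = 0 /\ cos c = 1).
    { unfold c. split.
      - replace (2 * PI * INR (S n)) with (0 + 2 * INR (S n) * PI) by ring.
        rewrite sin_period. apply sin_0.
      - replace (2 * PI * INR (S n)) with (0 + 2 * INR (S n) * PI) by ring.
        rewrite cos_period. apply cos_0. }
    rewrite sin_minus. destruct S0 as [-> ->]. field. assumption.
Qed.

(** Half the sum of the Fourier terms of frequencies n and - n, already evaluated at x0: one real
    integral replaces two complex coefficients. *)
Definition cos_coeff (f : R -> R) (x0 : R) (n : nat) : R :=
  RInt (fun t => f t * cos (2 * PI * INR n * (x0 - t))) 0 1.

Section Fejer.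
Variables (f : R -> R) (x0 : R).
Hypothesis fcont : forall t, continuous f t.

Notation cf := (cos_coeff f x0).

Lemma continuous_fcos (c t : R) : continuous (fun t => f t * cos (c * (x0 - t))) t.
Proof.
  apply (continuous_mult (K := R_AbsRing)). apply fcont. apply continuous_cos_shift.
Qed.

Lemma is_RInt_cos_sum (n : nat) :
  is_RInt (fun t => f t * sum_n (fun j => cos (2 * PI * INR j * (x0 - t))) n) 0 1 (sum_n cf n).
Proof.
  induction n as [|n IH].
  - rewrite sum_O. apply (is_RInt_ext (fun t => f t * cos (2 * PI * INR 0 * (x0 - t)))).
    intros t _. rewrite sum_O. reflexivity.
    apply (RInt_correct (V := R_CompleteNormedModule)). apply continuous_ex_RInt.
    intros t. apply continuous_fcos.
  - rewrite sum_Sn.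
    eapply is_RInt_ext; [|apply (is_RInt_plus (V := R_NormedModule)); [apply IH|]].
    2:{ apply (RInt_correct (V := R_CompleteNormedModule)). apply continuous_ex_RInt.
        intros t. apply continuous_fcos. }
    intros t _. rewrite sum_n_S_R. unfold plus; simpl. ring.
Qed.

Lemma RInt_f0 : RInt f 0 1 = cf 0.
Proof.
  unfold cos_coeff. apply RInt_ext. intros t _. simpl.
  replace (2 * PI * 0 * (x0 - t)) with 0 by ring. rewrite cos_0. simpl. ring.
Qed.

Lemma is_RInt_dirichlet (n : nat) :
  is_RInt (fun t => f t * dirichlet_kernel (x0 - t) n) 0 1 (cf 0 + 2 * (sum_n cf n - cf 0)).
Proof.
  assert (Hf : is_RInt f 0 1 (cf 0)).
  { rewrite <- RInt_f0. apply (RInt_correct (V := R_CompleteNormedModule)).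
    apply continuous_ex_RInt, fcont. }
  pose proof (is_RInt_plus (V := R_NormedModule) _ _ _ _ _ _ Hf
    (is_RInt_scal (V := R_NormedModule) _ _ _ 2 _
     (is_RInt_minus (V := R_NormedModule) _ _ _ _ _ _ (is_RInt_cos_sum n) Hf))) as H.
  eapply is_RInt_ext; [|exact H].
  intros t _. unfold dirichlet_kernel, plus, minus, scal, opp, plus; simpl.
  unfold mult; simpl. ring.
Qed.

Lemma is_RInt_fejer (n : nat) :
  is_RInt (fun t => f t * fejer_kernel (x0 - t) n) 0 1
    (sum_f_R0 (fun m => cf 0 + 2 * (sum_n cf m - cf 0)) n).
Proof.
  unfold fejer_kernel. induction n as [|n IH].
  - simpl. apply is_RInt_dirichlet.
  - simpl. eapply is_RInt_ext; [|apply (is_RInt_plus (V := R_NormedModule)); [apply IH|apply (is_RInt_dirichlet (S n))]].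
    intros t _. unfold plus; simpl. ring.
Qed.
End Fejer.

Lemma is_RInt_fejer_kernel (x0 : R) (n : nat) :
  is_RInt (fun t => fejer_kernel (x0 - t) n) 0 1 (INR (S n)).
Proof.
  pose proof (is_RInt_fejer (fun _ => 1) x0 (fun t => continuous_const 1 t) n) as H.
  assert (E0 : cos_coeff (fun _ => 1) x0 0 = 1).
  { unfold cos_coeff. rewrite (RInt_ext _ (fun _ => 1)). rewrite RInt_const. unfold scal; simpl; unfold mult; simpl. ring.
    intros t _. simpl. replace (2 * PI * 0 * (x0 - t)) with 0 by ring. rewrite cos_0. ring. }
  assert (E1 : forall m, sum_n (cos_coeff (fun _ => 1) x0) m = 1).
  { induction m. rewrite sum_O. exact E0. rewrite sum_n_S_R, IHm.
    replace (cos_coeff (fun _ => 1) x0 (S m)) with 0. apply Rplus_0_r.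
    rewrite <- (RInt_cos_shift x0 m). apply RInt_ext. intros t _. rewrite Rmult_1_l. reflexivity. }
  rewrite (sum_eq _ (fun _ => 1)) in H. 2: { intros m _. rewrite E1, E0. ring. }
  rewrite sum_cte, Rmult_1_l in H.
  eapply is_RInt_ext; [|exact H]. intros t _. simpl. ring.
Qed.

Lemma sin_pi_lower (d u : R) :
  0 < d -> d <= u <= 1 - d -> sin (PI * d) * sin (PI * d) <= sin (PI * u) * sin (PI * u).
Proof.
  intros Hd [H1 H2]. pose proof PI_RGT_0.
  assert (0 <= sin (PI * d)) by (apply sin_ge_0; nra).
  assert (sin (PI * d) <= sin (PI * u)).
  { destruct (Rle_dec u (1/2)).
    - apply sin_incr_1; nra.
    - rewrite <- (sin_PI_x (PI * u)). apply sin_incr_1; nra. }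
  nra.
Qed.

(* The factor sin^2 absorbs the Fejer kernel, since sin^2(pi u) F_n(u) = sin^2(pi (n+1) u) <= 1: no
   splitting of the integral is needed afterwards. *)
Lemma fejer_deviation (f : R -> R) (x0 eps : R) :
  (forall t, continuous f t) -> f 0 = f 1 -> 0 <= x0 <= 1 -> 0 < eps ->
  exists M, 0 <= M /\ forall t, 0 <= t <= 1 ->
    Rabs (f t - f x0) <= eps + M * (sin (PI * (x0 - t)) * sin (PI * (x0 - t))).
Proof.
  intros fc f01 hx heps.
  assert (fcp : forall t, 0 <= t <= 1 -> continuity_pt f t).
  { intros t _. apply continuity_pt_filterlim, fc. }
  destruct (Heine_cor2 (f := f) (a := 0) (b := 1) fcp (mkposreal (eps/2) ltac:(lra))) as [d Hd]. simpl in Hd.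
  assert (Hd' : forall t u, 0 <= t <= 1 -> 0 <= u <= 1 -> Rabs (t - u) < d -> Rabs (f t - f u) < eps / 2).
  { intros; apply Hd; assumption. }
  destruct (continuity_ab_maj f 0 1 ltac:(lra) fcp) as [mx [Hmx _]].
  destruct (continuity_ab_min f 0 1 ltac:(lra) fcp) as [mn [Hmn _]].
  set (d' := Rmin (d/2) (1/4)).
  assert (hd0 : 0 < d') by (unfold d'; apply Rmin_pos; [pose proof (cond_pos d)|]; lra).
  assert (hdd : d' < d) by (unfold d'; pose proof (Rmin_l (d/2) (1/4)); pose proof (cond_pos d); lra).
  assert (hdq : d' <= 1/4) by (unfold d'; apply Rmin_r).
  set (s := sin (PI * d') * sin (PI * d')).
  assert (hs : 0 < s).
  { unfold s. pose proof PI_RGT_0. assert (0 < sin (PI * d')) by (apply sin_gt_0; nra). nra. }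
  exists ((f mx - f mn) / s).
  assert (hmm : 0 <= f mx - f mn) by (pose proof (Hmn mx); pose proof (Hmx 0); pose proof (Hmn 0); lra).
  split. apply Rdiv_le_0_compat; lra.
  intros t ht.
  pose proof (Hmx t ht). pose proof (Hmn t ht). pose proof (Hmx x0 hx). pose proof (Hmn x0 hx).
  assert (hM : 0 <= (f mx - f mn) / s) by (apply Rdiv_le_0_compat; lra).
  assert (hq : 0 <= sin (PI * (x0 - t)) * sin (PI * (x0 - t))) by nra.
  assert (hMq := Rmult_le_pos _ _ hM hq).
  destruct (Rlt_dec (Rabs (t - x0)) d').
  { pose proof (Hd' t x0 ht hx ltac:(lra)). lra. }
  (* Here t and x0 lie near opposite ends of [0, 1]. The deviation passes through [f 0 = f 1], one
     eps / 2 at each end. *)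
  destruct (Rlt_dec (1 - d') (Rabs (t - x0))) as [hb|hb].
  { assert (Rabs (f t - f x0) < eps).
    { unfold Rabs in hb. destruct (Rcase_abs (t - x0)).
      - pose proof (Hd' t 0 ht ltac:(lra) ltac:(rewrite Rabs_right; lra)) as E1.
        pose proof (Hd' x0 1 hx ltac:(lra) ltac:(rewrite Rabs_left1; lra)) as E2.
        apply Rabs_def2 in E1. apply Rabs_def2 in E2. apply Rabs_def1; lra.
      - pose proof (Hd' x0 0 hx ltac:(lra) ltac:(rewrite Rabs_right; lra)) as E1.
        pose proof (Hd' t 1 ht ltac:(lra) ltac:(rewrite Rabs_left1; lra)) as E2.
        apply Rabs_def2 in E1. apply Rabs_def2 in E2. apply Rabs_def1; lra. }
    lra. }
  assert (hl : s <= sin (PI * (x0 - t)) * sin (PI * (x0 - t))).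
  { replace (sin (PI * (x0 - t)) * sin (PI * (x0 - t)))
      with (sin (PI * Rabs (t - x0)) * sin (PI * Rabs (t - x0))).
    apply sin_pi_lower; lra.
    unfold Rabs; destruct (Rcase_abs (t - x0)).
    replace (- (t - x0)) with (x0 - t) by ring. reflexivity.
    replace (PI * (x0 - t)) with (- (PI * (t - x0))) by ring. rewrite sin_neg. ring. }
  assert (f mx - f mn <= (f mx - f mn) / s * (sin (PI * (x0 - t)) * sin (PI * (x0 - t)))).
  { replace (f mx - f mn) with ((f mx - f mn) / s * s) at 1 by (field; lra).
    apply Rmult_le_compat_l; assumption. }
  assert (Rabs (f t - f x0) <= f mx - f mn) by (apply Rabs_le; lra).
  lra.
Qed.

(** Since the series is assumed to converge, its Cesaro means have the same limit, and the Fejer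
    estimate shows that this limit is [f x0]. *)
Theorem fourier_pointwise (f : R -> R) (x0 l : R) :
  (forall t, continuous f t) -> f 0 = f 1 -> 0 <= x0 <= 1 ->
  is_series (fun n => RInt (fun t => f t * cos (2 * PI * INR (S n) * (x0 - t))) 0 1) l ->
  f x0 = RInt f 0 1 + 2 * l.
Proof.
  intros fc f01 hx Hl.
  set (cf := cos_coeff f x0).
  rewrite (RInt_f0 f x0). change (f x0 = cf 0%nat + 2 * l).
  assert (Hcv : Un_cv (fun n => cf 0%nat + 2 * (sum_n cf n - cf 0%nat)) (cf 0%nat + 2 * l)).
  { apply is_lim_seq_Reals.
    apply is_lim_seq_plus'. apply is_lim_seq_const.
    apply (is_lim_seq_scal_l _ 2 (Finite l)).
    assert (Hs : is_lim_seq (sum_n cf) (cf 0%nat + l)).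
    { exact (is_series_decr_R cf l Hl). }
    replace l with ((cf 0%nat + l) - cf 0%nat) by ring.
    apply is_lim_seq_minus'. exact Hs. apply is_lim_seq_const. }
  apply Cesaro_1 in Hcv.
  apply Rminus_diag_uniq. apply cond_eq. intros eps heps. rewrite Rminus_0_r.
  destruct (fejer_deviation f x0 (eps / 4) fc f01 hx ltac:(lra)) as [M [hM HM]].
  destruct (Hcv (eps / 4) ltac:(lra)) as [N HN].
  (* Beyond this index M / (n + 1) is less than eps / 4. *)
  destruct (nfloor_ex (M / (eps / 4))) as [N2 HN2]. apply Rdiv_le_0_compat; lra.
  set (n := (N + N2 + 1)%nat).
  assert (hn : (N <= S n)%nat) by (unfold n; lia).
  specialize (HN (S n) hn). simpl pred in HN.
  pose proof (is_RInt_fejer f x0 fc n) as HI. fold cf in HI.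
  set (Sg := sum_f_R0 (fun m : nat => cf 0%nat + 2 * (sum_n cf m - cf 0%nat)) n) in *.
  set (Kn := fun t => fejer_kernel (x0 - t) n).
  assert (HK := is_RInt_fejer_kernel x0 n).
  assert (H1 : is_RInt (fun t => (f t - f x0) * Kn t) 0 1 (Sg - f x0 * INR (S n))).
  { eapply is_RInt_ext; [|apply (is_RInt_minus (V := R_NormedModule)); [exact HI|apply (is_RInt_scal (V := R_NormedModule)); exact HK]].
    intros t _. unfold minus, plus, opp, scal; simpl. unfold mult; simpl. unfold Kn. ring. }
  (* The term M sin^2 of the deviation, multiplied by the kernel, becomes M times this squared sine.
     Its integral is at most 1, so it contributes only M / (n + 1) to the mean. *)
  assert (H2 : ex_RInt (fun t => sin (INR (S n) * (PI * (x0 - t))) * sin (INR (S n) * (PI * (x0 - t)))) 0 1).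
  { apply continuous_ex_RInt. intros t. apply (ex_derive_continuous (V := R_NormedModule)). auto_derive. auto. }
  destruct H2 as [J HJ].
  assert (HJ1 : J <= 1).
  { rewrite <- (is_RInt_unique _ _ _ _ HJ).
    apply Rle_trans with (RInt (fun _ => 1) 0 1).
    apply RInt_le. lra. exists J; exact HJ. apply ex_RInt_const.
    intros t _. apply sin_sq_le_1.
    rewrite RInt_const. unfold scal; simpl; unfold mult; simpl. lra. }
  assert (H3 : is_RInt (fun t => eps/4 * Kn t + M * (sin (INR (S n) * (PI * (x0 - t))) * sin (INR (S n) * (PI * (x0 - t))))) 0 1 (eps/4 * INR (S n) + M * J)).
  { apply (is_RInt_plus (V := R_NormedModule)).
    apply (is_RInt_scal (V := R_NormedModule)). exact HK.
    apply (is_RInt_scal (V := R_NormedModule)). exact HJ. }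
  assert (H4 : Rabs (Sg - f x0 * INR (S n)) <= eps/4 * INR (S n) + M * J).
  { apply (is_RInt_abs_le (fun t => (f t - f x0) * Kn t)
      (fun t => eps/4 * Kn t + M * (sin (INR (S n) * (PI * (x0 - t))) * sin (INR (S n) * (PI * (x0 - t))))) 0 1).
    lra. 2: exact H1. 2: exact H3.
    intros t ht.
    rewrite Rabs_mult. rewrite (Rabs_pos_eq (Kn t)) by apply fejer_kernel_pos.
    rewrite <- fejer_kernel_sin. fold (Kn t).
    pose proof (HM t ht). pose proof (fejer_kernel_pos (x0 - t) n) as Hp. fold (Kn t) in Hp.
    nra. }
  assert (hSn : 0 < INR (S n)) by (apply lt_0_INR; lia).
  assert (H5 : Rabs (Sg / INR (S n) - f x0) <= eps/4 + M / INR (S n)).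
  { replace (Sg / INR (S n) - f x0) with ((Sg - f x0 * INR (S n)) / INR (S n)) by (field; lra).
    rewrite Rabs_div by lra. rewrite (Rabs_pos_eq (INR (S n))) by lra.
    apply Rmult_le_reg_r with (INR (S n)). lra.
    unfold Rdiv at 1. rewrite Rmult_assoc, Rinv_l, Rmult_1_r by lra.
    replace ((eps/4 + M / INR (S n)) * INR (S n)) with (eps/4 * INR (S n) + M) by (field; lra).
    nra. }
  assert (H6 : M / INR (S n) < eps / 4).
  { apply Rmult_lt_reg_r with (INR (S n)). lra.
    unfold Rdiv at 1. rewrite Rmult_assoc, Rinv_l, Rmult_1_r by lra.
    assert (M / (eps/4) < INR (S n)).
    { apply Rlt_le_trans with (INR N2 + 1). lra. rewrite <- S_INR. apply le_INR. unfold n; lia. }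
    apply Rmult_lt_compat_l with (r := eps/4) in H; [|lra].
    replace (eps / 4 * (M / (eps / 4))) with M in H by (field; lra). lra. }
  unfold Rdist in HN.
  replace (f x0 - (cf 0%nat + 2 * l)) with
    ((Sg / INR (S n) - (cf 0%nat + 2 * l)) - (Sg / INR (S n) - f x0)) by ring.
  eapply Rle_lt_trans. apply Rabs_triang. rewrite Rabs_Ropp.
  lra.
Qed.

(** * Goursat's theorem for rectangles *)

Lemma RInt_near_const (f : R -> R) (a b K M : R) : a <= b -> ex_RInt f a b ->
  (forall t, a <= t <= b -> Rabs (f t - K) <= M) -> Rabs (RInt f a b - K * (b - a)) <= M * (b - a).
Proof.
  intros hab hf H. rewrite (Rmult_comm K), (Rmult_comm M).
  apply (is_RInt_abs_le (fun t => f t - K) (fun _ => M) a b); auto.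
  apply is_RInt_minus_R. apply RInt_correct_R, hf. apply is_RInt_const_R.
  apply is_RInt_const_R.
Qed.

(* Real form of complex differentiability: for u + iv take (P, Q) = (u, -v) and (v, u), and
   the shared cross derivative m expresses the Cauchy-Riemann equations. *)
Definition goursat_at (P Q : R -> R -> R) (x0 y0 : R) : Prop :=
  exists px m qy, forall eps, 0 < eps -> exists delta, 0 < delta /\ forall x y,
    Rabs (x - x0) <= delta -> Rabs (y - y0) <= delta ->
    Rabs (P x y - (P x0 y0 + px * (x - x0) + m * (y - y0))) <= eps * (Rabs (x - x0) + Rabs (y - y0)) /\
    Rabs (Q x y - (Q x0 y0 + m * (x - x0) + qy * (y - y0))) <= eps * (Rabs (x - x0) + Rabs (y - y0)).

(** The integral of P dx + Q dy along the counterclockwise boundary, with opposite sides combined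
    under one integral sign. *)
Definition rect_integral (P Q : R -> R -> R) (a b c d : R) : R :=
  RInt (fun x => P x c - P x d) a b + RInt (fun y => Q b y - Q a y) c d.

Lemma continuous_of_linear_bound (f : R -> R) (t0 delta K : R) : 0 < delta ->
  (forall t, Rabs (t - t0) <= delta -> Rabs (f t - f t0) <= K * Rabs (t - t0)) -> continuous f t0.
Proof.
  intros hd H. apply continuity_pt_filterlim. intros eps heps.
  assert (hK : 0 < Rabs K + 1) by (pose proof (Rabs_pos K); lra).
  exists (Rmin delta (eps / (Rabs K + 1))). split.
  apply Rmin_pos. lra. apply Rdiv_lt_0_compat; lra.
  intros t [_ ht]. simpl in *. unfold Rdist in *.
  pose proof (Rmin_l delta (eps / (Rabs K + 1))). pose proof (Rmin_r delta (eps / (Rabs K + 1))).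
  eapply Rle_lt_trans. apply H. lra.
  apply Rle_lt_trans with (Rabs K * Rabs (t - t0)).
  apply Rmult_le_compat_r. apply Rabs_pos. apply Rle_abs.
  assert (Rabs (t - t0) * (Rabs K + 1) < eps).
  { apply (Rmult_lt_compat_r (Rabs K + 1)) in ht; [|lra].
    eapply Rlt_le_trans. exact ht.
    apply Rle_trans with (eps / (Rabs K + 1) * (Rabs K + 1)).
    apply Rmult_le_compat_r; lra. right. field. lra. }
  pose proof (Rabs_pos (t - t0)). nra.
Qed.

(** Pointwise differentiability supplies the continuity along horizontals and verticals that makes
    all boundary integrals exist. *)
Lemma goursat_at_continuous (P Q : R -> R -> R) (x0 y0 : R) : goursat_at P Q x0 y0 ->
  (continuous (fun x => P x y0) x0 /\ continuous (fun y => P x0 y) y0) /\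
  (continuous (fun x => Q x y0) x0 /\ continuous (fun y => Q x0 y) y0).
Proof.
  intros (px & m & qy & H). destruct (H 1 Rlt_0_1) as (d & hd & Hd).
  assert (Z : Rabs (x0 - x0) <= d) by (rewrite Rminus_diag, Rabs_R0; lra).
  assert (Z' : Rabs (y0 - y0) <= d) by (rewrite Rminus_diag, Rabs_R0; lra).
  assert (T : forall A B k u, Rabs (A - (B + k * u)) <= Rabs u -> Rabs (A - B) <= (Rabs k + 1) * Rabs u).
  { intros A B k u h. replace (A - B) with ((A - (B + k * u)) + k * u) by ring.
    eapply Rle_trans. apply Rabs_triang. rewrite Rabs_mult. lra. }
  repeat split.
  - apply (continuous_of_linear_bound _ x0 d (Rabs px + 1) hd). intros x hx.
    destruct (Hd x y0 hx Z') as [E _]. rewrite Rminus_diag, Rabs_R0 in E. apply T.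
    replace (P x0 y0 + px * (x - x0)) with (P x0 y0 + px * (x - x0) + m * 0) by ring. lra.
  - apply (continuous_of_linear_bound _ y0 d (Rabs m + 1) hd). intros y hy.
    destruct (Hd x0 y Z hy) as [E _]. rewrite Rminus_diag, Rabs_R0 in E. apply T.
    replace (P x0 y0 + m * (y - y0)) with (P x0 y0 + px * 0 + m * (y - y0)) by ring. lra.
  - apply (continuous_of_linear_bound _ x0 d (Rabs m + 1) hd). intros x hx.
    destruct (Hd x y0 hx Z') as [_ E]. rewrite Rminus_diag, Rabs_R0 in E. apply T.
    replace (Q x0 y0 + m * (x - x0)) with (Q x0 y0 + m * (x - x0) + qy * 0) by ring. lra.
  - apply (continuous_of_linear_bound _ y0 d (Rabs qy + 1) hd). intros y hy.
    destruct (Hd x0 y Z hy) as [_ E]. rewrite Rminus_diag, Rabs_R0 in E. apply T.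
    replace (Q x0 y0 + qy * (y - y0)) with (Q x0 y0 + m * 0 + qy * (y - y0)) by ring. lra.
Qed.

(** The affine parts contribute m (c - d) (b - a) + m (b - a) (d - c) = 0, because the cross
    derivative m is shared; only the error terms survive. *)
Lemma rect_integral_local (P Q : R -> R -> R) (a b c d x0 y0 eps delta px m qy : R) :
  a <= x0 <= b -> c <= y0 <= d -> b - a <= delta -> d - c <= delta ->
  ex_RInt (fun x => P x c - P x d) a b -> ex_RInt (fun y => Q b y - Q a y) c d ->
  0 <= eps ->
  (forall x y, Rabs (x - x0) <= delta -> Rabs (y - y0) <= delta ->
    Rabs (P x y - (P x0 y0 + px * (x - x0) + m * (y - y0))) <= eps * (Rabs (x - x0) + Rabs (y - y0)) /\
    Rabs (Q x y - (Q x0 y0 + m * (x - x0) + qy * (y - y0))) <= eps * (Rabs (x - x0) + Rabs (y - y0))) ->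
  Rabs (rect_integral P Q a b c d) <= 2 * eps * ((b - a) + (d - c)) ^ 2.
Proof.
  intros hx hy hw hh e1 e2 heps H. unfold rect_integral.
  set (w := b - a) in *. set (h := d - c) in *.
  assert (Bx : forall x, a <= x <= b -> Rabs (x - x0) <= w).
  { intros x hx'. apply Rabs_le. unfold w. lra. }
  assert (By : forall y, c <= y <= d -> Rabs (y - y0) <= h).
  { intros y hy'. apply Rabs_le. unfold h. lra. }
  assert (E : forall x y, a <= x <= b -> c <= y <= d ->
    Rabs (P x y - (P x0 y0 + px * (x - x0) + m * (y - y0))) <= eps * (w + h) /\
    Rabs (Q x y - (Q x0 y0 + m * (x - x0) + qy * (y - y0))) <= eps * (w + h)).
  { intros x y hx' hy'. pose proof (Bx x hx'). pose proof (By y hy').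
    destruct (H x y ltac:(lra) ltac:(lra)).
    assert (eps * (Rabs (x - x0) + Rabs (y - y0)) <= eps * (w + h)) by (apply Rmult_le_compat_l; lra).
    lra. }
  assert (I1 := RInt_near_const _ a b (m * (c - d)) (2 * eps * (w + h)) ltac:(lra) e1).
  assert (I2 := RInt_near_const _ c d (m * (b - a)) (2 * eps * (w + h)) ltac:(lra) e2).
  fold w in I1. fold h in I2.
  assert (J1 : Rabs (RInt (fun x => P x c - P x d) a b - m * (c - d) * w) <= 2 * eps * (w + h) * w).
  { apply I1. intros x hx'.
    destruct (E x c hx' ltac:(lra)) as [E1 _]. destruct (E x d hx' ltac:(lra)) as [E2 _].
    apply Rabs_le_between in E1. apply Rabs_le_between in E2. apply Rabs_le. lra. }
  assert (J2 : Rabs (RInt (fun y => Q b y - Q a y) c d - m * (b - a) * h) <= 2 * eps * (w + h) * h).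
  { apply I2. intros y hy'.
    destruct (E b y ltac:(lra) hy') as [_ E1]. destruct (E a y ltac:(lra) hy') as [_ E2].
    apply Rabs_le_between in E1. apply Rabs_le_between in E2. apply Rabs_le. lra. }
  apply Rabs_le_between in J1. apply Rabs_le_between in J2. apply Rabs_le.
  assert (m * (c - d) * w + m * (b - a) * h = 0) by (unfold w, h; ring).
  replace (2 * eps * (w + h) ^ 2) with (2 * eps * (w + h) * w + 2 * eps * (w + h) * h) by ring.
  lra.
Qed.

Lemma nested_point (a w : nat -> R) :
  (forall n, a n <= a (S n)) -> (forall n, a (S n) + w (S n) <= a n + w n) -> (forall n, 0 <= w n) ->
  exists x, forall n, a n <= x <= a n + w n.
Proof.
  intros H1 H2 H3.
  assert (M1 : forall n p, a n <= a (n + p)%nat).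
  { intros n p. induction p. rewrite Nat.add_0_r. lra. rewrite Nat.add_succ_r. pose proof (H1 (n+p)%nat). lra. }
  assert (M2 : forall n p, a (n + p)%nat + w (n + p)%nat <= a n + w n).
  { intros n p. induction p. rewrite Nat.add_0_r. lra. rewrite Nat.add_succ_r. pose proof (H2 (n+p)%nat). lra. }
  assert (M3 : forall n p, a n <= a p + w p).
  { intros n p. pose proof (M1 n p). pose proof (M2 p n). pose proof (H3 (n+p)%nat).
    rewrite (Nat.add_comm p n) in *. lra. }
  destruct (completeness (fun y => exists n, y = a n)) as [x [Hx1 Hx2]].
  - exists (a O + w O). intros y [n ->]. apply M3.
  - exists (a O), O. reflexivity.
  - exists x. intros n. split. apply Hx1. exists n; reflexivity.
    apply Hx2. intros y [k ->]. apply M3.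
Qed.

Section Goursat.
Variables (P Q : R -> R -> R) (A B C D : R).
Hypothesis hAB : A < B.
Hypothesis hCD : C < D.
Hypothesis HG : forall x y, A <= x <= B -> C <= y <= D -> goursat_at P Q x y.

Lemma goursat_ex_P (a b c d : R) : A <= a -> a <= b -> b <= B -> C <= c <= D -> C <= d <= D ->
  ex_RInt (fun x => P x c - P x d) a b.
Proof.
  intros. apply continuous_on_ex_RInt. assumption. intros x hx. apply continuous_minus_R.
  apply (goursat_at_continuous P Q x c). apply HG; lra.
  apply (goursat_at_continuous P Q x d). apply HG; lra.
Qed.

Lemma goursat_ex_Q (a b c d : R) : C <= c -> c <= d -> d <= D -> A <= a <= B -> A <= b <= B ->
  ex_RInt (fun y => Q b y - Q a y) c d.
Proof.
  intros. apply continuous_on_ex_RInt. assumption. intros y hy. apply continuous_minus_R.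
  apply (goursat_at_continuous P Q b y). apply HG; lra.
  apply (goursat_at_continuous P Q a y). apply HG; lra.
Qed.

Lemma rect_integral_split (a b c d m p : R) : A <= a -> a <= m -> m <= b -> b <= B ->
  C <= c -> c <= p -> p <= d -> d <= D ->
  rect_integral P Q a b c d =
    rect_integral P Q a m c p + rect_integral P Q m b c p
    + rect_integral P Q a m p d + rect_integral P Q m b p d.
Proof.
  intros h1 h2 h3 h4 h5 h6 h7 h8. unfold rect_integral.
  assert (CP : forall a b c d p, A <= a -> a <= b -> b <= B -> C <= c <= D -> C <= d <= D -> C <= p <= D ->
     RInt (fun x => P x c - P x d) a b =
     RInt (fun x => P x c - P x p) a b + RInt (fun x => P x p - P x d) a b).
  { intros. apply is_RInt_unique_R.
    apply (is_RInt_eq_R (fun x => (P x c0 - P x p0) + (P x p0 - P x d0))). intros t. ring.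
    apply is_RInt_plus_R; apply RInt_correct_R, goursat_ex_P; lra. }
  assert (CQ : forall a b c d p, C <= c -> c <= d -> d <= D -> A <= a <= B -> A <= b <= B -> A <= p <= B ->
     RInt (fun x => Q b x - Q a x) c d =
     RInt (fun x => Q p x - Q a x) c d + RInt (fun x => Q b x - Q p x) c d).
  { intros. apply is_RInt_unique_R.
    apply (is_RInt_eq_R (fun x => (Q p0 x - Q a0 x) + (Q b0 x - Q p0 x))). intros t. ring.
    apply is_RInt_plus_R; apply RInt_correct_R, goursat_ex_Q; lra. }
  rewrite (is_RInt_unique_R _ a b _ (is_RInt_Chasles_R _ a m b _ _
    (RInt_correct_R _ _ _ (goursat_ex_P a m c d ltac:(lra) ltac:(lra) ltac:(lra) ltac:(lra) ltac:(lra)))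
    (RInt_correct_R _ _ _ (goursat_ex_P m b c d ltac:(lra) ltac:(lra) ltac:(lra) ltac:(lra) ltac:(lra))))).
  rewrite (is_RInt_unique_R _ c d _ (is_RInt_Chasles_R _ c p d _ _
    (RInt_correct_R _ _ _ (goursat_ex_Q a b c p ltac:(lra) ltac:(lra) ltac:(lra) ltac:(lra) ltac:(lra)))
    (RInt_correct_R _ _ _ (goursat_ex_Q a b p d ltac:(lra) ltac:(lra) ltac:(lra) ltac:(lra) ltac:(lra))))).
  rewrite (CP a m c d p), (CP m b c d p), (CQ a b c p m), (CQ a b p d m) by lra. ring.
Qed.

Let W := B - A.
Let H := D - C.
Let w (n : nat) := W / 2 ^ n.
Let h (n : nat) := H / 2 ^ n.
Let om (z : R * R) (n : nat) := rect_integral P Q (fst z) (fst z + w n) (snd z) (snd z + h n).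
Variable K : R.

(** Picks a quarter whose boundary integral is at least K / 4^(n+1). When the first three fail the
    fourth is taken without a test: the four integrals add up to that of the parent, so it has to be
    large. *)
Let step (z : R * R) (n : nat) : R * R :=
  let z1 := (fst z, snd z) in
  let z2 := (fst z + w (S n), snd z) in
  let z3 := (fst z, snd z + h (S n)) in
  let z4 := (fst z + w (S n), snd z + h (S n)) in
  if Rle_dec (K / 4 ^ S n) (Rabs (om z1 (S n))) then z1 else
  if Rle_dec (K / 4 ^ S n) (Rabs (om z2 (S n))) then z2 else
  if Rle_dec (K / 4 ^ S n) (Rabs (om z3 (S n))) then z3 else z4.

Let Fixpoint corner (n : nat) : R * R :=
  match n with O => (A, C) | S m => step (corner m) m end.

Lemma goursat_halves (n : nat) : w n = 2 * w (S n) /\ h n = 2 * h (S n) /\ 0 < w (S n) /\ 0 < h (S n).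
Proof.
  assert (0 < 2 ^ n) by (apply pow_lt; lra).
  unfold w, h, W, H. simpl. repeat split; try (field; lra);
  apply Rdiv_lt_0_compat; lra.
Qed.

Lemma goursat_inv (n : nat) : K <= Rabs (rect_integral P Q A B C D) ->
  A <= fst (corner n) /\ fst (corner n) + w n <= B /\ C <= snd (corner n) /\ snd (corner n) + h n <= D
  /\ K / 4 ^ n <= Rabs (om (corner n) n).
Proof.
  intros hK. induction n as [|n IH].
  - simpl. unfold om, w, h, W, H; simpl. repeat split; try lra.
    replace (A + (B - A) / 1) with B by field. replace (C + (D - C) / 1) with D by field. lra.
  - destruct IH as (i1 & i2 & i3 & i4 & i5).
    destruct (goursat_halves n) as (e1 & e2 & e3 & e4).
    set (z := corner n) in *. change (corner (S n)) with (step z n).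
    assert (E := rect_integral_split (fst z) (fst z + w n) (snd z) (snd z + h n)
      (fst z + w (S n)) (snd z + h (S n)) ltac:(lra) ltac:(lra) ltac:(lra) ltac:(lra)
      ltac:(lra) ltac:(lra) ltac:(lra) ltac:(lra)).
    unfold step.
    destruct (Rle_dec _ _) as [l1|l1]. simpl; repeat split; try lra. exact l1.
    destruct (Rle_dec _ _) as [l2|l2]. simpl; repeat split; try lra. exact l2.
    destruct (Rle_dec _ _) as [l3|l3]. simpl; repeat split; try lra. exact l3.
    assert (l4 : K / 4 ^ S n <= Rabs (om (fst z + w (S n), snd z + h (S n)) (S n))).
    { unfold om in *; simpl fst in *; simpl snd in *.
      replace (fst z + w (S n) + w (S n)) with (fst z + w n) in * by lra.
      replace (snd z + h (S n) + h (S n)) with (snd z + h n) in * by lra.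
      rewrite E in i5.
      assert (4 * (K / 4 ^ S n) = K / 4 ^ n).
      { simpl. field. apply pow_nonzero. lra. }
      match type of i5 with _ <= Rabs (?a + ?b + ?c + ?d) =>
        pose proof (Rabs_triang (a + b + c) d); pose proof (Rabs_triang (a + b) c);
        pose proof (Rabs_triang a b) end.
      lra. }
    simpl; repeat split; try lra. exact l4.
Qed.

Lemma goursat_mono (n : nat) :
  fst (corner n) <= fst (corner (S n)) /\ snd (corner n) <= snd (corner (S n)) /\
  fst (corner (S n)) + w (S n) <= fst (corner n) + w n /\
  snd (corner (S n)) + h (S n) <= snd (corner n) + h n.
Proof.
  destruct (goursat_halves n) as (e1 & e2 & e3 & e4).
  set (z := corner n). change (corner (S n)) with (step z n).
  unfold step. repeat destruct (Rle_dec _ _); simpl; lra.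
Qed.

Lemma goursat_bound_contra : 0 < K -> K <= Rabs (rect_integral P Q A B C D) -> False.
Proof.
  intros hK0 hK.
  assert (wp : forall n, 0 <= w n) by (intros n; destruct (goursat_halves n); lra).
  assert (hp : forall n, 0 <= h n) by (intros n; destruct (goursat_halves n); lra).
  destruct (nested_point (fun n => fst (corner n)) w) as [x0 Hx]; [apply goursat_mono..|exact wp|].
  destruct (nested_point (fun n => snd (corner n)) h) as [y0 Hy]; [apply goursat_mono..|exact hp|].
  assert (hx0 : A <= x0 <= B).
  { pose proof (Hx O). destruct (goursat_inv O hK). lra. }
  assert (hy0 : C <= y0 <= D).
  { pose proof (Hy O). destruct (goursat_inv O hK) as (_ & _ & ? & ? & _). lra. }
  destruct (HG x0 y0 hx0 hy0) as (px & m & qy & HD).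
  assert (hS : 0 < (W + H) ^ 2) by (apply pow_lt; unfold W, H; lra).
  (* With this tolerance the local estimate bounds the n-th boundary integral by half of K / 4^n,
     against the invariant that it is at least K / 4^n. *)
  destruct (HD (K / (4 * (W + H) ^ 2))) as (delta & hd & Hd).
  { apply Rdiv_lt_0_compat; lra. }
  assert (hn : exists n, w n <= delta /\ h n <= delta).
  { destruct (nfloor_ex ((W + H) / delta)) as [N [_ HN]].
    apply Rdiv_le_0_compat; unfold W, H; lra.
    exists N. assert (hN : INR N + 1 <= 2 ^ N).
    { clear. induction N. simpl; lra. rewrite S_INR. simpl.
      assert (1 <= 2 ^ N) by (apply pow_R1_Rle; lra). lra. }
    assert (hh : (W + H) / 2 ^ N <= delta).
    { apply Rmult_le_reg_r with (2 ^ N). apply pow_lt; lra.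
      unfold Rdiv. rewrite Rmult_assoc, Rinv_l, Rmult_1_r by (apply pow_nonzero; lra).
      assert ((W + H) / delta <= 2 ^ N) by lra.
      apply Rmult_le_compat_r with (r := delta) in H0; [|lra].
      replace ((W + H) / delta * delta) with (W + H) in H0 by (field; lra). lra. }
    assert (0 < 2 ^ N) by (apply pow_lt; lra).
    assert (0 < / 2 ^ N) by (apply Rinv_0_lt_compat; lra).
    unfold w, h. unfold Rdiv in *.
    assert (0 < W) by (unfold W; lra). assert (0 < H) by (unfold H; lra).
    split; nra. }
  destruct hn as [n [hw hh]].
  destruct (goursat_inv n hK) as (i1 & i2 & i3 & i4 & i5).
  pose proof (Hx n). pose proof (Hy n). pose proof (wp n). pose proof (hp n).
  assert (L := rect_integral_local P Q (fst (corner n)) (fst (corner n) + w n) (snd (corner n))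
    (snd (corner n) + h n) x0 y0 (K / (4 * (W + H) ^ 2)) delta px m qy).
  fold (om (corner n) n) in L.
  assert (L' : Rabs (om (corner n) n) <= 2 * (K / (4 * (W + H) ^ 2)) * (w n + h n) ^ 2).
  { replace (w n + h n) with (fst (corner n) + w n - fst (corner n) + (snd (corner n) + h n - snd (corner n))) by ring.
    apply L; try lra.
    apply goursat_ex_P; lra. apply goursat_ex_Q; lra.
    apply Rdiv_le_0_compat; lra. exact Hd. }
  replace (2 * (K / (4 * (W + H) ^ 2)) * (w n + h n) ^ 2) with (K / 4 ^ n / 2) in L'.
  assert (0 < K / 4 ^ n). { apply Rdiv_lt_0_compat. lra. apply pow_lt; lra. }
  lra.
  unfold w, h. replace (W / 2 ^ n + H / 2 ^ n) with ((W + H) / 2 ^ n) by (unfold Rdiv; ring).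
  replace (4 ^ n) with (2 ^ n * 2 ^ n) by (rewrite <- Rpow_mult_distr; f_equal; ring).
  field. split. apply pow_nonzero; lra. unfold W, H; lra.
Qed.
End Goursat.

Theorem goursat_rectangle (P Q : R -> R -> R) (A B C D : R) : A < B -> C < D ->
  (forall x y, A <= x <= B -> C <= y <= D -> goursat_at P Q x y) ->
  rect_integral P Q A B C D = 0.
Proof.
  intros hAB hCD HG. destruct (Req_dec (rect_integral P Q A B C D) 0) as [E|E]. exact E.
  exfalso. apply (goursat_bound_contra P Q A B C D hAB hCD HG (Rabs (rect_integral P Q A B C D))).
  apply Rabs_pos_lt, E. lra.
Qed.

(** * The complex exponential and holomorphic functions *)

Lemma C_ext (z w : C) : Re z = Re w -> Im z = Im w -> z = w.
Proof. destruct z, w; simpl; intros -> ->; reflexivity. Qed.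

Ltac C_parts := apply C_ext; simpl; try ring.

Lemma Cmod_le_parts (z : C) : Cmod z <= Rabs (Re z) + Rabs (Im z).
Proof.
  unfold Cmod. change (fst z) with (Re z). change (snd z) with (Im z).
  pose proof (Rabs_pos (Re z)). pose proof (Rabs_pos (Im z)).
  rewrite <- (sqrt_square (Rabs (Re z) + Rabs (Im z))) by lra.
  apply sqrt_le_1_alt. rewrite <- !Rsqr_pow2, (Rsqr_abs (Re z)), (Rsqr_abs (Im z)).
  unfold Rsqr. nra.
Qed.

Lemma Im_le_Cmod (z : C) : Rabs (Im z) <= Cmod z.
Proof. pose proof (Rmax_Cmod z). pose proof (Rmax_r (Rabs (fst z)) (Rabs (snd z))). unfold Im. lra. Qed.

Lemma Re_le_Cmod (z : C) : Rabs (Re z) <= Cmod z.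
Proof. apply re_le_Cmod. Qed.

Lemma cexp_plus (z w : C) : cexp (z + w) = (cexp z * cexp w)%C.
Proof.
  unfold cexp. rewrite re_plus, im_plus. rewrite exp_plus, cos_plus, sin_plus.
  C_parts.
Qed.

Lemma cexp_RtoC (x : R) : cexp (RtoC x) = RtoC (exp x).
Proof. unfold cexp. simpl. rewrite cos_0, sin_0. C_parts. Qed.

Lemma cexp_0 : cexp (RtoC 0) = RtoC 1.
Proof. rewrite cexp_RtoC, exp_0. reflexivity. Qed.

Lemma Cmod_cexp (z : C) : Cmod (cexp z) = exp (Re z).
Proof.
  unfold cexp, Cmod. simpl fst; simpl snd.
  replace ((exp (Re z) * cos (Im z)) ^ 2 + (exp (Re z) * sin (Im z)) ^ 2)
    with (Rsqr (exp (Re z)) * (Rsqr (sin (Im z)) + Rsqr (cos (Im z)))) by (unfold Rsqr; ring).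
  rewrite sin2_cos2, Rmult_1_r. apply sqrt_Rsqr. left; apply exp_pos.
Qed.

Lemma cexp_nz (z : C) : cexp z <> RtoC 0.
Proof. apply Cmod_gt_0. rewrite Cmod_cexp. apply exp_pos. Qed.

Lemma cexp_opp (z : C) : cexp (- z) = (/ cexp z)%C.
Proof.
  assert (H : (cexp (- z) * cexp z)%C = RtoC 1).
  { rewrite <- cexp_plus. replace (- z + z)%C with (RtoC 0) by ring. apply cexp_0. }
  rewrite <- (Cmult_1_r (cexp (- z))), <- (Cinv_r (cexp z)) by apply cexp_nz.
  rewrite Cmult_assoc, H. ring.
Qed.

Lemma exp_sub_1_abs (x : R) : Rabs (exp x - 1) <= Rabs x * exp (Rabs x).
Proof.
  pose proof (exp_ineq1_le x). pose proof (exp_ineq1_le (- x)). rewrite exp_Ropp in *.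
  pose proof (exp_pos x).
  assert (exp x - 1 <= x * exp x).
  { apply (Rmult_le_compat_r (exp x)) in H0; [|lra]. rewrite Rinv_l in H0 by lra. lra. }
  pose proof (exp_ineq1_le (Rabs x)). pose proof (Rabs_pos x).
  unfold Rabs at 2 3. destruct (Rcase_abs x).
  - assert (exp x < 1) by (rewrite <- exp_0; apply exp_increasing; lra).
    rewrite Rabs_left1 by lra.
    rewrite exp_Ropp. assert (1 <= / exp x).
    { rewrite <- Rinv_1. apply Rinv_le_contravar; lra. }
    nra.
  - rewrite Rabs_pos_eq; lra.
Qed.

Lemma exp_quad (x : R) : Rabs (exp x - 1 - x) <= x * x * exp (Rabs x).
Proof.
  pose proof (exp_ineq1_le x). pose proof (exp_ineq1_le (- x)). rewrite exp_Ropp in *.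
  pose proof (exp_pos x).
  assert (exp x - 1 <= x * exp x).
  { apply (Rmult_le_compat_r (exp x)) in H0; [|lra]. rewrite Rinv_l in H0 by lra. lra. }
  rewrite Rabs_pos_eq by lra.
  apply Rle_trans with (x * (exp x - 1)). lra.
  apply Rle_trans with (Rabs (x * (exp x - 1))). apply Rle_abs.
  rewrite Rabs_mult. replace (x * x * exp (Rabs x)) with (Rabs x * (Rabs x * exp (Rabs x))).
  apply Rmult_le_compat_l. apply Rabs_pos. apply exp_sub_1_abs.
  rewrite <- Rmult_assoc. f_equal. rewrite <- Rabs_mult. apply Rabs_pos_eq. nra.
Qed.

Lemma sin_abs_le (x : R) : Rabs (sin x) <= Rabs x.
Proof.
  destruct (Rtotal_order x 0) as [h|[->|h]].
  - pose proof (sin_lt_x (- x) ltac:(lra)). rewrite sin_neg in H.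
    destruct (Rle_dec (- x) PI).
    + pose proof (sin_ge_0 (- x) ltac:(lra) ltac:(lra)). rewrite sin_neg in H0.
      rewrite !Rabs_left1 by lra. lra.
    + pose proof PI2_3_2. pose proof (SIN_bound x). rewrite (Rabs_left1 x) by lra.
      apply Rabs_le. lra.
  - rewrite sin_0, Rabs_R0. lra.
  - pose proof (sin_lt_x x h). destruct (Rle_dec x PI).
    + pose proof (sin_ge_0 x ltac:(lra) ltac:(lra)). rewrite !Rabs_pos_eq by lra. lra.
    + pose proof PI2_3_2. pose proof (SIN_bound x). rewrite (Rabs_pos_eq x) by lra.
      apply Rabs_le. lra.
Qed.

Lemma cos_sub_1 (y : R) : Rabs (cos y - 1) <= y * y / 2.
Proof.
  replace y with (2 * (y / 2)) at 1 by field. rewrite cos_2a_sin.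
  replace (1 - 2 * sin (y / 2) * sin (y / 2) - 1) with (- (2 * (Rsqr (sin (y / 2))))) by (unfold Rsqr; ring).
  rewrite Rabs_Ropp, Rabs_pos_eq by (pose proof (Rle_0_sqr (sin (y/2))); lra).
  pose proof (Rsqr_le_abs_1 _ _ (sin_abs_le (y / 2))). unfold Rsqr in *. lra.
Qed.

Lemma sin_sub_id (y : R) : Rabs (sin y - y) <= y * y.
Proof.
  destruct (MVT_gen sin 0 y cos) as [c [Hc E]].
  - intros x _. apply is_derive_Reals. apply derivable_pt_lim_sin.
  - intros x _. apply continuity_pt_filterlim, ex_derive_continuous_R. auto_derive. auto.
  - rewrite sin_0, !Rminus_0_r in E. rewrite E.
    replace (cos c * y - y) with ((cos c - 1) * y) by ring. rewrite Rabs_mult.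
    assert (Rabs c <= Rabs y).
    { destruct (Rle_dec 0 y).
      - rewrite Rmin_left, Rmax_right in Hc by lra. rewrite !Rabs_pos_eq; lra.
      - rewrite Rmin_right, Rmax_left in Hc by lra. rewrite !Rabs_left1; lra. }
    assert (Rabs (cos c - 1) <= Rabs c).
    { destruct (Rle_dec (Rabs c) 2).
      - eapply Rle_trans. apply cos_sub_1. rewrite <- (Rabs_pos_eq (c * c)) by nra.
        rewrite Rabs_mult. pose proof (Rabs_pos c). nra.
      - pose proof (COS_bound c). apply Rle_trans with 2. apply Rabs_le; lra. lra. }
    replace (y * y) with (Rabs y * Rabs y).
    apply Rmult_le_compat_r. apply Rabs_pos. lra.
    rewrite <- Rabs_mult. apply Rabs_pos_eq. nra.
Qed.

Lemma Cmod_sqr (z : C) : Cmod z * Cmod z = Re z * Re z + Im z * Im z.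
Proof. pose proof (Cmod2_alt z). simpl in H. lra. Qed.

(** The bound is explicit in z, with its growth, since [cpow_quad] uses it at z = - h ln u for all
    the bases u of a zeta series, where z is unbounded. *)
Lemma cexp_quad (z : C) : Cmod (cexp z - 1 - z) <= 3 * (Cmod z * Cmod z) * exp (Cmod z).
Proof.
  rewrite Cmod_sqr.
  eapply Rle_trans. apply Cmod_le_parts.
  set (x := Re z). set (y := Im z).
  replace (Re (cexp z - 1 - z)) with ((exp x - 1 - x) * cos y + (1 + x) * (cos y - 1))
    by (unfold cexp; destruct z; simpl in *; unfold x, y; ring).
  replace (Im (cexp z - 1 - z)) with ((exp x - 1) * sin y + (sin y - y))
    by (unfold cexp; destruct z; simpl in *; unfold x, y; ring).
  assert (E1 : exp (Rabs x) <= exp (Cmod z)).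
  { destruct (Re_le_Cmod z) as [h|h]. left; apply exp_increasing, h. right; f_equal; exact h. }
  pose proof (exp_quad x). pose proof (cos_sub_1 y). pose proof (sin_sub_id y). pose proof (exp_sub_1_abs x).
  pose proof (sin_abs_le y). pose proof (exp_ineq1_le (Rabs x)). pose proof (Rabs_pos x). pose proof (Rabs_pos y).
  assert (Rabs (cos y) <= 1) by (apply Rabs_le; pose proof (COS_bound y); lra).
  assert (Rabs (1 + x) <= exp (Rabs x)).
  { eapply Rle_trans. apply Rabs_triang. rewrite Rabs_R1. lra. }
  assert (A1 : Rabs ((exp x - 1 - x) * cos y + (1 + x) * (cos y - 1)) <= x * x * exp (Rabs x) + exp (Rabs x) * (y * y / 2)).
  { eapply Rle_trans. apply Rabs_triang. rewrite !Rabs_mult. apply Rplus_le_compat.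
    - rewrite <- (Rmult_1_r (x * x * exp (Rabs x))). apply Rmult_le_compat; try apply Rabs_pos; lra.
    - apply Rmult_le_compat; try apply Rabs_pos; lra. }
  assert (A2 : Rabs ((exp x - 1) * sin y + (sin y - y)) <= Rabs x * exp (Rabs x) * Rabs y + y * y).
  { eapply Rle_trans. apply Rabs_triang. rewrite !Rabs_mult. apply Rplus_le_compat; [|lra].
    apply Rmult_le_compat; try apply Rabs_pos; lra. }
  set (e := exp (Rabs x)) in *. set (E := exp (Cmod z)) in *.
  assert (hx : x * x = Rabs x * Rabs x) by (rewrite <- Rabs_mult; symmetry; apply Rabs_pos_eq; nra).
  assert (hy : y * y = Rabs y * Rabs y) by (rewrite <- Rabs_mult; symmetry; apply Rabs_pos_eq; nra).
  rewrite hx, hy in *. set (p := Rabs x) in *. set (q := Rabs y) in *.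
  assert (1 <= e) by lra.
  apply Rle_trans with (3 * (p * p + q * q) * e).
  2: { apply Rmult_le_compat_l; nra. }
  assert (p * q <= (p * p + q * q) / 2) by (pose proof (Rle_0_sqr (p - q)) as hpq; unfold Rsqr in hpq; lra).
  assert (p * e * q <= (p * p + q * q) / 2 * e) by (replace (p * e * q) with (p * q * e) by ring; apply Rmult_le_compat_r; lra).
  assert (q * q <= q * q * e) by nra.
  assert (0 <= p * p * e) by nra. assert (0 <= q * q * e) by nra. lra.
Qed.

(** Complex differentiability as linear approximation: without a quotient, h = 0 is no exception,
    and sums, products and compositions reduce to norm estimates. *)
Definition holo (f : C -> C) (w : C) : Prop :=
  exists l : C, forall eps, 0 < eps -> exists delta, 0 < delta /\ forall h : C,
    Cmod h <= delta -> Cmod (f (w + h)%C - f w - l * h) <= eps * Cmod h.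

Lemma C_differentiable_holo (f : C -> C) (w : C) : C_differentiable f w <-> holo f w.
Proof.
  split; intros [l H]; exists l.
  - intros eps heps.
    (* The balls of [C] are squares: each coordinate is controlled by eps / 2, the modulus by the
       sum of both. *)
    destruct (H (ball l (mkposreal (eps / 2) ltac:(lra))) (locally_ball l _)) as [d Hd].
    exists (d / 2). split. pose proof (cond_pos d); lra.
    intros h hh.
    destruct (Ceq_dec h (RtoC 0)) as [->|hne].
    { rewrite Cplus_0_r. replace (f w - f w - l * 0)%C with (RtoC 0) by ring.
      rewrite Cmod_0. lra. }
    assert (hb : ball (RtoC 0 : C_UniformSpace) d h).
    { pose proof (Re_le_Cmod h). pose proof (Im_le_Cmod h). pose proof (cond_pos d).
      split; unfold ball; simpl; unfold AbsRing_ball, abs, minus, plus, opp; simpl;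
      rewrite Ropp_0, Rplus_0_r; change (fst h) with (Re h); change (snd h) with (Im h); lra. }
    specialize (Hd h hb hne). destruct Hd as [B1 B2].
    unfold ball in B1, B2; simpl in B1, B2; unfold AbsRing_ball, abs, minus, plus, opp in B1, B2; simpl in B1, B2.
    set (q := ((f (w + h)%C - f w) / h)%C) in *.
    replace (f (w + h)%C - f w - l * h)%C with ((q - l) * h)%C by (unfold q; field; exact hne).
    rewrite Cmod_mult. apply Rmult_le_compat_r. apply Cmod_ge_0.
    eapply Rle_trans. apply Cmod_le_parts.
    change (Rabs (Re (q - l)) < eps / 2) in B1. change (Rabs (Im (q - l)) < eps / 2) in B2. lra.
  - intros P [e HP].
    destruct (H (e / 2)) as (d & hd & Hd). pose proof (cond_pos e); lra.
    exists (mkposreal (d / 2) ltac:(lra)). intros h [B1 B2] hne. apply HP.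
    unfold ball in B1, B2; simpl in B1, B2; unfold AbsRing_ball, abs, minus, plus, opp in B1, B2; simpl in B1, B2.
    rewrite Ropp_0, Rplus_0_r in B1, B2.
    change (Rabs (Re h) < d / 2) in B1. change (Rabs (Im h) < d / 2) in B2.
    pose proof (Cmod_le_parts h).
    specialize (Hd h ltac:(lra)).
    set (q := ((f (w + h)%C - f w) / h)%C) in *.
    replace (f (w + h)%C - f w - l * h)%C with ((q - l) * h)%C in Hd by (unfold q; field; exact hne).
    rewrite Cmod_mult in Hd. apply Rmult_le_reg_r in Hd; [|apply Cmod_gt_0, hne].
    pose proof (cond_pos e). pose proof (Re_le_Cmod (q - l)). pose proof (Im_le_Cmod (q - l)).
    change (Rabs (Re (q - l)) < e /\ Rabs (Im (q - l)) < e). lra.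
Qed.

Lemma holo_local_bound (f : C -> C) (w : C) : holo f w ->
  exists delta K, 0 < delta /\ 0 <= K /\ forall h, Cmod h <= delta -> Cmod (f (w + h)%C - f w) <= K * Cmod h.
Proof.
  intros [l H]. destruct (H 1 Rlt_0_1) as (d & hd & Hd).
  exists d, (1 + Cmod l). pose proof (Cmod_ge_0 l). repeat split; try lra. intros h hh.
  replace (f (w + h)%C - f w)%C with ((f (w + h)%C - f w - l * h) + l * h)%C by ring.
  eapply Rle_trans. apply Cmod_triangle. rewrite Cmod_mult. specialize (Hd h hh). lra.
Qed.

Lemma holo_ext_loc (f g : C -> C) (w : C) (r : R) : 0 < r ->
  (forall h, Cmod h <= r -> f (w + h)%C = g (w + h)%C)%C -> holo f w -> holo g w.
Proof.
  intros hr E [l H]. exists l. intros eps heps. destruct (H eps heps) as (d & hd & Hd).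
  exists (Rmin d r). split. apply Rmin_pos; lra. intros h hh.
  pose proof (Rmin_l d r). pose proof (Rmin_r d r).
  rewrite <- E by lra. replace (g w) with (f w). apply Hd; lra.
  specialize (E (RtoC 0)). rewrite Cplus_0_r in E. apply E. rewrite Cmod_0; lra.
Qed.

Lemma holo_const (c w : C) : holo (fun _ => c) w.
Proof.
  exists (RtoC 0). intros eps heps. exists 1. split. lra. intros h _.
  replace (c - c - 0 * h)%C with (RtoC 0) by ring. rewrite Cmod_0. pose proof (Cmod_ge_0 h). nra.
Qed.

Lemma holo_affine (a b w : C) : holo (fun z => a * z + b)%C w.
Proof.
  exists a. intros eps heps. exists 1. split. lra. intros h _.
  replace (a * (w + h) + b - (a * w + b) - a * h)%C with (RtoC 0) by ring.
  rewrite Cmod_0. pose proof (Cmod_ge_0 h). nra.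
Qed.

Lemma holo_plus (f g : C -> C) (w : C) : holo f w -> holo g w -> holo (fun z => f z + g z)%C w.
Proof.
  intros [l H] [m G]. exists (l + m)%C. intros eps heps.
  destruct (H (eps/2)) as (d & hd & Hd). lra. destruct (G (eps/2)) as (e & he & He). lra.
  exists (Rmin d e). split. apply Rmin_pos; lra. intros h hh.
  pose proof (Rmin_l d e). pose proof (Rmin_r d e).
  replace (f (w + h)%C + g (w + h)%C - (f w + g w) - (l + m) * h)%C
    with ((f (w + h)%C - f w - l * h) + (g (w + h)%C - g w - m * h))%C by ring.
  eapply Rle_trans. apply Cmod_triangle.
  specialize (Hd h ltac:(lra)). specialize (He h ltac:(lra)). lra.
Qed.

Lemma holo_mult (f g : C -> C) (w : C) : holo f w -> holo g w -> holo (fun z => f z * g z)%C w.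
Proof.
  intros Hf Hg. destruct (holo_local_bound g w Hg) as (d0 & K & hd0 & hK & HK).
  destruct Hf as [l H], Hg as [m G]. exists (l * g w + f w * m)%C. intros eps heps.
  pose proof (Cmod_ge_0 l). pose proof (Cmod_ge_0 (g w)). pose proof (Cmod_ge_0 (f w)).
  (* S collects the coefficients of the three error terms below, so that e = eps / (2 S) keeps their
     sum within eps / 2 times |h|. *)
  set (S := Cmod (g w) + K * d0 + Cmod (f w) + Cmod l * K + 1).
  assert (hS : 0 < S) by (unfold S; nra).
  set (e := eps / (2 * S)). assert (he : 0 < e) by (apply Rdiv_lt_0_compat; lra).
  destruct (H e he) as (d1 & hd1 & HH1). destruct (G e he) as (d2 & hd2 & HH2).
  exists (Rmin (Rmin d0 e) (Rmin d1 d2)). split. repeat apply Rmin_pos; lra. intros h hh.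
  pose proof (Rmin_l (Rmin d0 e) (Rmin d1 d2)). pose proof (Rmin_r (Rmin d0 e) (Rmin d1 d2)).
  pose proof (Rmin_l d0 e). pose proof (Rmin_r d0 e). pose proof (Rmin_l d1 d2). pose proof (Rmin_r d1 d2).
  specialize (HH1 h ltac:(lra)). specialize (HH2 h ltac:(lra)). specialize (HK h ltac:(lra)).
  pose proof (Cmod_ge_0 h).
  replace (f (w + h)%C * g (w + h)%C - f w * g w - (l * g w + f w * m) * h)%C
    with ((f (w + h)%C - f w - l * h) * g (w + h)%C + f w * (g (w + h)%C - g w - m * h)
          + l * h * (g (w + h)%C - g w))%C by ring.
  assert (Bg : Cmod (g (w + h)%C) <= Cmod (g w) + K * d0).
  { replace (g (w + h)%C) with (g w + (g (w + h)%C - g w))%C by ring.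
    eapply Rle_trans. apply Cmod_triangle. nra. }
  eapply Rle_trans. apply Cmod_triangle.
  eapply Rle_trans. apply Rplus_le_compat_r, Cmod_triangle. rewrite !Cmod_mult.
  set (x := Cmod h) in *.
  assert (T1 : Cmod (f (w + h)%C - f w - l * h) * Cmod (g (w + h)%C) <= e * x * (Cmod (g w) + K * d0)).
  { apply Rmult_le_compat; try apply Cmod_ge_0; assumption. }
  assert (T2 : Cmod (f w) * Cmod (g (w + h)%C - g w - m * h) <= Cmod (f w) * (e * x)).
  { apply Rmult_le_compat_l; assumption. }
  assert (T3 : Cmod l * x * Cmod (g (w + h)%C - g w) <= Cmod l * x * (K * e)).
  { apply Rmult_le_compat_l. nra. nra. }
  assert (e * S = eps / 2) by (unfold e; field; lra).
  assert (e * x * (Cmod (g w) + K * d0) + Cmod (f w) * (e * x) + Cmod l * x * (K * e) <= e * S * x).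
  { unfold S. assert (0 <= e * x) by nra. nra. }
  nra.
Qed.

Lemma holo_comp (g f : C -> C) (w : C) : holo f w -> holo g (f w) -> holo (fun z => g (f z)) w.
Proof.
  intros Hf Hg. destruct (holo_local_bound f w Hf) as (d0 & K & hd0 & hK & HK).
  destruct Hf as [l H], Hg as [m G]. exists (m * l)%C. intros eps heps.
  pose proof (Cmod_ge_0 m).
  set (S := K + Cmod m + 1). assert (hS : 0 < S) by (unfold S; lra).
  set (e := eps / S). assert (he : 0 < e) by (apply Rdiv_lt_0_compat; lra).
  destruct (H e he) as (d1 & hd1 & HH1). destruct (G e he) as (d2 & hd2 & HH2).
  exists (Rmin (Rmin d0 d1) (d2 / (K + 1))). split.
  repeat apply Rmin_pos; try lra. apply Rdiv_lt_0_compat; lra. intros h hh.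
  pose proof (Rmin_l (Rmin d0 d1) (d2 / (K + 1))). pose proof (Rmin_r (Rmin d0 d1) (d2 / (K + 1))).
  pose proof (Rmin_l d0 d1). pose proof (Rmin_r d0 d1).
  specialize (HH1 h ltac:(lra)). specialize (HK h ltac:(lra)). pose proof (Cmod_ge_0 h).
  set (k := (f (w + h)%C - f w)%C) in *.
  assert (hk : Cmod k <= d2).
  { eapply Rle_trans. exact HK.
    assert (Cmod h * (K + 1) <= d2).
    { replace d2 with (d2 / (K + 1) * (K + 1)) by (field; lra). apply Rmult_le_compat_r; lra. }
    nra. }
  specialize (HH2 k hk). replace (f w + k)%C with (f (w + h)%C) in HH2 by (unfold k; ring).
  replace (g (f (w + h)%C) - g (f w) - m * l * h)%C
    with ((g (f (w + h)%C) - g (f w) - m * k) + m * (k - l * h))%C by ring.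
  eapply Rle_trans. apply Cmod_triangle. rewrite Cmod_mult.
  assert (e * Cmod k <= e * (K * Cmod h)) by (apply Rmult_le_compat_l; lra).
  assert (Cmod m * Cmod (k - l * h) <= Cmod m * (e * Cmod h)) by (apply Rmult_le_compat_l; lra).
  assert (e * S = eps) by (unfold e; field; lra).
  assert (e * (K * Cmod h) + Cmod m * (e * Cmod h) <= e * S * Cmod h).
  { unfold S. assert (0 <= e * Cmod h) by nra. nra. }
  nra.
Qed.

Lemma quad_holo (f : C -> C) (w l : C) (d M : R) : 0 < d -> 0 <= M ->
  (forall h, Cmod h <= d -> Cmod (f (w + h)%C - f w - l * h) <= M * (Cmod h * Cmod h)) -> holo f w.
Proof.
  intros hd hM H. exists l. intros eps heps. exists (Rmin d (eps / (M + 1))).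
  assert (0 < eps / (M + 1)) by (apply Rdiv_lt_0_compat; lra).
  split. apply Rmin_pos; lra. intros h hh.
  pose proof (Rmin_l d (eps / (M + 1))). pose proof (Rmin_r d (eps / (M + 1))).
  specialize (H h ltac:(lra)). eapply Rle_trans. exact H.
  pose proof (Cmod_ge_0 h). rewrite <- Rmult_assoc. apply Rmult_le_compat_r. lra.
  assert (Cmod h * (M + 1) <= eps).
  { replace eps with (eps / (M + 1) * (M + 1)) by (field; lra). apply Rmult_le_compat_r; lra. }
  nra.
Qed.

Lemma holo_cexp (w : C) : holo cexp w.
Proof.
  apply (quad_holo cexp w (cexp w) 1 (exp (Re w) * (3 * exp 1))). lra.
  pose proof (exp_pos (Re w)). pose proof (exp_pos 1). nra.
  intros h hh. rewrite cexp_plus.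
  replace (cexp w * cexp h - cexp w - cexp w * h)%C with (cexp w * (cexp h - 1 - h))%C by ring.
  rewrite Cmod_mult, Cmod_cexp. pose proof (exp_pos (Re w)).
  rewrite Rmult_assoc. apply Rmult_le_compat_l. lra.
  eapply Rle_trans. apply cexp_quad.
  assert (exp (Cmod h) <= exp 1). { destruct hh as [hh| ->]. left; apply exp_increasing, hh. lra. }
  pose proof (Cmod_ge_0 h). assert (0 <= Cmod h * Cmod h) by nra.
  nra.
Qed.

Lemma holo_inv (w : C) : w <> RtoC 0 -> holo Cinv w.
Proof.
  intros hw. assert (h0 : 0 < Cmod w) by (apply Cmod_gt_0, hw).
  apply (quad_holo Cinv w (- / (w * w))%C (Cmod w / 2) (2 / (Cmod w * Cmod w * Cmod w))).
  lra. apply Rdiv_le_0_compat. lra. repeat apply Rmult_lt_0_compat; assumption.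
  intros h hh.
  assert (hl : Cmod w / 2 <= Cmod (w + h)).
  { assert (Cmod w <= Cmod (w + h) + Cmod h).
    { replace w with ((w + h) + - h)%C at 1 by ring. eapply Rle_trans. apply Cmod_triangle.
      rewrite Cmod_opp. lra. }
    lra. }
  assert (hn : (w + h)%C <> RtoC 0) by (apply Cmod_gt_0; lra).
  replace (/ (w + h) - / w - - / (w * w) * h)%C with ((h * h) / (w * w * (w + h)))%C by (field; split; assumption).
  rewrite Cmod_div by (repeat apply Cmult_neq_0; assumption). rewrite !Cmod_mult.
  unfold Rdiv. rewrite (Rmult_comm (2 * _)). apply Rmult_le_compat_l. pose proof (Cmod_ge_0 h); nra.
  replace (2 * / (Cmod w * Cmod w * Cmod w)) with (/ (Cmod w * Cmod w * (Cmod w / 2))) by (field; lra).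
  apply Rinv_le_contravar. repeat apply Rmult_lt_0_compat; lra.
  apply Rmult_le_compat_l; [nra|exact hl].
Qed.

(** * The identity theorem *)

Lemma holo_goursat (f : C -> C) (x y : R) : holo f (x, y) ->
  goursat_at (fun x y => Re (f (x, y))) (fun x y => - Im (f (x, y))) x y /\
  goursat_at (fun x y => Im (f (x, y))) (fun x y => Re (f (x, y))) x y.
Proof.
  intros [l H].
  assert (K : forall eps, 0 < eps -> exists delta, 0 < delta /\ forall u v,
    Rabs (u - x) <= delta -> Rabs (v - y) <= delta ->
    Rabs (Re (f (u, v)) - Re (f (x, y)) - (Re l * (u - x) - Im l * (v - y))) <= eps * (Rabs (u - x) + Rabs (v - y)) /\
    Rabs (Im (f (u, v)) - Im (f (x, y)) - (Re l * (v - y) + Im l * (u - x))) <= eps * (Rabs (u - x) + Rabs (v - y))).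
  { intros eps heps. destruct (H eps heps) as (d & hd & Hd). exists (d / 2). split. lra.
    intros u v hu hv. set (h := (u - x, v - y) : C).
    assert (hm : Cmod h <= Rabs (u - x) + Rabs (v - y)) by apply Cmod_le_parts.
    specialize (Hd h ltac:(lra)).
    replace ((x, y) + h)%C with ((u, v) : C) in Hd by (unfold h; C_parts).
    assert (eps * Cmod h <= eps * (Rabs (u - x) + Rabs (v - y))) by (apply Rmult_le_compat_l; lra).
    pose proof (Re_le_Cmod (f (u, v) - f (x, y) - l * h)) as E1.
    pose proof (Im_le_Cmod (f (u, v) - f (x, y) - l * h)) as E2.
    split.
    - replace (Re (f (u, v)) - Re (f (x, y)) - (Re l * (u - x) - Im l * (v - y)))
        with (Re (f (u, v) - f (x, y) - l * h)) by (unfold h; simpl; unfold Re, Im; ring). lra.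
    - replace (Im (f (u, v)) - Im (f (x, y)) - (Re l * (v - y) + Im l * (u - x)))
        with (Im (f (u, v) - f (x, y) - l * h)) by (unfold h; simpl; unfold Re, Im; ring). lra. }
  split.
  - exists (Re l), (- Im l), (- Re l). intros eps heps. destruct (K eps heps) as (d & hd & Hd).
    exists d. split. exact hd. intros u v hu hv. destruct (Hd u v hu hv) as [E1 E2]. split.
    + eapply Rle_trans; [|exact E1]. right. f_equal. ring.
    + eapply Rle_trans; [|exact E2]. rewrite <- Rabs_Ropp. right. f_equal. ring.
  - exists (Im l), (Re l), (- Im l). intros eps heps. destruct (K eps heps) as (d & hd & Hd).
    exists d. split. exact hd. intros u v hu hv. destruct (Hd u v hu hv) as [E1 E2]. split.
    + eapply Rle_trans; [|exact E2]. right. f_equal. ring.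
    + eapply Rle_trans; [|exact E1]. right. f_equal. ring.
Qed.

Lemma holo_continuous_vert (f : C -> C) (x y : R) : holo f (x, y) ->
  continuous (fun y => Re (f (x, y))) y /\ continuous (fun y => Im (f (x, y))) y.
Proof.
  intros H. destruct (holo_goursat f x y H) as [H1 H2].
  split. apply (goursat_at_continuous _ _ _ _ H1). apply (goursat_at_continuous _ _ _ _ H2).
Qed.

(** On a rectangle one period high the two horizontal sides cancel, and Goursat's theorem leaves
    equality of the vertical ones. *)
Lemma periodic_vertical_integral (f : C -> C) (A B : R) : A < B ->
  (forall x y, A <= x <= B -> 0 <= y <= 1 -> holo f (x, y)) ->
  (forall x, A <= x <= B -> f (x, 1) = f (x, 0)) ->
  RInt (fun y => Re (f (B, y))) 0 1 = RInt (fun y => Re (f (A, y))) 0 1 /\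
  RInt (fun y => Im (f (B, y))) 0 1 = RInt (fun y => Im (f (A, y))) 0 1.
Proof.
  intros hAB H per.
  assert (E1 := goursat_rectangle _ _ A B 0 1 hAB Rlt_0_1 (fun x y hx hy => proj1 (holo_goursat f x y (H x y hx hy)))).
  assert (E2 := goursat_rectangle _ _ A B 0 1 hAB Rlt_0_1 (fun x y hx hy => proj2 (holo_goursat f x y (H x y hx hy)))).
  unfold rect_integral in E1, E2.
  assert (Z : forall g : R -> R, (forall x, A <= x <= B -> g x = 0) -> RInt g A B = 0).
  { intros g hg. apply is_RInt_unique_R. apply (is_RInt_ext_R (fun _ => 0)). lra.
    intros t ht. symmetry. apply hg. lra.
    apply is_RInt_0_R. }
  rewrite Z in E1 by (intros x hx; rewrite (per x hx); ring).
  rewrite Z in E2 by (intros x hx; rewrite (per x hx); ring).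
  assert (D : forall u, A <= u <= B -> ex_RInt (fun y => Re (f (u, y))) 0 1 /\ ex_RInt (fun y => Im (f (u, y))) 0 1).
  { intros u hu. split; apply continuous_on_ex_RInt; try lra; intros t ht;
    apply (holo_continuous_vert f u t), H; assumption. }
  assert (hA : A <= A <= B) by lra. assert (hB : A <= B <= B) by lra.
  assert (F1 : is_RInt (fun y => - Im (f (B, y)) - - Im (f (A, y))) 0 1
     (RInt (fun y => Im (f (A, y))) 0 1 - RInt (fun y => Im (f (B, y))) 0 1)).
  { apply (is_RInt_eq_R (fun y => Im (f (A, y)) - Im (f (B, y)))). intros; ring.
    apply is_RInt_minus_R; apply RInt_correct_R; [exact (proj2 (D A hA))|exact (proj2 (D B hB))]. }
  assert (F2 : is_RInt (fun y => Re (f (B, y)) - Re (f (A, y))) 0 1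
     (RInt (fun y => Re (f (B, y))) 0 1 - RInt (fun y => Re (f (A, y))) 0 1)).
  { apply (is_RInt_minus_R (fun y => Re (f (B, y))) (fun y => Re (f (A, y)))); apply RInt_correct_R;
    [exact (proj1 (D B hB))|exact (proj1 (D A hA))]. }
  rewrite (is_RInt_unique_R _ _ _ _ F1) in E1. rewrite (is_RInt_unique_R _ _ _ _ F2) in E2.
  lra.
Qed.

Lemma polar_form (z : C) : 0 < Cmod z ->
  exists x0, 0 <= x0 <= 1 /\ z = cexp (ln (Cmod z), 2 * PI * x0).
Proof.
  intros hz. set (r := Cmod z) in *. pose proof PI_RGT_0.
  assert (hs : Re z * Re z + Im z * Im z = r * r) by (unfold r; rewrite Cmod_sqr; reflexivity).
  assert (hb : -1 <= Re z / r <= 1).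
  { pose proof (Re_le_Cmod z) as hR. fold r in hR. apply Rabs_le_between in hR.
    split; apply Rmult_le_reg_r with r; try lra; unfold Rdiv; rewrite Rmult_assoc, Rinv_l by lra; lra. }
  set (p := acos (Re z / r)). pose proof (acos_bound (Re z / r)) as hp. fold p in hp.
  assert (hc : r * cos p = Re z).
  { unfold p. rewrite cos_acos by exact hb. field. lra. }
  assert (hq : r * sin p = Rabs (Im z)).
  { assert (0 <= sin p) by (apply sin_ge_0; lra).
    rewrite <- (Rabs_pos_eq (r * sin p)) by (apply Rmult_le_pos; lra).
    apply Rsqr_eq_abs_0. unfold Rsqr.
    pose proof (sin2_cos2 p) as T. unfold Rsqr in T. 
    assert (r * sin p * (r * sin p) = r * r - (r * cos p) * (r * cos p)).
    { replace (r * sin p * (r * sin p)) with (r * r * (sin p * sin p)) by ring.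
      replace (sin p * sin p) with (1 - cos p * cos p) by lra. ring. }
    rewrite hc in H1. lra. }
  destruct (Rle_dec 0 (Im z)) as [hi|hi].
  - exists (p / (2 * PI)). split.
    + split. apply Rdiv_le_0_compat; lra.
      apply Rmult_le_reg_r with (2 * PI). lra. unfold Rdiv. rewrite Rmult_assoc, Rinv_l by lra. lra.
    + unfold cexp; simpl. rewrite exp_ln by lra.
      replace (2 * PI * (p / (2 * PI))) with p by (field; lra).
      rewrite hc, hq, Rabs_pos_eq by lra. destruct z; reflexivity.
  (* The arccosine determines the angle only up to sign; in the lower half plane the angle is 2 pi -
     p. *)
  - exists (1 - p / (2 * PI)). split.
    + assert (0 <= p / (2 * PI)) by (apply Rdiv_le_0_compat; lra).
      assert (p / (2 * PI) <= 1).
      { apply Rmult_le_reg_r with (2 * PI). lra. unfold Rdiv. rewrite Rmult_assoc, Rinv_l by lra. lra. }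
      lra.
    + unfold cexp; simpl. rewrite exp_ln by lra.
      replace (2 * PI * (1 - p / (2 * PI))) with (- p + 2 * INR 1 * PI) by (simpl; field; lra).
      rewrite cos_period, sin_period, cos_neg, sin_neg.
      rewrite hc. replace (r * - sin p) with (- (r * sin p)) by ring.
      rewrite hq, Rabs_left by lra. rewrite Ropp_involutive. destruct z; reflexivity.
Qed.

Lemma cexp_period (z : C) (n : nat) : cexp (z + RtoC (2 * PI * INR n) * Ci) = cexp z.
Proof.
  unfold cexp. destruct z as [x y]. simpl.
  replace (x + (2 * PI * INR n * 0 - 0 * 1)) with x by ring.
  replace (y + (2 * PI * INR n * 1 + 0 * 0)) with (y + 2 * INR n * PI) by ring.
  rewrite cos_period, sin_period. reflexivity.
Qed.

(* In the coordinate z with w = c + exp (2 pi z), the circles around c are vertical segments.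
   Multiplying by exp (2 pi n (z - z0)) + exp (- 2 pi n (z - z0)) keeps the function holomorphic and
   periodic, so its vertical integrals agree with those on a small circle, which vanish: all
   Fourier coefficients on the big circle are zero. *)
Lemma identity_disc (g : C -> C) (c : C) (rho R0 : R) : 0 < rho ->
  (forall w, Cmod (w - c) < R0 -> holo g w) ->
  (forall w, Cmod (w - c) < rho -> g w = RtoC 0) ->
  forall w, Cmod (w - c) < R0 -> g w = RtoC 0.
Proof.
  intros hrho Hh Hz w hw.
  destruct (Rlt_dec (Cmod (w - c)) rho) as [hlt|hge]. apply Hz, hlt.
  set (r := Cmod (w - c)) in *.
  assert (hr : 0 < r) by lra.
  destruct (polar_form (w - c) hr) as (x0 & hx0 & Hw). fold r in Hw.
  pose proof PI_RGT_0 as hPI.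
  set (B0 := ln r / (2 * PI)). set (A0 := ln (rho / 2) / (2 * PI)).
  assert (hAB : A0 < B0).
  { unfold A0, B0. apply Rmult_lt_compat_r. apply Rinv_0_lt_compat; lra. apply ln_increasing; lra. }
  set (E := fun z : C => (c + cexp (RtoC (2 * PI) * z))%C).
  assert (hE : forall x y, Cmod (E (x, y) - c) = exp (2 * PI * x)).
  { intros x y. unfold E. replace (c + cexp (RtoC (2 * PI) * (x, y)) - c)%C with (cexp (RtoC (2 * PI) * (x, y))) by ring.
    rewrite Cmod_cexp. f_equal. simpl. ring. }
  assert (hEB : exp (2 * PI * B0) = r).
  { unfold B0. replace (2 * PI * (ln r / (2 * PI))) with (ln r) by (field; lra). apply exp_ln, hr. }
  assert (hEA : exp (2 * PI * A0) = rho / 2).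
  { unfold A0. replace (2 * PI * (ln (rho/2) / (2 * PI))) with (ln (rho/2)) by (field; lra). apply exp_ln; lra. }
  assert (holE : forall z, holo E z).
  { intros z. unfold E. apply holo_plus. apply holo_const.
    apply (holo_comp cexp (fun z => RtoC (2 * PI) * z)%C).
    apply (holo_ext_loc (fun z => RtoC (2 * PI) * z + 0)%C _ z 1). lra. intros; ring. apply holo_affine.
    apply holo_cexp. }
  assert (holgE : forall x y, x <= B0 -> holo (fun z => g (E z)) (x, y)).
  { intros x y hx. apply (holo_comp g E). apply holE. apply Hh. rewrite hE.
    apply Rle_lt_trans with (exp (2 * PI * B0)). 2: rewrite hEB; exact hw.
    destruct hx as [hx| ->]; [|lra]. left. apply exp_increasing. nra. }
  assert (perE : forall x, E (x, 1) = E (x, 0)).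
  { intros x. unfold E. f_equal.
    rewrite <- (cexp_period (RtoC (2 * PI) * (x, 0)) 1). f_equal. simpl. C_parts. }
  set (z0 := (B0, x0) : C).
  set (k := fun (n : nat) (z : C) => (cexp (RtoC (2 * PI * INR n) * (z - z0)) + cexp (RtoC (2 * PI * INR n) * (z0 - z)))%C).
  assert (holk : forall n z, holo (k n) z).
  { intros n z. unfold k. apply holo_plus.
    - apply (holo_comp cexp (fun z => RtoC (2 * PI * INR n) * (z - z0))%C). 2: apply holo_cexp.
      apply (holo_ext_loc (fun z => RtoC (2 * PI * INR n) * z + - (RtoC (2 * PI * INR n) * z0))%C _ z 1). lra.
      intros; ring. apply holo_affine.
    - apply (holo_comp cexp (fun z => RtoC (2 * PI * INR n) * (z0 - z))%C). 2: apply holo_cexp.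
      apply (holo_ext_loc (fun z => - RtoC (2 * PI * INR n) * z + (RtoC (2 * PI * INR n) * z0))%C _ z 1). lra.
      intros; ring. apply holo_affine. }
  assert (perk : forall n x, k n (x, 1) = k n (x, 0)).
  { intros n x. unfold k. f_equal.
    - rewrite <- (cexp_period (RtoC (2 * PI * INR n) * ((x, 0) - z0)) n). f_equal. C_parts.
    - rewrite <- (cexp_period (RtoC (2 * PI * INR n) * (z0 - (x, 1))) n). f_equal. C_parts. }
  assert (kB : forall n y, k n (B0, y) = RtoC (2 * cos (2 * PI * INR n * (x0 - y)))).
  { intros n y. unfold k, z0, cexp. simpl.
    replace (2 * PI * INR n * (B0 + - B0) - 0 * (y + - x0)) with 0 by ring.
    replace (2 * PI * INR n * (B0 + - B0) - 0 * (x0 + - y)) with 0 by ring.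
    replace (2 * PI * INR n * (y + - x0) + 0 * (B0 + - B0)) with (- (2 * PI * INR n * (x0 - y))) by ring.
    replace (2 * PI * INR n * (x0 + - y) + 0 * (B0 + - B0)) with (2 * PI * INR n * (x0 - y)) by ring.
    rewrite exp_0, cos_neg, sin_neg. C_parts. }
  assert (I : forall n, RInt (fun y => 2 * (Re (g (E (B0, y))) * cos (2 * PI * INR n * (x0 - y)))) 0 1 = 0 /\
                        RInt (fun y => 2 * (Im (g (E (B0, y))) * cos (2 * PI * INR n * (x0 - y)))) 0 1 = 0).
  { intros n.
    destruct (periodic_vertical_integral (fun z => g (E z) * k n z)%C A0 B0 hAB) as [I1 I2].
    - intros x y hx hy. apply holo_mult. apply holgE; lra. apply holk.
    - intros x hx. rewrite perE, perk. reflexivity.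
    - assert (ZA : forall y, (g (E (A0, y)) * k n (A0, y))%C = RtoC 0).
      { intros y. rewrite Hz. ring. rewrite hE, hEA. lra. }
      assert (Z0 : RInt (fun _ : R => 0) 0 1 = 0).
      { apply is_RInt_unique_R, is_RInt_0_R. }
      split.
      + rewrite (RInt_ext_R _ (fun y => Re (g (E (B0, y)) * k n (B0, y))%C)).
        rewrite I1. rewrite (RInt_ext_R _ (fun _ => 0)). exact Z0.
        intros y. rewrite ZA. reflexivity.
        intros y. rewrite kB. rewrite re_scal_r. ring.
      + rewrite (RInt_ext_R _ (fun y => Im (g (E (B0, y)) * k n (B0, y))%C)).
        rewrite I2. rewrite (RInt_ext_R _ (fun _ => 0)). exact Z0.
        intros y. rewrite ZA. reflexivity.
        intros y. rewrite kB. rewrite im_scal_r. ring. }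
  assert (F : forall f : R -> R, (forall t, continuous f t) -> f 0 = f 1 ->
    (forall n, RInt (fun y => 2 * (f y * cos (2 * PI * INR n * (x0 - y)))) 0 1 = 0) -> f x0 = 0).
  { intros f fc f01 Hf.
    assert (Hc : forall n, RInt (fun y => f y * cos (2 * PI * INR n * (x0 - y))) 0 1 = 0).
    { intros n. pose proof (Hf n) as T.
      rewrite (is_RInt_unique_R _ _ _ _ (is_RInt_scal_R _ 0 1 2 _
        (continuous_is_RInt (fun y => f y * cos (2 * PI * INR n * (x0 - y))) 0 1
         (fun t => continuous_fcos f x0 fc _ t)))) in T. lra. }
    rewrite (fourier_pointwise f x0 0 fc f01 hx0).
    - rewrite (RInt_f0 f x0). unfold cos_coeff. rewrite Hc. ring.
    - apply (is_series_ext_R (fun _ => 0)). intros n. symmetry. apply Hc.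
      exact is_series_0_R. }
  assert (hEw : E (B0, x0) = w).
  { unfold E. replace (RtoC (2 * PI) * (B0, x0))%C with ((ln r, 2 * PI * x0) : C).
    rewrite <- Hw. ring. unfold B0. apply C_ext; simpl; field; lra. }
  rewrite <- hEw.
  assert (cont := fun y => holo_continuous_vert _ _ _ (holgE B0 y (Rle_refl _))).
  apply C_ext.
  - apply (F (fun y => Re (g (E (B0, y))))). intros t; exact (proj1 (cont t)). rewrite perE; reflexivity. apply I.
  - apply (F (fun y => Im (g (E (B0, y))))). intros t; exact (proj2 (cont t)). rewrite perE; reflexivity. apply I.
Qed.


(** The pole 1 lies between the half plane of convergence and p, so two discs centred at height T =
    4 - p pass above it. The disc around 2 + i T contains the unit disc around p + i T, since 2 - p
    + 1 < T; the disc around p + i T then reaches down to p. *)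
Theorem identity_punctured_plane (g : C -> C) (p : R) : p < 0 ->
  (forall w, w <> RtoC 1 -> holo g w) -> (forall w, 1 < Re w -> g w = RtoC 0) -> g (RtoC p) = RtoC 0.
Proof.
  intros hp Hh Hz.
  set (T := 4 - p).
  set (c1 := (2, T) : C). set (c2 := (p, T) : C).
  assert (L : forall (c : C) (r : R), 0 <= r -> r * r <= (Re c - 1) * (Re c - 1) + Im c * Im c ->
    forall w, Cmod (w - c) < r -> holo g w).
  { intros c r hr hc w hw. apply Hh. intros ->.
    assert (Cmod (1 - c) * Cmod (1 - c) < r * r) by (pose proof (Cmod_ge_0 (1 - c)); nra).
    rewrite Cmod_sqr in H. destruct c as [u v]; simpl in *. nra. }
  assert (G1 : forall w, Cmod (w - c1) < T -> g w = RtoC 0).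
  { apply (identity_disc g c1 1 T). lra.
    - apply L. unfold T; lra. simpl. nra.
    - intros w hw. apply Hz. pose proof (Re_le_Cmod (w - c1)) as E. unfold Cminus in E. rewrite re_plus, re_opp in E.
      apply Rabs_le_between in E. change (Re c1) with 2 in E. unfold Cminus in hw. lra. }
  (* The point p is at distance exactly T from the centre, so the radius has to exceed T, but by so
     little that 1 stays outside: its squared distance is T^2 + (T - 3)^2, at least T^2 + 1. *)
  apply (identity_disc g c2 1 (T + 1 / (4 * T))).
  - lra.
  - apply L. assert (0 < / (4 * T)) by (apply Rinv_0_lt_compat; unfold T; lra). unfold T at 1; unfold Rdiv; lra.
    simpl. assert (hT : 4 <= T) by (unfold T; lra).
    replace ((T + 1 / (4 * T)) * (T + 1 / (4 * T))) with (T * T + 1 / 2 + (/ (4 * T)) * (/ (4 * T))) by (field; lra).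
    replace (p - 1) with (- (T - 3)) by (unfold T; ring).
    assert (/ (4 * T) <= / 16) by (apply Rinv_le_contravar; lra).
    assert (0 < / (4 * T)) by (apply Rinv_0_lt_compat; lra).
    assert (/ (4 * T) * / (4 * T) <= / 16 * / 16) by (apply Rmult_le_compat; lra).
    assert (hT2 : T = 4 - p) by reflexivity. nra.
  - intros w hw. apply G1.
    replace (w - c1)%C with ((w - c2) + (c2 - c1))%C by ring.
    eapply Rle_lt_trans. apply Cmod_triangle.
    assert (Cmod (c2 - c1) <= 2 - p).
    { eapply Rle_trans. apply Cmod_le_parts. simpl.
      rewrite Rabs_left1 by lra. replace (T + - T) with 0 by ring. rewrite Rabs_R0. lra. }
    unfold T. lra.
  - apply Rle_lt_trans with T.
    + eapply Rle_trans. apply Cmod_le_parts. simpl. replace (p + - p) with 0 by ring.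
      rewrite Rabs_R0, Rabs_left1 by (unfold T; lra). lra.
    + assert (0 < / (4 * T)) by (apply Rinv_0_lt_compat; unfold T; lra). unfold Rdiv; lra.
Qed.

(** * Uniformly dominated series *)

Lemma ex_series_pos_bounded (a : nat -> R) (M : R) :
  (forall n, 0 <= a n) -> (forall n, sum_n a n <= M) -> ex_series a.
Proof.
  intros H1 H2.
  destruct (ex_finite_lim_seq_incr (sum_n a) M) as [l Hl].
  - intros n. rewrite sum_n_S_R. specialize (H1 (S n)). lra.
  - exact H2.
  - exists l. exact Hl.
Qed.


Lemma sum_n_le_Series (a : nat -> R) (n : nat) :
  (forall n, 0 <= a n) -> ex_series a -> sum_n a n <= Series a.
Proof.
  intros H E. apply (is_lim_seq_incr_compare (sum_n a)).
  - exact (Series_correct _ E).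
  - intros m. rewrite sum_n_S_R. specialize (H (S m)). lra.
Qed.


Lemma tail_bound (a c : nat -> R) (n : nat) : (forall k, Rabs (a k) <= c k) -> ex_series c ->
  Rabs (Series a - sum_n a n) <= Series c - sum_n c n.
Proof.
  intros H E.
  assert (Ea : ex_series a) by (apply (ex_series_le_R a c H E)).
  assert (K : forall b, ex_series b -> Series b - sum_n b n = Series (fun k => b (S n + k)%nat)).
  { intros b Eb. rewrite (Series_incr_n b (S n)) by (lia || assumption). simpl pred.
    rewrite sum_n_Reals. ring. }
  rewrite !K by assumption.
  assert (E' : ex_series (fun k => c (S n + k)%nat)) by (apply (ex_series_incr_n (V := R_NormedModule)); assumption).
  eapply Rle_trans.
  - apply Series_Rabs. apply (ex_series_le_R _ (fun k => c (S n + k)%nat)); [|exact E'].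
    intros k. rewrite Rabs_Rabsolu. apply H.
  - apply Series_le; [|exact E']. intros k. split. apply Rabs_pos. apply H.
Qed.

Lemma Series_abs_le (a c : nat -> R) : (forall k, Rabs (a k) <= c k) -> ex_series c ->
  Rabs (Series a) <= Series c.
Proof.
  intros H E. eapply Rle_trans.
  - apply Series_Rabs. apply (ex_series_le_R _ c); [|exact E]. intros k. rewrite Rabs_Rabsolu. apply H.
  - apply Series_le; [|exact E]. intros k. split. apply Rabs_pos. apply H.
Qed.

Lemma tail_small (c : nat -> R) (eps : R) : 0 < eps -> ex_series c ->
  exists N, forall n, (N <= n)%nat -> Rabs (Series c - sum_n c n) < eps.
Proof.
  intros he E. assert (H : is_lim_seq (sum_n c) (Series c)) by exact (Series_correct c E).
  apply is_lim_seq_spec in H. destruct (H (mkposreal eps he)) as [N HN].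
  exists N. intros n hn. rewrite Rabs_minus_sym. apply (HN n hn).
Qed.

Lemma continuous_eps (f : R -> R) (t0 : R) :
  (forall eps, 0 < eps -> exists d, 0 < d /\ forall t, Rabs (t - t0) < d -> Rabs (f t - f t0) < eps) ->
  continuous f t0.
Proof.
  intros H. apply continuity_pt_filterlim. intros eps he. destruct (H eps he) as (d & hd & Hd).
  exists d. split. exact hd. intros t [_ ht]. apply Hd. exact ht.
Qed.

Lemma continuous_eps_inv (f : R -> R) (t0 eps : R) : continuous f t0 -> 0 < eps ->
  exists d, 0 < d /\ forall t, Rabs (t - t0) < d -> Rabs (f t - f t0) < eps.
Proof.
  intros H he. apply continuity_pt_filterlim in H. destruct (H eps he) as (d & hd & Hd).
  exists d. split. exact hd. intros t ht. destruct (Req_dec t t0) as [->|hne].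
  rewrite Rminus_diag, Rabs_R0. exact he.
  apply Hd. split. split. exact I. auto. exact ht.
Qed.

Lemma sum_n_continuous (f : nat -> R -> R) (t0 : R) (n : nat) :
  (forall n, continuous (f n) t0) -> continuous (fun t => sum_n (fun k => f k t) n) t0.
Proof.
  intros H. induction n.
  - apply (continuous_ext_R (f O)). intros t. rewrite sum_O. reflexivity. apply H.
  - apply (continuous_ext_R (fun t => sum_n (fun k => f k t) n + f (S n) t)).
    intros t. rewrite sum_n_S_R. reflexivity. apply continuous_plus_R; auto.
Qed.

Lemma series_continuous (f : nat -> R -> R) (c : nat -> R) (t0 d : R) : 0 < d ->
  (forall n, continuous (f n) t0) -> (forall n t, Rabs (t - t0) < d -> Rabs (f n t) <= c n) ->
  ex_series c -> continuous (fun t => Series (fun n => f n t)) t0.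
Proof.
  intros hd Hc Hb E. apply continuous_eps. intros eps he.
  destruct (tail_small c (eps / 3) ltac:(lra) E) as [N HN]. specialize (HN N (le_n N)).
  destruct (continuous_eps_inv _ t0 (eps / 3) (sum_n_continuous f t0 N Hc) ltac:(lra)) as (d' & hd' & Hd').
  exists (Rmin d d'). split. apply Rmin_pos; lra. intros t ht.
  pose proof (Rmin_l d d'). pose proof (Rmin_r d d').
  pose proof (tail_bound (fun n => f n t) c N (fun n => Hb n t ltac:(lra)) E) as T1.
  assert (h0 : Rabs (t0 - t0) < d) by (rewrite Rminus_diag, Rabs_R0; lra).
  pose proof (tail_bound (fun n => f n t0) c N (fun n => Hb n t0 h0) E) as T2.
  specialize (Hd' t ltac:(lra)).
  pose proof (Rle_abs (Series c - sum_n c N)).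
  replace (Series (fun n => f n t) - Series (fun n => f n t0)) with
    ((Series (fun n => f n t) - sum_n (fun n => f n t) N)
     - (Series (fun n => f n t0) - sum_n (fun n => f n t0) N)
     + (sum_n (fun n => f n t) N - sum_n (fun n => f n t0) N)) by ring.
  eapply Rle_lt_trans. apply Rabs_triang.
  eapply Rle_lt_trans. apply Rplus_le_compat_r. apply Rabs_triang. rewrite Rabs_Ropp. lra.
Qed.

Lemma is_RInt_sum_n (f : nat -> R -> R) (l : nat -> R) (a b : R) (n : nat) :
  (forall n, is_RInt (f n) a b (l n)) -> is_RInt (fun t => sum_n (fun k => f k t) n) a b (sum_n l n).
Proof.
  intros H. induction n.
  - rewrite sum_O. apply (is_RInt_eq_R (f O)). intros t. rewrite sum_O. reflexivity. apply H.
  - rewrite sum_n_S_R. apply (is_RInt_eq_R (fun t => sum_n (fun k => f k t) n + f (S n) t)).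
    intros t. rewrite sum_n_S_R. reflexivity. apply is_RInt_plus_R; auto.
Qed.

(** The common end of the exchanges of a series with an integral and with another series: the
    remainder is dominated by the tail of a fixed convergent series. *)
Lemma is_series_of_tail (a c : nat -> R) (l K : R) : 0 <= K ->
  (forall n, Rabs (l - sum_n a n) <= K * (Series c - sum_n c n)) -> ex_series c -> is_series a l.
Proof.
  intros hK H E. change (is_lim_seq (sum_n a) l). apply is_lim_seq_spec. intros eps.
  destruct (tail_small c (eps / (K + 1))) as [N HN]; [|exact E|].
  apply Rdiv_lt_0_compat; [apply cond_pos|lra].
  exists N. intros n hn. rewrite Rabs_minus_sym. eapply Rle_lt_trans. apply H.
  specialize (HN n hn). apply (Rmult_lt_compat_r (K + 1)) in HN; [|lra].
  replace (eps / (K + 1) * (K + 1)) with (pos eps) in HN by (field; lra).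
  pose proof (Rle_abs (Series c - sum_n c n)). pose proof (Rabs_pos (Series c - sum_n c n)). nra.
Qed.

Lemma series_RInt (f : nat -> R -> R) (c : nat -> R) (a b : R) : a <= b ->
  (forall n t, a <= t <= b -> continuous (f n) t) ->
  ex_RInt (fun t => Series (fun n => f n t)) a b ->
  (forall n t, a <= t <= b -> Rabs (f n t) <= c n) -> ex_series c ->
  is_series (fun n => RInt (f n) a b) (RInt (fun t => Series (fun n => f n t)) a b).
Proof.
  intros hab Hc HF Hb E. apply (is_series_of_tail _ c _ (b - a)). lra. 2: exact E.
  intros n.
  apply (is_RInt_abs_le (fun t => Series (fun n => f n t) - sum_n (fun k => f k t) n)
    (fun _ => Series c - sum_n c n) a b); auto.
  - intros t ht. apply tail_bound; auto.
  - apply is_RInt_minus_R. apply RInt_correct_R, HF. apply is_RInt_sum_n.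
    intros k. apply continuous_on_is_RInt; auto.
  - apply is_RInt_const_R.
Qed.

Lemma Rpower_pos (x y : R) : 0 < Rpower x y.
Proof. apply exp_pos. Qed.

Lemma Rpower_antitone (x y p : R) : 0 < x -> x <= y -> 0 <= p -> Rpower y (- p) <= Rpower x (- p).
Proof.
  intros hx hxy hp. unfold Rpower.
  assert (ln x <= ln y) by (destruct hxy as [h| ->]; [left; apply ln_increasing; lra|lra]).
  destruct (Rle_lt_or_eq_dec (- p * ln y) (- p * ln x)). nra. left; apply exp_increasing; assumption.
  rewrite e; lra.
Qed.

(** A discrete integral test: with e = p - 1 the term of index n + 1 is at most the decrease of
    u^(-e) / e from u = n + a to u + 1, and these decreases telescope. *)
Lemma ex_series_Rpower (a p : R) : 0 < a -> 1 < p -> ex_series (fun n => Rpower (INR n + a) (- p)).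
Proof.
  intros ha hp. set (e := p - 1). assert (he : 0 < e) by (unfold e; lra).
  apply (ex_series_incr_1 (V := R_NormedModule) (fun n => Rpower (INR n + a) (- p))).
  apply (ex_series_pos_bounded _ (Rpower a (- e) / e)).
  { intros n. left. apply Rpower_pos. }
  assert (K : forall n, Rpower (INR (S n) + a) (- p) <= (Rpower (INR n + a) (- e) - Rpower (INR (S n) + a) (- e)) / e).
  { intros n. rewrite S_INR. set (u := INR n + a). replace (INR n + 1 + a) with (u + 1) by (unfold u; ring).
    assert (hu : 0 < u) by (unfold u; pose proof (pos_INR n); lra).
    replace (- p) with (- e + Ropp 1) by (unfold e; ring). rewrite Rpower_plus.
    replace (Rpower (u + 1) (Ropp 1)) with (/ (u + 1)).
    2: { rewrite Rpower_Ropp, Rpower_1 by lra. reflexivity. }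
    (* The quotient of the two powers is exp (- e ln (u / (u + 1))); apply exp y >= 1 + y and ln y
       <= y - 1. *)
    assert (H : Rpower (u + 1) (- e) * (1 + e / (u + 1)) <= Rpower u (- e)).
    { replace (Rpower u (- e)) with (Rpower (u + 1) (- e) * Rpower (u / (u + 1)) (- e)).
      apply Rmult_le_compat_l. left; apply Rpower_pos.
      unfold Rpower at 1. eapply Rle_trans; [|apply exp_ineq1_le].
      pose proof (exp_ineq1_le (ln (u / (u + 1)))) as L. rewrite exp_ln in L by (apply Rdiv_lt_0_compat; lra).
      assert (ln (u / (u + 1)) <= - (1 / (u + 1))).
      { replace (- (1 / (u + 1))) with (u / (u + 1) - 1) by (field; lra). lra. }
      assert (e / (u + 1) = e * (1 / (u + 1))) by (field; lra). nra.
      rewrite Rpower_mult_distr by (lra || (apply Rdiv_lt_0_compat; lra)).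
      f_equal. field. lra. }
    apply Rmult_le_reg_r with e. lra. unfold Rdiv. rewrite (Rmult_assoc (_ - _)), Rinv_l, Rmult_1_r by lra.
    unfold Rdiv in H. lra. }
  intros n. apply Rle_trans with ((Rpower (INR 0 + a) (- e) - Rpower (INR (S n) + a) (- e)) / e).
  - induction n. rewrite sum_O. apply K. rewrite sum_n_S_R. specialize (K (S n)).
    unfold Rdiv in *. lra.
  - simpl (INR 0). rewrite Rplus_0_l. apply Rmult_le_compat_r. left; apply Rinv_0_lt_compat, he.
    pose proof (Rpower_pos (INR (S n) + a) (- e)). lra.
Qed.

Lemma is_series_C (a : nat -> C) (l : C) :
  is_series (K := C_AbsRing) (V := C_NormedModule) a l <->
  is_series (fun n => Re (a n)) (Re l) /\ is_series (fun n => Im (a n)) (Im l).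
Proof.
  assert (S : forall n, Re (sum_n (G := C_AbelianMonoid) a n) = sum_n (fun n => Re (a n)) n /\ Im (sum_n (G := C_AbelianMonoid) a n) = sum_n (fun n => Im (a n)) n).
  { induction n as [|n [IH1 IH2]]. rewrite !sum_O; auto.
    rewrite (sum_Sn (G := C_AbelianMonoid)), !sum_n_S_R, <- IH1, <- IH2. split; reflexivity. }
  split.
  - intros H. split.
    + change (is_lim_seq (sum_n (fun n => Re (a n))) (Re l)). apply is_lim_seq_spec. intros eps. destruct (H _ (locally_ball (l : C_UniformSpace) eps)) as [N HN].
      exists N. intros n hn. destruct (HN n hn) as [B1 _]. rewrite <- (proj1 (S n)). exact B1.
    + change (is_lim_seq (sum_n (fun n => Im (a n))) (Im l)). apply is_lim_seq_spec. intros eps. destruct (H _ (locally_ball (l : C_UniformSpace) eps)) as [N HN].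
      exists N. intros n hn. destruct (HN n hn) as [_ B1]. rewrite <- (proj2 (S n)). exact B1.
  - intros [H1 H2] P [eps HP]. change (is_lim_seq (sum_n (fun n => Re (a n))) (Re l)) in H1.
    change (is_lim_seq (sum_n (fun n => Im (a n))) (Im l)) in H2. apply is_lim_seq_spec in H1. apply is_lim_seq_spec in H2.
    destruct (H1 eps) as [N1 HN1]. destruct (H2 eps) as [N2 HN2].
    exists (max N1 N2). intros n hn. apply HP.
    specialize (HN1 n ltac:(lia)). specialize (HN2 n ltac:(lia)).
    rewrite <- (proj1 (S n)) in HN1. rewrite <- (proj2 (S n)) in HN2. split. exact HN1. exact HN2.
Qed.

Definition CSeries (a : nat -> C) : C := (Series (fun n => Re (a n)), Series (fun n => Im (a n))).

Lemma CSeries_correct (a : nat -> C) (c : nat -> R) : (forall n, Cmod (a n) <= c n) -> ex_series c ->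
  is_series (K := C_AbsRing) (V := C_NormedModule) a (CSeries a).
Proof.
  intros H E. apply is_series_C. split; apply Series_correct; apply (ex_series_le_R _ c); auto;
  intros n; eapply Rle_trans; try apply H. apply Re_le_Cmod. apply Im_le_Cmod.
Qed.

(** The factor 2 is the price of bounding the two coordinates separately. It is harmless: the later
    uses need only the order in h or summability. *)
Lemma CSeries_bound (a : nat -> C) (c : nat -> R) : (forall n, Cmod (a n) <= c n) -> ex_series c ->
  Cmod (CSeries a) <= 2 * Series c.
Proof.
  intros H E. eapply Rle_trans. apply Cmod_le_parts. unfold CSeries; simpl.
  assert (Rabs (Series (fun n => Re (a n))) <= Series c).
  { apply Series_abs_le; auto. intros n. eapply Rle_trans. apply Re_le_Cmod. auto. }
  assert (Rabs (Series (fun n => Im (a n))) <= Series c).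
  { apply Series_abs_le; auto. intros n. eapply Rle_trans. apply Im_le_Cmod. auto. }
  unfold Re, Im in *. simpl. lra.
Qed.

(** * Complex series, integrals and powers *)

Notation is_seriesC := (is_series (K := C_AbsRing) (V := C_NormedModule)).


Lemma is_seriesC_scal (c : C) (a : nat -> C) (l : C) :
  is_seriesC a l -> is_seriesC (fun n => c * a n)%C (c * l)%C.
Proof. exact (is_series_scal (K := C_AbsRing) (V := C_NormedModule) c a l). Qed.

Lemma is_seriesC_minus (a b : nat -> C) (la lb : C) :
  is_seriesC a la -> is_seriesC b lb -> is_seriesC (fun n => a n - b n)%C (la - lb)%C.
Proof. exact (is_series_minus (K := C_AbsRing) (V := C_NormedModule) a b la lb). Qed.

Lemma is_seriesC_ext (a b : nat -> C) (l : C) :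
  (forall n, a n = b n) -> is_seriesC a l -> is_seriesC b l.
Proof. exact (is_series_ext (K := C_AbsRing) (V := C_NormedModule) a b l). Qed.

Lemma is_seriesC_unique (a : nat -> C) (l : C) : is_seriesC a l -> CSeries a = l.
Proof.
  intros H. apply is_series_C in H. destruct H as [H1 H2]. apply C_ext; apply is_series_unique; assumption.
Qed.

Lemma is_seriesC_bound (a : nat -> C) (c : nat -> R) (l : C) :
  is_seriesC a l -> (forall n, Cmod (a n) <= c n) -> ex_series c -> Cmod l <= 2 * Series c.
Proof. intros H. rewrite <- (is_seriesC_unique a l H). apply CSeries_bound. Qed.

(** * Continuity and integration of complex functions of a real variable *)

Definition cont_at (f : R -> C) (t : R) : Prop :=
  continuous (fun t => Re (f t)) t /\ continuous (fun t => Im (f t)) t.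

Lemma cont_at_plus (f g : R -> C) (t : R) : cont_at f t -> cont_at g t -> cont_at (fun t => f t + g t)%C t.
Proof. intros [H1 H2] [H3 H4]. split; apply continuous_plus_R; assumption. Qed.

Lemma cont_at_minus (f g : R -> C) (t : R) : cont_at f t -> cont_at g t -> cont_at (fun t => f t - g t)%C t.
Proof. intros [H1 H2] [H3 H4]. split; apply continuous_minus_R; assumption. Qed.

Lemma cont_at_mult (f g : R -> C) (t : R) : cont_at f t -> cont_at g t -> cont_at (fun t => f t * g t)%C t.
Proof.
  intros [H1 H2] [H3 H4]. split.
  - apply continuous_minus_R; apply continuous_mult_R; assumption.
  - apply continuous_plus_R; apply continuous_mult_R; assumption.
Qed.

Lemma cont_at_const (c : C) (t : R) : cont_at (fun _ => c) t.
Proof. split; apply continuous_const. Qed.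

Lemma cont_at_RtoC (f : R -> R) (t : R) : continuous f t -> cont_at (fun t => RtoC (f t)) t.
Proof. intros H. split. exact H. apply continuous_const. Qed.

Lemma cont_at_ext (f g : R -> C) (t : R) : (forall u, f u = g u) -> cont_at f t -> cont_at g t.
Proof.
  intros E [H1 H2]. split.
  apply (continuous_ext_R (fun t => Re (f t))); auto. intros; rewrite E; auto.
  apply (continuous_ext_R (fun t => Im (f t))); auto. intros; rewrite E; auto.
Qed.

Lemma cont_at_shift (f : R -> C) (u t : R) : cont_at f (u + t) -> cont_at (fun t => f (u + t)) t.
Proof.
  intros [H1 H2]. split.
  - apply (continuous_comp (fun t => u + t) (fun t => Re (f t))); [|exact H1].
    apply continuous_plus_R. apply continuous_const. apply continuous_id.
  - apply (continuous_comp (fun t => u + t) (fun t => Im (f t))); [|exact H2].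
    apply continuous_plus_R. apply continuous_const. apply continuous_id.
Qed.

Lemma continuous_bounded (f : R -> R) (a b : R) : a <= b -> (forall t, a <= t <= b -> continuous f t) ->
  exists K, 0 <= K /\ forall t, a <= t <= b -> Rabs (f t) <= K.
Proof.
  intros hab H.
  assert (H' : forall t, a <= t <= b -> continuity_pt f t) by (intros t ht; apply continuity_pt_filterlim, H, ht).
  destruct (continuity_ab_maj f a b hab H') as [mx [Hmx _]].
  destruct (continuity_ab_min f a b hab H') as [mn [Hmn _]].
  exists (Rabs (f mx) + Rabs (f mn)). pose proof (Rabs_pos (f mx)). pose proof (Rabs_pos (f mn)).
  split. lra. intros t ht. specialize (Hmx t ht). specialize (Hmn t ht).
  pose proof (Rle_abs (f mx)). pose proof (Rle_abs (- f mn)). rewrite Rabs_Ropp in *. apply Rabs_le. lra.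
Qed.

Lemma cont_at_bounded (f : R -> C) (a b : R) : a <= b -> (forall t, a <= t <= b -> cont_at f t) ->
  exists K, 0 <= K /\ forall t, a <= t <= b -> Cmod (f t) <= K.
Proof.
  intros hab H.
  destruct (continuous_bounded (fun t => Re (f t)) a b hab (fun t ht => proj1 (H t ht))) as (K1 & h1 & H1).
  destruct (continuous_bounded (fun t => Im (f t)) a b hab (fun t ht => proj2 (H t ht))) as (K2 & h2 & H2).
  exists (K1 + K2). split. lra. intros t ht. eapply Rle_trans. apply Cmod_le_parts.
  specialize (H1 t ht). specialize (H2 t ht). lra.
Qed.

Definition Cint (f : R -> C) (a b : R) : C := (RInt (fun t => Re (f t)) a b, RInt (fun t => Im (f t)) a b).

Section Cint.
Variables (a b : R).
Hypothesis hab : a <= b.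

Lemma Cint_ex (f : R -> C) : (forall t, a <= t <= b -> cont_at f t) ->
  is_RInt (fun t => Re (f t)) a b (Re (Cint f a b)) /\ is_RInt (fun t => Im (f t)) a b (Im (Cint f a b)).
Proof.
  intros H. split; (apply continuous_on_is_RInt; [exact hab|]); intros t ht.
  exact (proj1 (H t ht)). exact (proj2 (H t ht)).
Qed.

Lemma Cint_eq (f : R -> C) (l : C) : is_RInt (fun t => Re (f t)) a b (Re l) ->
  is_RInt (fun t => Im (f t)) a b (Im l) -> Cint f a b = l.
Proof. intros H1 H2. apply C_ext; apply is_RInt_unique_R; assumption. Qed.


Lemma Cint_minus (f g : R -> C) : (forall t, a <= t <= b -> cont_at f t) -> (forall t, a <= t <= b -> cont_at g t) ->
  Cint (fun t => f t - g t)%C a b = (Cint f a b - Cint g a b)%C.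
Proof.
  intros Hf Hg. destruct (Cint_ex f Hf), (Cint_ex g Hg).
  apply Cint_eq; apply is_RInt_minus_R; assumption.
Qed.

Lemma Cint_scal (c : C) (f : R -> C) : (forall t, a <= t <= b -> cont_at f t) ->
  Cint (fun t => c * f t)%C a b = (c * Cint f a b)%C.
Proof.
  intros Hf. destruct (Cint_ex f Hf) as [H1 H2]. apply Cint_eq.
  - apply is_RInt_minus_R; apply is_RInt_scal_R; assumption.
  - apply is_RInt_plus_R; apply is_RInt_scal_R; assumption.
Qed.

Lemma Cint_ext (f g : R -> C) : (forall t, a < t < b -> f t = g t) -> Cint f a b = Cint g a b.
Proof.
  intros H. apply C_ext; apply (RInt_ext (V := R_CompleteNormedModule)); intros t;
  rewrite Rmin_left, Rmax_right by assumption; intros ht; rewrite H; auto.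
Qed.

Lemma Cint_bound (f : R -> C) (M : R) : (forall t, a <= t <= b -> cont_at f t) ->
  (forall t, a <= t <= b -> Cmod (f t) <= M) -> Cmod (Cint f a b) <= 2 * M * (b - a).
Proof.
  intros Hf HM. destruct (Cint_ex f Hf) as [H1 H2]. eapply Rle_trans. apply Cmod_le_parts.
  pose proof (is_RInt_abs_le _ _ a b _ _ hab (fun t ht => Rle_trans _ _ _ (Re_le_Cmod (f t)) (HM t ht)) H1 (is_RInt_const_R M a b)).
  pose proof (is_RInt_abs_le _ _ a b _ _ hab (fun t ht => Rle_trans _ _ _ (Im_le_Cmod (f t)) (HM t ht)) H2 (is_RInt_const_R M a b)).
  lra.
Qed.

Definition Cder (F : R -> C) (t : R) (l : C) : Prop :=
  is_derive (fun t => Re (F t)) t (Re l) /\ is_derive (fun t => Im (F t)) t (Im l).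

Lemma Cint_FTC (F f : R -> C) : (forall t, a <= t <= b -> Cder F t (f t)) ->
  (forall t, a <= t <= b -> cont_at f t) -> Cint f a b = (F b - F a)%C.
Proof.
  intros H1 H2. apply Cint_eq.
  - apply (is_RInt_derive_R (fun t => Re (F t))); auto; intros t ht. exact (proj1 (H1 t ht)). exact (proj1 (H2 t ht)).
  - apply (is_RInt_derive_R (fun t => Im (F t))); auto; intros t ht. exact (proj2 (H1 t ht)). exact (proj2 (H2 t ht)).
Qed.

Lemma Cint_series (f : nat -> R -> C) (c : nat -> R) :
  (forall n t, a <= t <= b -> cont_at (f n) t) ->
  (forall t, a <= t <= b -> cont_at (fun t => CSeries (fun n => f n t)) t) ->
  (forall n t, a <= t <= b -> Cmod (f n t) <= c n) -> ex_series c ->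
  is_seriesC (fun n => Cint (f n) a b) (Cint (fun t => CSeries (fun n => f n t)) a b).
Proof.
  intros Hc HF Hb E. apply is_series_C. split.
  - apply (series_RInt (fun n t => Re (f n t)) c); auto. intros n t ht; exact (proj1 (Hc n t ht)).
    apply continuous_on_ex_RInt; auto. intros t ht; exact (proj1 (HF t ht)).
    intros n t ht. eapply Rle_trans. apply Re_le_Cmod. auto.
  - apply (series_RInt (fun n t => Im (f n t)) c); auto. intros n t ht; exact (proj2 (Hc n t ht)).
    apply continuous_on_ex_RInt; auto. intros t ht; exact (proj2 (HF t ht)).
    intros n t ht. eapply Rle_trans. apply Im_le_Cmod. auto.
Qed.
End Cint.

Lemma CSeries_cont (f : nat -> R -> C) (c : nat -> R) (t0 d : R) : 0 < d ->
  (forall n, cont_at (f n) t0) -> (forall n t, Rabs (t - t0) < d -> Cmod (f n t) <= c n) ->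
  ex_series c -> cont_at (fun t => CSeries (fun n => f n t)) t0.
Proof.
  intros hd Hc Hb E. split.
  - apply (series_continuous (fun n t => Re (f n t)) c t0 d); auto. intros n; exact (proj1 (Hc n)).
    intros n t ht. eapply Rle_trans. apply Re_le_Cmod. auto.
  - apply (series_continuous (fun n t => Im (f n t)) c t0 d); auto. intros n; exact (proj2 (Hc n)).
    intros n t ht. eapply Rle_trans. apply Im_le_Cmod. auto.
Qed.

(** * Complex powers and their quantitative dependence on the exponent *)

Lemma Cmod_cpow (u : R) (s : C) : Cmod (cpow u s) = Rpower u (Re s).
Proof. unfold cpow. rewrite Cmod_cexp, re_scal_r. reflexivity. Qed.

Lemma cpow_plus (u : R) (s z : C) : cpow u (s + z) = (cpow u s * cpow u z)%C.
Proof. unfold cpow. rewrite <- cexp_plus. f_equal. ring. Qed.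

Lemma cpow_INR (u : R) (n : nat) : 0 < u -> cpow u (RtoC (INR n)) = RtoC (u ^ n).
Proof.
  intros hu. unfold cpow. rewrite <- RtoC_mult, cexp_RtoC. f_equal.
  rewrite <- Rpower_pow by assumption. reflexivity.
Qed.

Lemma Cder_cpow (u t : R) (s : C) : 0 < u + t -> Cder (fun t => cpow (u + t) s) t (s * cpow (u + t) (s - 1))%C.
Proof.
  intros h. destruct s as [p q].
  assert (E : cpow (u + t) ((p, q) - 1) = (cpow (u + t) (p, q) * RtoC (/ (u + t)))%C).
  { unfold Cminus. rewrite cpow_plus. f_equal. unfold cpow. rewrite <- RtoC_opp, <- RtoC_mult, cexp_RtoC.
    f_equal. replace (Ropp 1 * ln (u + t)) with (- ln (u + t)) by ring. rewrite exp_Ropp, exp_ln by lra. reflexivity. }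
  rewrite E. unfold cpow, cexp. split; simpl; auto_derive; try lra;
  rewrite ?Rmult_0_r, ?Rminus_0_r, ?Ropp_0, ?Rplus_0_r; field; lra.
Qed.

Lemma Cder_cont (F : R -> C) (t : R) (l : C) : Cder F t l -> cont_at F t.
Proof. intros [H1 H2]. split; apply ex_derive_continuous_R. exists (Re l); exact H1. exists (Im l); exact H2. Qed.

Lemma cont_at_cpow (s : C) (t : R) : 0 < t -> cont_at (fun t => cpow t s) t.
Proof.
  intros h. apply (cont_at_ext (fun t => cpow (0 + t) s)). intros u; f_equal; ring.
  apply (Cder_cont _ _ _ (Cder_cpow 0 t s ltac:(lra))).
Qed.

Lemma continuous_Rpower (p t : R) : 0 < t -> continuous (fun t => Rpower t p) t.
Proof. intros h. apply ex_derive_continuous_R. unfold Rpower. auto_derive. exact h. Qed.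

Lemma exp_abs_le (x : R) : exp (Rabs x) <= exp x + exp (- x).
Proof.
  unfold Rabs. pose proof (exp_pos x). pose proof (exp_pos (- x)). destruct (Rcase_abs x); lra.
Qed.

Lemma exp_le (x y : R) : x <= y -> exp x <= exp y.
Proof. intros [h| ->]. left; apply exp_increasing, h. lra. Qed.

Lemma sqr_le_exp (x d : R) : 0 < d -> 0 <= x -> x * x <= 4 / (d * d) * exp (d * x).
Proof.
  intros hd hx. pose proof (exp_ineq1_le (d * x / 2)).
  replace (exp (d * x)) with (exp (d * x / 2) * exp (d * x / 2)) by (rewrite <- exp_plus; f_equal; field).
  assert (0 <= d * x / 2) by nra.
  assert ((d * x / 2) * (d * x / 2) <= exp (d * x / 2) * exp (d * x / 2)) by (apply Rmult_le_compat; lra).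
  replace (x * x) with (4 / (d * d) * ((d * x / 2) * (d * x / 2))) by (field; lra).
  apply Rmult_le_compat_l. apply Rdiv_le_0_compat; nra. assumption.
Qed.

(** Dominates u^(-p) exp (2 d |ln u|) for u < 1 and for u > 1 alike. Moving the exponent by 2 d
    either way absorbs the powers of ln u that differentiation in the exponent produces. *)
Definition two_power (u p d : R) : R := Rpower u (- (p - 2 * d)) + Rpower u (- (p + 2 * d)).

Lemma exp_ln_two_power (u p d : R) : exp (2 * d * Rabs (ln u)) * Rpower u (- p) <= two_power u p d.
Proof.
  unfold two_power, Rpower.
  apply Rle_trans with ((exp (2 * d * ln u) + exp (- (2 * d * ln u))) * exp (- p * ln u)).
  - apply Rmult_le_compat_r. left; apply exp_pos.
    destruct (Rle_dec 0 d) as [hd|hd].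
    + eapply Rle_trans; [|apply exp_abs_le]. apply exp_le. rewrite Rabs_mult, (Rabs_pos_eq (2 * d)); lra.
    + pose proof (exp_abs_le (2 * d * ln u)). eapply Rle_trans; [|exact H]. apply exp_le.
      pose proof (Rabs_pos (2 * d * ln u)). pose proof (Rabs_pos (ln u)). nra.
  - rewrite Rmult_plus_distr_r, <- !exp_plus. right. f_equal; f_equal; ring.
Qed.

(** With L = |ln u| the remainder of the exponential is 3 |h|^2 L^2 exp (d L); [sqr_le_exp] trades
    L^2 for 4 / d^2 times exp (d L), which explains 12 / d^2 and the exponent 2 d L. *)
Lemma cpow_quad (u d : R) (s h : C) : 0 < u -> 0 < d -> Cmod h <= d ->
  Cmod (cpow u (- (s + h)) - cpow u (- s) - h * (RtoC (- ln u) * cpow u (- s)))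
  <= 12 / (d * d) * two_power u (Re s) d * (Cmod h * Cmod h).
Proof.
  intros hu hd hh.
  replace (- (s + h))%C with (- s + - h)%C by ring. rewrite cpow_plus.
  set (z := (- h * RtoC (ln u))%C).
  assert (Ez : cpow u (- h) = cexp z) by reflexivity. rewrite Ez.
  replace (cpow u (- s) * cexp z - cpow u (- s) - h * (RtoC (- ln u) * cpow u (- s)))%C
    with (cpow u (- s) * (cexp z - 1 - z))%C by (unfold z; rewrite RtoC_opp; ring).
  rewrite Cmod_mult, Cmod_cpow, re_opp.
  set (L := Rabs (ln u)). assert (hL : 0 <= L) by apply Rabs_pos.
  assert (Hz : Cmod z = Cmod h * L) by (unfold z; rewrite Cmod_mult, Cmod_opp, Cmod_R; reflexivity).
  pose proof (Cmod_ge_0 h).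
  assert (E1 : Cmod (cexp z - 1 - z) <= 3 * (Cmod h * Cmod h) * (L * L) * exp (d * L)).
  { eapply Rle_trans. apply cexp_quad. rewrite Hz.
    replace (3 * (Cmod h * L * (Cmod h * L))) with (3 * (Cmod h * Cmod h) * (L * L)) by ring.
    apply Rmult_le_compat_l. apply Rmult_le_pos; nra. apply exp_le. nra. }
  pose proof (sqr_le_exp L d hd hL).
  assert (E2 : 3 * (Cmod h * Cmod h) * (L * L) * exp (d * L) <= 12 / (d * d) * (Cmod h * Cmod h) * exp (2 * d * L)).
  { replace (exp (2 * d * L)) with (exp (d * L) * exp (d * L)) by (rewrite <- exp_plus; f_equal; ring).
    rewrite <- (Rmult_assoc (12 / (d * d) * (Cmod h * Cmod h))). apply Rmult_le_compat_r. left; apply exp_pos.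
    replace (12 / (d * d) * (Cmod h * Cmod h) * exp (d * L)) with (3 * (Cmod h * Cmod h) * (4 / (d * d) * exp (d * L))) by (field; lra).
    apply Rmult_le_compat_l. nra. assumption. }
  apply Rle_trans with (Rpower u (- Re s) * (12 / (d * d) * (Cmod h * Cmod h) * exp (2 * d * L))).
  apply Rmult_le_compat_l. left; apply Rpower_pos. lra.
  pose proof (exp_ln_two_power u (Re s) d) as E3. fold L in E3.
  replace (Rpower u (- Re s) * (12 / (d * d) * (Cmod h * Cmod h) * exp (2 * d * L)))
    with (12 / (d * d) * (Cmod h * Cmod h) * (exp (2 * d * L) * Rpower u (- Re s))) by ring.
  replace (12 / (d * d) * two_power u (Re s) d * (Cmod h * Cmod h))
    with (12 / (d * d) * (Cmod h * Cmod h) * two_power u (Re s) d) by ring.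
  apply Rmult_le_compat_l. apply Rmult_le_pos. apply Rdiv_le_0_compat; nra. nra. exact E3.
Qed.

Lemma ln_cpow_bound (u d : R) (s : C) : 0 < d ->
  Cmod (RtoC (- ln u) * cpow u (- s)) <= / d * two_power u (Re s) d.
Proof.
  intros hd. rewrite Cmod_mult, Cmod_R, Rabs_Ropp, Cmod_cpow, re_opp.
  pose proof (exp_ln_two_power u (Re s) d) as E.
  set (L := Rabs (ln u)) in *. assert (hL : 0 <= L) by apply Rabs_pos.
  assert (L <= / d * exp (2 * d * L)).
  { pose proof (exp_ineq1_le (2 * d * L)). assert (0 <= d * L) by nra.
    replace L with (/ d * (d * L)) at 1 by (field; lra).
    apply Rmult_le_compat_l. left; apply Rinv_0_lt_compat, hd. lra. }
  pose proof (Rpower_pos u (- Re s)).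
  apply Rle_trans with (/ d * exp (2 * d * L) * Rpower u (- Re s)). apply Rmult_le_compat_r; lra.
  rewrite Rmult_assoc. apply Rmult_le_compat_l. left; apply Rinv_0_lt_compat, hd. exact E.
Qed.

(** * Differentiability in the exponent *)

(* Differentiability in s with a quadratic remainder that is uniform for alpha in compact subsets
   of (0, oo): strong enough to pass under integrals in alpha. *)
Definition unif_diff (G : C -> R -> C) (s : C) : Prop :=
  exists D : R -> C, (forall al, 0 < al -> cont_at D al) /\ (forall al, 0 < al -> cont_at (G s) al) /\
  forall a b, 0 < a -> a <= b -> exists d M, 0 < d /\ 0 <= M /\ forall h al, Cmod h <= d -> a <= al <= b ->
    Cmod (G (s + h)%C al - G s al - h * D al) <= M * (Cmod h * Cmod h).

Lemma unif_diff_plus (F G : C -> R -> C) (s : C) : unif_diff F s -> unif_diff G s ->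
  unif_diff (fun s al => F s al + G s al)%C s.
Proof.
  intros (D & D1 & D2 & D3) (E & E1 & E2 & E3). exists (fun al => D al + E al)%C.
  split; [|split].
  - intros al hal. exact (cont_at_plus D E al (D1 al hal) (E1 al hal)).
  - intros al hal. exact (cont_at_plus (F s) (G s) al (D2 al hal) (E2 al hal)).
  - intros a b ha hab. destruct (D3 a b ha hab) as (d & M & hd & hM & H).
    destruct (E3 a b ha hab) as (e & N & he & hN & K).
    exists (Rmin d e), (M + N). split. apply Rmin_pos; lra. split. lra. intros h al hh hal.
    pose proof (Rmin_l d e). pose proof (Rmin_r d e).
    replace (F (s + h) al + G (s + h) al - (F s al + G s al) - h * (D al + E al))%C
      with ((F (s + h) al - F s al - h * D al) + (G (s + h) al - G s al - h * E al))%C by ring.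
    eapply Rle_trans. apply Cmod_triangle. specialize (H h al ltac:(lra) hal). specialize (K h al ltac:(lra) hal).
    lra.
Qed.

Lemma unif_diff_mult_s (G : C -> R -> C) (s c : C) : unif_diff G s ->
  unif_diff (fun s al => (s - c) * G s al)%C s.
Proof.
  intros (D & D1 & D2 & D3). exists (fun al => (s - c) * D al + G s al)%C.
  split; [|split].
  - intros al hal. apply cont_at_plus. apply cont_at_mult. apply cont_at_const. auto. auto.
  - intros al hal. apply (cont_at_mult (fun _ => (s - c)%C)). apply cont_at_const. auto.
  - intros a b ha hab. destruct (D3 a b ha hab) as (d & M & hd & hM & H).
    destruct (cont_at_bounded D a b hab) as (K & hK & HK). intros t ht. apply D1; lra.
    pose proof (Cmod_ge_0 (s - c)).
    exists d, (Cmod (s - c) * M + M * d + K). split. lra. split. assert (0 <= M * d) by nra. nra.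
    intros h al hh hal. specialize (H h al hh hal). specialize (HK al hal). pose proof (Cmod_ge_0 h).
    set (Q := (G (s + h) al - G s al - h * D al)%C) in *.
    replace ((s + h - c) * G (s + h) al - (s - c) * G s al - h * ((s - c) * D al + G s al))%C
      with ((s - c) * Q + (h * Q + h * h * D al))%C by (unfold Q; ring).
    eapply Rle_trans. apply Cmod_triangle. eapply Rle_trans. apply Rplus_le_compat_l, Cmod_triangle.
    rewrite !Cmod_mult. set (x := Cmod h) in *.
    assert (Cmod (s - c) * Cmod Q <= Cmod (s - c) * (M * (x * x))) by (apply Rmult_le_compat_l; assumption).
    assert (x * Cmod Q <= d * (M * (x * x))).
    { apply Rmult_le_compat; auto. apply Cmod_ge_0. }
    assert (x * x * Cmod (D al) <= x * x * K) by (apply Rmult_le_compat_l; nra).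
    nra.
Qed.

Lemma unif_diff_cpow (s : C) : unif_diff (fun s al => cpow al (1 - s)) s.
Proof.
  exists (fun al => RtoC (- ln al) * cpow al (1 - s))%C. split; [|split].
  - intros al hal. apply cont_at_mult; [|apply cont_at_cpow, hal]. apply cont_at_RtoC.
    apply ex_derive_continuous_R. auto_derive. exact hal.
  - intros al hal. apply cont_at_cpow, hal.
  - intros a b ha hab.
    destruct (continuous_bounded (fun u => two_power u (Re (s - 1)) 1) a b hab) as (K & hK & HK).
    { intros t ht. apply continuous_plus_R; apply continuous_Rpower; lra. }
    exists 1, (12 * K). split. lra. split. lra. intros h al hh hal.
    replace (1 - (s + h))%C with (- ((s - 1) + h))%C by ring.
    replace (1 - s)%C with (- (s - 1))%C by ring.
    eapply Rle_trans. apply (cpow_quad al 1); lra.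
    apply Rmult_le_compat_r. pose proof (Cmod_ge_0 h); nra.
    replace (12 / (1 * 1)) with 12 by field. apply Rmult_le_compat_l. lra.
    eapply Rle_trans. apply Rle_abs. apply HK, hal.
Qed.

(** The weight 1 - v arises from integrating int_0^v g (al + w) dw over v in [0, 1] and exchanging
    the order. With g the function s zeta(s + 1, .) this is the mean of zeta(s, al) - zeta(s, al +
    v) over v. *)
Definition weight_avg (g : R -> C) (al : R) : C := Cint (fun v => RtoC (1 - v) * g (al + v)%R)%C 0 1.

Lemma weight_cont (g : R -> C) (al v : R) : (forall u, 0 < u -> cont_at g u) -> 0 < al -> 0 <= v ->
  cont_at (fun v => RtoC (1 - v) * g (al + v)%R)%C v.
Proof.
  intros Hg hal hv. apply cont_at_mult.
  - apply cont_at_RtoC. apply continuous_minus_R. apply continuous_const. apply continuous_id.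
  - apply cont_at_shift. apply Hg. lra.
Qed.

Lemma weight_avg_bound (g : R -> C) (al M : R) : (forall u, 0 < u -> cont_at g u) -> 0 < al ->
  (forall v, 0 <= v <= 1 -> Cmod (g (al + v)%R) <= M) -> Cmod (weight_avg g al) <= 2 * M.
Proof.
  intros Hg hal HM. replace (2 * M) with (2 * M * (1 - 0)) by ring. apply Cint_bound. lra.
  - intros t ht. apply weight_cont; auto; lra.
  - intros t ht. rewrite Cmod_mult, Cmod_R, Rabs_pos_eq by lra. specialize (HM t ht).
    pose proof (Cmod_ge_0 (g (al + t))). nra.
Qed.

Lemma real_weight_cont (g : R -> R) (al : R) : (forall u, 0 < u -> continuous g u) -> 0 < al ->
  continuous (fun al => RInt (fun v => (1 - v) * g (al + v)%R) 0 1) al.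
Proof.
  intros Hg hal. apply continuous_eps. intros eps he.
  assert (H' : forall t, al / 2 <= t <= al + 2 -> continuity_pt g t).
  { intros t ht; apply continuity_pt_filterlim, Hg. lra. }
  destruct (Heine_cor2 H' (mkposreal (eps / 2) ltac:(lra))) as [d Hd]. simpl in Hd.
  exists (Rmin d (Rmin (al / 2) 1)). split. repeat apply Rmin_pos; try lra. apply cond_pos.
  intros t ht. pose proof (Rmin_l d (Rmin (al/2) 1)). pose proof (Rmin_r d (Rmin (al/2) 1)).
  pose proof (Rmin_l (al/2) 1). pose proof (Rmin_r (al/2) 1).
  assert (ht' : al / 2 < t < al + 1) by (apply Rabs_def2 in ht; lra).
  assert (I : forall u, 0 < u -> is_RInt (fun v => (1 - v) * g (u + v)) 0 1 (RInt (fun v => (1 - v) * g (u + v)) 0 1)).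
  { intros u hu. apply continuous_on_is_RInt. lra. intros v hv. apply continuous_mult_R.
    apply continuous_minus_R. apply continuous_const. apply continuous_id.
    apply (continuous_comp (fun v => u + v) g). apply continuous_plus_R. apply continuous_const. apply continuous_id.
    apply Hg. lra. }
  apply Rle_lt_trans with (1 * (eps / 2)); [|lra].
  replace (1 * (eps / 2)) with ((1 - 0) * (eps / 2)) by ring.
  apply (is_RInt_abs_le (fun v => (1 - v) * g (t + v) - (1 - v) * g (al + v)%R) (fun _ => eps / 2) 0 1). lra.
  - intros v hv. replace ((1 - v) * g (t + v) - (1 - v) * g (al + v)%R) with ((1 - v) * (g (t + v) - g (al + v)%R)) by ring.
    rewrite Rabs_mult, (Rabs_pos_eq (1 - v)) by lra.
    assert (Rabs (g (t + v) - g (al + v)%R) < eps / 2).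
    { apply Hd; try lra. replace (t + v - (al + v)) with (t - al) by ring. lra. }
    pose proof (Rabs_pos (g (t + v) - g (al + v)%R)). nra.
  - apply is_RInt_minus_R; apply I; lra.
  - apply is_RInt_const_R.
Qed.

Lemma weight_avg_cont (g : R -> C) (al : R) : (forall u, 0 < u -> cont_at g u) -> 0 < al ->
  cont_at (weight_avg g) al.
Proof.
  intros Hg hal. split.
  - apply (continuous_ext_R (fun al => RInt (fun v => (1 - v) * Re (g (al + v)%R)) 0 1)).
    intros u. unfold weight_avg, Cint; simpl. apply RInt_ext_R. intros t. unfold Re, Im; simpl. ring.
    apply (real_weight_cont (fun u => Re (g u))); auto. intros u hu; exact (proj1 (Hg u hu)).
  - apply (continuous_ext_R (fun al => RInt (fun v => (1 - v) * Im (g (al + v)%R)) 0 1)).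
    intros u. unfold weight_avg, Cint; simpl. apply RInt_ext_R. intros t. unfold Re, Im; simpl. ring.
    apply (real_weight_cont (fun u => Im (g u))); auto. intros u hu; exact (proj2 (Hg u hu)).
Qed.

Lemma weight_avg_lin (f g h : R -> C) (c : C) (al : R) : 0 < al -> (forall u, 0 < u -> cont_at f u) ->
  (forall u, 0 < u -> cont_at g u) -> (forall u, 0 < u -> cont_at h u) ->
  weight_avg (fun u => f u - g u - c * h u)%C al = (weight_avg f al - weight_avg g al - c * weight_avg h al)%C.
Proof.
  intros hal Hf Hg Hh.
  set (F := fun v => (RtoC (1 - v) * f (al + v)%R)%C). set (G := fun v => (RtoC (1 - v) * g (al + v)%R)%C).
  set (H := fun v => (RtoC (1 - v) * h (al + v)%R)%C).
  assert (cF : forall v, 0 <= v <= 1 -> cont_at F v) by (intros v hv; apply weight_cont; auto; lra).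
  assert (cG : forall v, 0 <= v <= 1 -> cont_at G v) by (intros v hv; apply weight_cont; auto; lra).
  assert (cH : forall v, 0 <= v <= 1 -> cont_at H v) by (intros v hv; apply weight_cont; auto; lra).
  assert (cH' : forall v, 0 <= v <= 1 -> cont_at (fun v => c * H v)%C v).
  { intros v hv. apply cont_at_mult. apply cont_at_const. auto. }
  change (weight_avg f al) with (Cint F 0 1). change (weight_avg g al) with (Cint G 0 1).
  change (weight_avg h al) with (Cint H 0 1).
  rewrite <- (Cint_scal 0 1 Rle_0_1 c H cH), <- (Cint_minus 0 1 Rle_0_1 F G cF cG).
  rewrite <- (Cint_minus 0 1 Rle_0_1 (fun v => F v - G v)%C (fun v => c * H v)%C).
  - apply Cint_ext. lra. intros t ht. unfold F, G, H. ring.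
  - intros v hv. apply cont_at_minus; auto.
  - exact cH'.
Qed.

Lemma unif_diff_weight (G : C -> R -> C) (s : C) (r : R) : 0 < r ->
  (forall h, Cmod h <= r -> forall al, 0 < al -> cont_at (G (s + 1 + h)%C) al) ->
  unif_diff G (s + 1)%C -> unif_diff (fun s al => weight_avg (G (s + 1)%C) al) s.
Proof.
  intros hr Hr (D & D1 & D2 & D3). exists (weight_avg D). split; [|split].
  - intros al hal. apply weight_avg_cont; auto.
  - intros al hal. apply weight_avg_cont; auto.
  (* The average at al sees its argument on [al, al + 1], so a bound on [a, b] takes one on
     [a, b + 1]. *)
  - intros a b ha hab. destruct (D3 a (b + 1) ha ltac:(lra)) as (d & M & hd & hM & H).
    exists (Rmin d r), (2 * M). split. apply Rmin_pos; lra. split. lra. intros h al hh hal.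
    pose proof (Rmin_l d r). pose proof (Rmin_r d r).
    replace (s + h + 1)%C with (s + 1 + h)%C by ring.
    rewrite <- weight_avg_lin by (auto; try lra; apply Hr; lra).
    rewrite Rmult_assoc. apply weight_avg_bound. 2: lra.
    + intros u hu.
      apply (cont_at_minus (fun u => G (s + 1 + h)%C u - G (s + 1)%C u)%C (fun u => h * D u)%C).
      apply (cont_at_minus (G (s + 1 + h)%C) (G (s + 1)%C)). apply Hr; auto; lra. auto.
      apply (cont_at_mult (fun _ => h) D). apply cont_at_const. auto.
    + intros v hv. apply H; lra.
Qed.

(** * The Dirichlet series in its half plane of convergence *)

Definition zeta_series (s : C) (al : R) : C := CSeries (fun n => cpow (INR n + al) (- s)).

Lemma zeta_terms_bound (s : C) (a : R) : 0 < a -> 1 < Re s ->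
  forall n al, a <= al -> Cmod (cpow (INR n + al) (- s)) <= Rpower (INR n + a) (- Re s).
Proof.
  intros ha hs n al hal. rewrite Cmod_cpow, re_opp. pose proof (pos_INR n). apply Rpower_antitone; lra.
Qed.

Lemma zeta_series_correct (s : C) (al : R) : 0 < al -> 1 < Re s ->
  is_seriesC (fun n => cpow (INR n + al) (- s)) (zeta_series s al).
Proof.
  intros ha hs. apply (CSeries_correct _ (fun n => Rpower (INR n + al) (- Re s))).
  intros n. apply zeta_terms_bound; lra. apply ex_series_Rpower; lra.
Qed.


Lemma zeta_series_cont (s : C) (al : R) : 0 < al -> 1 < Re s -> cont_at (zeta_series s) al.
Proof.
  intros ha hs. apply (CSeries_cont (fun n al => cpow (INR n + al) (- s))
    (fun n => Rpower (INR n + al / 2) (- Re s)) al (al / 2)). lra.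
  - intros n. apply (cont_at_shift (fun u => cpow u (- s))). apply cont_at_cpow. pose proof (pos_INR n); lra.
  - intros n t ht. apply zeta_terms_bound; try lra. apply Rabs_def2 in ht; lra.
  - apply ex_series_Rpower; lra.
Qed.

Lemma ex_series_two_power (a p d : R) : 0 < a -> 1 < p - 2 * d -> 0 <= d ->
  ex_series (fun n => two_power (INR n + a) p d).
Proof.
  intros ha hp hd. apply (ex_series_plus (V := R_NormedModule)
    (fun n => Rpower (INR n + a) (- (p - 2 * d))) (fun n => Rpower (INR n + a) (- (p + 2 * d))));
  apply ex_series_Rpower; lra.
Qed.

Lemma two_power_antitone (x y p d : R) : 0 < x -> x <= y -> 0 <= p - 2 * d -> 0 <= d ->
  two_power y p d <= two_power x p d.
Proof. intros. unfold two_power. apply Rplus_le_compat; apply Rpower_antitone; lra. Qed.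

Lemma unif_diff_zeta (s : C) : 1 < Re s -> unif_diff zeta_series s.
Proof.
  (* [two_power] lowers the exponent by 2 d; a quarter of the distance to 1 leaves (Re s + 1) / 2,
     still above 1. *)
  intros hs. set (d := (Re s - 1) / 4). assert (hd : 0 < d) by (unfold d; lra).
  assert (hp : 1 < Re s - 2 * d) by (unfold d; lra).
  set (dt := fun n al => (RtoC (- ln (INR n + al)) * cpow (INR n + al) (- s))%C).
  assert (Bd : forall n a al, 0 < a -> a <= al -> Cmod (dt n al) <= / d * two_power (INR n + a) (Re s) d).
  { intros n a al ha hal. unfold dt. eapply Rle_trans. apply (ln_cpow_bound _ d); assumption.
    apply Rmult_le_compat_l. left; apply Rinv_0_lt_compat, hd. apply two_power_antitone; try lra.
    pose proof (pos_INR n); lra. }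
  assert (Ed : forall a K, 0 < a -> ex_series (fun n => K * two_power (INR n + a) (Re s) d)).
  { intros a K ha. apply (ex_series_scal_l (V := R_NormedModule) K). apply ex_series_two_power; lra. }
  exists (fun al => CSeries (fun n => dt n al)). split; [|split].
  - intros al hal. apply (CSeries_cont dt (fun n => / d * two_power (INR n + al / 2) (Re s) d) al (al / 2)). lra.
    + intros n. pose proof (pos_INR n). unfold dt. apply cont_at_mult.
      * apply cont_at_RtoC. apply ex_derive_continuous_R. auto_derive. lra.
      * apply (cont_at_shift (fun u => cpow u (- s))). apply cont_at_cpow. lra.
    + intros n t ht. apply Bd. lra. apply Rabs_def2 in ht; lra.
    + apply Ed. lra.
  - intros al hal. apply zeta_series_cont; assumption.
  - intros a b ha hab.
    exists d, (2 * Series (fun n => 12 / (d * d) * two_power (INR n + a) (Re s) d)). split. exact hd.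
    assert (h12 : 0 < 12 / (d * d)) by (apply Rdiv_lt_0_compat; nra).
    split.
    { apply Rmult_le_pos. lra.
      eapply Rle_trans; [|apply (Series_le (fun _ => 0))].
      rewrite (is_series_unique _ 0 is_series_0_R). lra.
      intros n. split. lra. apply Rmult_le_pos. lra. unfold two_power.
      pose proof (Rpower_pos (INR n + a) (- (Re s - 2 * d))). pose proof (Rpower_pos (INR n + a) (- (Re s + 2 * d))). lra.
      apply Ed, ha. }
    intros h al hh hal.
    assert (hs' : 1 < Re (s + h)).
    { rewrite re_plus. pose proof (Re_le_Cmod h) as E. apply Rabs_le_between in E. unfold d in *. lra. }
    set (x2 := Cmod h * Cmod h).
    assert (hx2 : 0 <= x2) by (unfold x2; pose proof (Cmod_ge_0 h); nra).
    assert (S1 := zeta_series_correct (s + h) al ltac:(lra) hs').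
    assert (S2 := zeta_series_correct s al ltac:(lra) hs).
    assert (S3 : is_seriesC (fun n => dt n al) (CSeries (fun n => dt n al))).
    { apply (CSeries_correct _ (fun n => / d * two_power (INR n + a) (Re s) d)).
      intros n. apply Bd; lra. apply Ed, ha. }
    assert (S4 := is_seriesC_minus _ _ _ _ (is_seriesC_minus _ _ _ _ S1 S2) (is_seriesC_scal h _ _ S3)).
    replace (2 * Series (fun n => 12 / (d * d) * two_power (INR n + a) (Re s) d) * x2)
      with (2 * Series (fun n => 12 / (d * d) * two_power (INR n + a) (Re s) d * x2))
      by (rewrite Series_scal_r; ring).
    apply (is_seriesC_bound _ _ _ S4).
    + intros n. pose proof (pos_INR n). eapply Rle_trans. apply (cpow_quad (INR n + al) d s h); lra.
      apply Rmult_le_compat_r. exact hx2. apply Rmult_le_compat_l. lra. apply two_power_antitone; lra.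
    + apply (ex_series_scal_r x2). apply Ed, ha.
Qed.

(** * Continuation of the Hurwitz zeta function *)

(* zeta_reg j s al is (s - 1) zeta(s, al) on Re s > 1 - j.  The recursion integrates by parts
   zeta(s, al) = al^(1-s) / (s - 1) + int_0^1 (zeta(s, al) - zeta(s, al + v)) dv, using
   d/dal zeta(s, al) = - s zeta(s + 1, al); the factor s - 1 removes the pole. *)
Fixpoint zeta_reg (j : nat) (s : C) (al : R) : C :=
  match j with
  | O => (s - 1) * zeta_series s al
  | S j => cpow al (1 - s) + (s - 1) * weight_avg (zeta_reg j (s + 1)) al
  end%C.

Lemma zeta_reg_unif_diff (j : nat) : forall s, 1 - INR j < Re s -> unif_diff (zeta_reg j) s.
Proof.
  induction j as [|j IH]; intros s hs.
  - apply (unif_diff_mult_s zeta_series s 1). apply unif_diff_zeta. simpl in hs. lra.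
  - rewrite S_INR in hs.
    apply (unif_diff_plus (fun s al => cpow al (1 - s)) (fun s al => (s - 1) * weight_avg (zeta_reg j (s + 1)) al)%C).
    apply unif_diff_cpow.
    apply (unif_diff_mult_s (fun s al => weight_avg (zeta_reg j (s + 1)%C) al) s 1).
    (* Half the distance from s to the boundary line Re = - j, so that s + 1 + h stays in the domain
       of stage j. *)
    apply (unif_diff_weight (zeta_reg j) s ((Re s + INR j) / 2)). lra.
    + intros h hh. destruct (IH (s + 1 + h)%C) as (D & _ & H & _).
      { rewrite !re_plus. simpl (Re (RtoC 1)). pose proof (Re_le_Cmod h) as E. apply Rabs_le_between in E. lra. }
      exact H.
    + apply IH. rewrite re_plus. simpl (Re (RtoC 1)). lra.
Qed.


Lemma Rpower_lim_0 (a e : R) : 0 < a -> 0 < e -> is_lim_seq (fun n => Rpower (INR n + a) (- e)) 0.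
Proof.
  intros ha he. apply is_lim_seq_spec. intros eps. 
  destruct (nfloor_ex (exp (- ln eps / e))) as [N [_ HN]]. left; apply exp_pos.
  exists (S N). intros n hn. rewrite Rminus_0_r, Rabs_pos_eq by (left; apply Rpower_pos).
  assert (hN : exp (- ln eps / e) < INR n + a).
  { apply le_INR in hn. rewrite S_INR in hn. lra. }
  unfold Rpower. rewrite <- (exp_ln eps) by apply cond_pos. apply exp_increasing.
  apply ln_increasing in hN; [|apply exp_pos]. rewrite ln_exp in hN.
  apply (Rmult_lt_compat_l e) in hN; [|lra].
  replace (e * (- ln eps / e)) with (- ln eps) in hN by (field; lra). lra.
Qed.

Lemma telescoping_C (a : nat -> C) : is_lim_seq (fun n => Cmod (a n)) 0 ->
  is_seriesC (fun n => a n - a (S n))%C (a O).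
Proof.
  intros H.
  assert (L : forall f : C -> R, (forall z w, f (z - w)%C = f z - f w) -> (forall z, Rabs (f z) <= Cmod z) ->
    is_series (fun n => f (a n - a (S n))%C) (f (a O))).
  { intros f f1 f2. apply (is_series_ext_R (fun n => f (a n) - f (a (S n)))). intros n; rewrite f1; auto.
    change (is_lim_seq (sum_n (fun n => f (a n) - f (a (S n)))) (f (a O))).
    apply (is_lim_seq_ext (fun n => f (a O) - f (a (S n)))).
    { induction n. rewrite sum_O. reflexivity. rewrite sum_n_S_R, <- IHn. ring. }
    replace (Finite (f (a O))) with (Finite (f (a O) - 0)) by (f_equal; ring).
    apply is_lim_seq_minus'. apply is_lim_seq_const.
    apply -> (is_lim_seq_incr_1 (fun n => f (a n))).
    apply is_lim_seq_abs_0.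
    apply (is_lim_seq_le_le (fun _ => 0) _ (fun n => Cmod (a n))).
    intros n; split; [apply Rabs_pos|apply f2]. apply is_lim_seq_const. exact H. }
  apply is_series_C. split.
  - apply (L Re). reflexivity. apply Re_le_Cmod.
  - apply (L Im). reflexivity. apply Im_le_Cmod.
Qed.

Lemma Re_s_ne_1 (s : C) : 1 < Re s -> (s - 1)%C <> RtoC 0.
Proof. intros h e. apply (f_equal Re) in e. simpl in e. unfold Re in *. lra. Qed.

Lemma Cder_mult (F G : R -> C) (t : R) (l m : C) : Cder F t l -> Cder G t m ->
  Cder (fun t => F t * G t)%C t (l * G t + F t * m)%C.
Proof.
  intros [H1 H2] [H3 H4].
  assert (M : forall f g df dg, is_derive f t df -> is_derive g t dg -> is_derive (fun t => f t * g t) t (df * g t + f t * dg)).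
  { intros f g df dg Hf Hg. apply (is_derive_mult (K := R_AbsRing) f g t df dg Hf Hg). intros; apply Rmult_comm. }
  split.
  - apply (is_derive_ext (fun t => Re (F t) * Re (G t) - Im (F t) * Im (G t))). reflexivity.
    replace (Re (l * G t + F t * m)) with ((Re l * Re (G t) + Re (F t) * Re m) - (Im l * Im (G t) + Im (F t) * Im m))
      by (simpl; unfold Re, Im; ring).
    apply (is_derive_minus (V := R_NormedModule)); apply M; assumption.
  - apply (is_derive_ext (fun t => Re (F t) * Im (G t) + Im (F t) * Re (G t))). reflexivity.
    replace (Im (l * G t + F t * m)) with ((Re l * Im (G t) + Re (F t) * Im m) + (Im l * Re (G t) + Im (F t) * Re m))
      by (simpl; unfold Re, Im; ring).
    apply (is_derive_plus (V := R_NormedModule)); apply M; assumption.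
Qed.

Lemma Cder_plus (F G : R -> C) (t : R) (l m : C) : Cder F t l -> Cder G t m ->
  Cder (fun t => F t + G t)%C t (l + m)%C.
Proof. intros [H1 H2] [H3 H4]. split; apply (is_derive_plus (V := R_NormedModule)); assumption. Qed.

Lemma Cder_RtoC (f : R -> R) (t l : R) : is_derive f t l -> Cder (fun t => RtoC (f t)) t (RtoC l).
Proof.
  intros H. split. exact H. change (is_derive (fun _ : R => 0) t 0).
  exact (is_derive_const (V := R_NormedModule) 0 t).
Qed.

Lemma Cder_const (c : C) (t : R) : Cder (fun _ => c) t (RtoC 0).
Proof.
  split. exact (is_derive_const (V := R_NormedModule) (Re c) t).
  exact (is_derive_const (V := R_NormedModule) (Im c) t).
Qed.

(** Integration by parts for a single term of the series. On the right, the first summand is a zeta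
    term, and the bracket telescopes when u runs through n + al. *)
Lemma zeta_term_integral (u : R) (s : C) : 0 < u -> (s - 1)%C <> RtoC 0 ->
  ((s - 1) * Cint (fun v => RtoC (1 - v) * (s * cpow (u + v)%R (- (s + 1)))) 0 1)%C =
  ((s - 1) * cpow u (- s) - (cpow u (1 - s) - cpow (u + 1)%R (1 - s)))%C.
Proof.
  intros hu hs.
  rewrite (Cint_FTC 0 1 Rle_0_1 (fun v => RtoC (v - 1) * cpow (u + v)%R (- s) + / (s - 1) * cpow (u + v)%R (1 - s))%C).
  - replace (RtoC (1 - 1)) with (RtoC 0) by (f_equal; ring).
    replace (RtoC (0 - 1)) with (- RtoC 1)%C by (rewrite <- RtoC_opp; f_equal; ring).
    rewrite Rplus_0_r. field. exact hs.
  - intros t ht.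
    assert (H1 := Cder_mult _ _ t _ _ (Cder_RtoC (fun v => v - 1) t 1 ltac:(auto_derive; [auto|ring])) (Cder_cpow u t (- s) ltac:(lra))).
    assert (H2 := Cder_mult _ _ t _ _ (Cder_const (/ (s - 1)) t) (Cder_cpow u t (1 - s) ltac:(lra))).
    assert (H3 := Cder_plus _ _ _ _ _ H1 H2).
    replace (RtoC (1 - t) * (s * cpow (u + t)%R (- (s + 1))))%C with
     (1 * cpow (u + t)%R (- s) + (t - 1)%R * (- s * cpow (u + t)%R (- s - 1)) +
       (0 * cpow (u + t)%R (1 - s) + / (s - 1) * ((1 - s) * cpow (u + t)%R (1 - s - 1))))%C. exact H3.
    replace (1 - s - 1)%C with (- s)%C by ring. replace (- (s + 1))%C with (- s - 1)%C by ring.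
    replace (RtoC (1 - t)) with (- RtoC (t - 1))%C by (rewrite <- RtoC_opp; f_equal; ring).
    field. exact hs.
  - intros t ht. apply cont_at_mult.
    + apply cont_at_RtoC. apply continuous_minus_R. apply continuous_const. apply continuous_id.
    + apply (cont_at_mult (fun _ => s)). apply cont_at_const.
      apply (cont_at_shift (fun u => cpow u (- (s + 1)))). apply cont_at_cpow. lra.
Qed.

(** Where the series converges the recursion is an identity: summing [zeta_term_integral] over u = n
    + al, the brackets collapse to al^(1-s). *)
Lemma zeta_reg_step_0 (s : C) (al : R) : 1 < Re s -> 0 < al -> zeta_reg 1 s al = zeta_reg 0 s al.
Proof.
  intros hs hal. simpl zeta_reg. pose proof (Re_s_ne_1 s hs) as hne.
  assert (hs1 : 1 < Re (s + 1)) by (rewrite re_plus; simpl (Re (RtoC 1)); lra).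
  set (f := fun (n : nat) v => (RtoC (1 - v) * (s * cpow (INR n + al + v)%R (- (s + 1))))%C).
  set (c := fun n => Cmod s * Rpower (INR n + al) (- Re (s + 1))).
  assert (Ec : ex_series c).
  { apply (ex_series_scal_l (V := R_NormedModule) (Cmod s)). apply ex_series_Rpower; lra. }
  assert (Bf : forall n v, 0 <= v <= 1 -> Cmod (f n v) <= c n).
  { intros n v hv. unfold f, c. rewrite Cmod_mult, Cmod_mult, Cmod_R, Rabs_pos_eq by lra.
    pose proof (zeta_terms_bound (s + 1) al hal hs1 n (al + v) ltac:(lra)) as T.
    rewrite <- Rplus_assoc in T. pose proof (Cmod_ge_0 s).
    pose proof (Cmod_ge_0 (cpow (INR n + al + v) (- (s + 1)))).
    assert (Cmod s * Cmod (cpow (INR n + al + v) (- (s + 1))) <= Cmod s * Rpower (INR n + al) (- Re (s + 1))).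
    { apply Rmult_le_compat_l; lra. }
    assert (0 <= Cmod s * Cmod (cpow (INR n + al + v) (- (s + 1)))) by nra. nra. }
  assert (EqS : forall v, 0 <= v <= 1 -> CSeries (fun n => f n v) = (RtoC (1 - v) * ((s + 1 - 1) * zeta_series (s + 1) (al + v)%R))%C).
  { intros v hv. apply is_seriesC_unique. unfold f.
    apply (is_seriesC_ext (fun n => RtoC (1 - v) * (s * cpow (INR n + (al + v))%R (- (s + 1))))%C).
    intros n. rewrite Rplus_assoc. reflexivity.
    apply is_seriesC_scal. replace (s + 1 - 1)%C with s by ring. apply is_seriesC_scal.
    apply zeta_series_correct; lra. }
  assert (Cw : forall v, 0 <= v <= 1 -> cont_at (fun v => CSeries (fun n => f n v)) v).
  { intros v hv. apply (CSeries_cont f (fun n => (2 + Rabs v) * (Cmod s * Rpower (INR n + al / 2) (- Re (s + 1)))) v (Rmin 1 (al / 2))).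
    apply Rmin_pos; lra.
    - intros n. unfold f. apply cont_at_mult.
      + apply cont_at_RtoC. apply continuous_minus_R. apply continuous_const. apply continuous_id.
      + apply (cont_at_mult (fun _ => s)). apply cont_at_const.
        apply (cont_at_shift (fun u => cpow u (- (s + 1)))). apply cont_at_cpow. pose proof (pos_INR n). lra.
    - intros n t ht. unfold f. rewrite Cmod_mult, Cmod_mult, Cmod_R.
      pose proof (Rmin_l 1 (al / 2)). pose proof (Rmin_r 1 (al / 2)). apply Rabs_def2 in ht.
      pose proof (zeta_terms_bound (s + 1) (al / 2) ltac:(lra) hs1 n (al + t) ltac:(lra)) as T.
      rewrite <- Rplus_assoc in T.
      apply Rmult_le_compat. apply Rabs_pos. apply Rmult_le_pos; apply Cmod_ge_0.
      rewrite (Rabs_pos_eq v) by lra. apply Rabs_le. lra.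
      apply Rmult_le_compat_l. apply Cmod_ge_0. exact T.
    - apply (ex_series_scal_l (V := R_NormedModule) (2 + Rabs v)).
      apply (ex_series_scal_l (V := R_NormedModule) (Cmod s)). apply ex_series_Rpower; lra. }
  assert (HS : is_seriesC (fun n => Cint (f n) 0 1) (Cint (fun v => CSeries (fun n => f n v)) 0 1)).
  { apply (Cint_series 0 1 Rle_0_1 f c); auto.
    intros n v hv. unfold f. apply cont_at_mult.
    + apply cont_at_RtoC. apply continuous_minus_R. apply continuous_const. apply continuous_id.
    + apply (cont_at_mult (fun _ => s)). apply cont_at_const.
      apply (cont_at_shift (fun u => cpow u (- (s + 1)))). apply cont_at_cpow. pose proof (pos_INR n). lra. }
  replace (Cint (fun v => CSeries (fun n => f n v)) 0 1) with
    (weight_avg (fun al => (s + 1 - 1) * zeta_series (s + 1) al)%C al) in HS.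
  2: { apply Cint_ext. lra. intros v hv. symmetry. apply EqS. lra. }
  assert (H1 := is_seriesC_scal (s - 1)%C _ _ HS).
  assert (H2 : is_seriesC (fun n => (s - 1) * Cint (f n) 0 1)%C ((s - 1) * zeta_series s al - cpow al (1 - s))%C).
  { apply (is_seriesC_ext (fun n => (s - 1) * cpow (INR n + al) (- s) - (cpow (INR n + al)%R (1 - s) - cpow (INR (S n) + al)%R (1 - s)))%C).
    - intros n. unfold f. rewrite zeta_term_integral by (assumption || (pose proof (pos_INR n); lra)).
      rewrite S_INR. replace (INR n + 1 + al) with (INR n + al + 1) by ring. reflexivity.
    - apply is_seriesC_minus.
      + apply is_seriesC_scal. apply zeta_series_correct; assumption.
      + replace (cpow al (1 - s)) with (cpow (INR 0 + al)%R (1 - s)) by (simpl; f_equal; ring).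
        apply (telescoping_C (fun n => cpow (INR n + al)%R (1 - s))).
        apply (is_lim_seq_ext (fun n => Rpower (INR n + al) (- (Re s - 1)))).
        * intros n. rewrite Cmod_cpow. f_equal. simpl. unfold Re. ring.
        * apply Rpower_lim_0; lra. }
  rewrite <- (is_seriesC_unique _ _ H1), (is_seriesC_unique _ _ H2). ring.
Qed.

(** Since stage j + 1 at s uses stage j at s + 1, agreement in the half plane of convergence moves
    one unit to the left with each stage, purely algebraically. *)
Lemma zeta_reg_step (j : nat) : forall s al, 1 - INR j < Re s -> 0 < al ->
  zeta_reg (S j) s al = zeta_reg j s al.
Proof.
  induction j as [|j IH]; intros s al hs hal.
  - apply zeta_reg_step_0. simpl in hs; lra. exact hal.
  - rewrite S_INR in hs.
    change (zeta_reg (S (S j)) s al) with (cpow al (1 - s) + (s - 1) * weight_avg (zeta_reg (S j) (s + 1)) al)%C.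
    change (zeta_reg (S j) s al) with (cpow al (1 - s) + (s - 1) * weight_avg (zeta_reg j (s + 1)) al)%C.
    do 2 f_equal. apply Cint_ext. lra. intros v hv. f_equal. apply IH.
    rewrite re_plus. simpl (Re (RtoC 1)). lra. lra.
Qed.

Lemma zeta_reg_add (m j : nat) (s : C) (al : R) : 1 - INR j < Re s -> 0 < al ->
  zeta_reg (m + j) s al = zeta_reg j s al.
Proof.
  intros hs hal. induction m. reflexivity. rewrite Nat.add_succ_l, zeta_reg_step; auto.
  rewrite plus_INR. pose proof (pos_INR m). lra.
Qed.

Lemma zeta_reg_indep (i j : nat) (s : C) (al : R) : 1 - INR i < Re s -> 1 - INR j < Re s -> 0 < al ->
  zeta_reg i s al = zeta_reg j s al.
Proof.
  intros hi hj hal. rewrite <- (zeta_reg_add j i s al hi hal), Nat.add_comm. apply zeta_reg_add; assumption.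
Qed.

(** * Existence and uniqueness of the continuation *)

Definition zeta_depth (s : C) : nat := Z.to_nat (up (Rabs (Re s) + 1)).

Lemma zeta_depth_spec (s : C) : 1 - INR (zeta_depth s) < Re s.
Proof.
  unfold zeta_depth. destruct (archimed (Rabs (Re s) + 1)) as [h _].
  pose proof (Rabs_pos (Re s)). pose proof (Rle_abs (- Re s)). rewrite Rabs_Ropp in *.
  rewrite INR_IZR_INZ, Z2Nat.id. lra. apply le_IZR. lra.
Qed.

Definition hurwitz_fun (al : R) (s : C) : C := (zeta_reg (zeta_depth s) s al / (s - 1))%C.

Lemma hurwitz_fun_eq (j : nat) (al : R) (s : C) : 1 - INR j < Re s -> 0 < al ->
  hurwitz_fun al s = (zeta_reg j s al / (s - 1))%C.
Proof.
  intros hs hal. unfold hurwitz_fun. f_equal. apply zeta_reg_indep; auto. apply zeta_depth_spec.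
Qed.

Lemma hurwitz_fun_continuation (al : R) : 0 < al -> hurwitz_continuation al (hurwitz_fun al).
Proof.
  intros hal. split.
  - intros w hw. apply C_differentiable_holo.
    (* [hurwitz_fun] changes its depth with s; one stage more than w requires is a valid depth on
       the whole unit disc around w. *)
    set (j := S (zeta_depth w)).
    assert (hj : 2 - INR j < Re w) by (unfold j; rewrite S_INR; pose proof (zeta_depth_spec w); lra).
    apply (holo_ext_loc (fun s => zeta_reg j s al * / (s - 1))%C _ w 1). lra.
    + intros h hh. symmetry. apply hurwitz_fun_eq; auto. rewrite re_plus.
      pose proof (Re_le_Cmod h) as E. apply Rabs_le_between in E. lra.
    + apply (holo_mult (fun s => zeta_reg j s al) (fun s => / (s - 1))%C).
      * destruct (zeta_reg_unif_diff j w ltac:(lra)) as (D & _ & _ & H).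
        destruct (H al al hal (Rle_refl _)) as (d & M & hd & hM & HM).
        apply (quad_holo _ w (D al) d M hd hM). intros h hh.
        replace (D al * h)%C with (h * D al)%C by ring. apply HM; auto; lra.
      * apply (holo_comp Cinv (fun s => s - 1)%C).
        apply (holo_ext_loc (fun z => 1 * z + - (1))%C _ w 1). lra. intros; ring. apply holo_affine.
        apply holo_inv. intros e. apply hw. replace w with (w - 1 + 1)%C by ring. rewrite e. ring.
  - intros s hs. rewrite (hurwitz_fun_eq 0) by (simpl; lra). simpl zeta_reg.
    replace ((s - 1) * zeta_series s al / (s - 1))%C with (zeta_series s al).
    apply zeta_series_correct; assumption. field. apply Re_s_ne_1, hs.
Qed.

Lemma hurwitz_zeta_eq (al p : R) : 0 < al -> p < 0 -> hurwitz_zeta (RtoC p) al = hurwitz_fun al (RtoC p).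
Proof.
  intros hal hp. unfold hurwitz_zeta.
  set (f := epsilon _ _).
  assert (Hf : hurwitz_continuation al f).
  { apply epsilon_spec. exists (hurwitz_fun al). apply hurwitz_fun_continuation, hal. }
  assert (Hg := hurwitz_fun_continuation al hal).
  destruct Hf as [f1 f2], Hg as [g1 g2].
  apply Ceq_minus.
  apply (identity_punctured_plane (fun s => f s - hurwitz_fun al s)%C p hp).
  - intros w hw. apply (holo_ext_loc (fun s => f s + (- (1)) * hurwitz_fun al s)%C _ w 1). lra. intros; ring.
    apply holo_plus. apply C_differentiable_holo, f1, hw.
    apply holo_mult. apply holo_const. apply C_differentiable_holo, g1, hw.
  - intros w hw. rewrite <- (is_seriesC_unique _ _ (f2 w hw)), <- (is_seriesC_unique _ _ (g2 w hw)). ring.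
Qed.

(** * Bernoulli polynomials and zeta values *)

(* bern m is the Bernoulli polynomial B_m: the recursion is that of [zeta_reg] at s = 1 - m, so that
   zeta(-k, al) = - B_(k+1)(al) / (k+1). *)
Fixpoint bern (m : nat) (al : R) : R :=
  match m with
  | O => 1
  | S p => al ^ S p - INR (S p) * RInt (fun v => (1 - v) * bern p (al + v)) 0 1
  end.

Definition bern_prim (m : nat) (x : R) : R := RInt (bern m) 0 x.

Lemma is_derive_prim (f : R -> R) (x : R) : (forall t, continuous f t) ->
  is_derive (fun x => RInt f 0 x) x (f x).
Proof.
  intros H. apply (is_derive_RInt (V := R_NormedModule) f _ 0).
  - exists (mkposreal 1 Rlt_0_1). intros y _. apply continuous_is_RInt, H.
  - apply H.
Qed.

Lemma is_derive_shift (f : R -> R) (x v l : R) : is_derive f (x + v) l -> is_derive (fun v => f (x + v)) v l.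
Proof.
  intros H. replace l with (1 * l) by ring.
  apply (is_derive_comp (V := R_NormedModule) f (fun v => x + v) v l 1 H). auto_derive; auto.
Qed.

Lemma is_derive_plus_R (f g : R -> R) (x l m : R) : is_derive f x l -> is_derive g x m ->
  is_derive (fun x => f x + g x) x (l + m).
Proof. exact (is_derive_plus (V := R_NormedModule) f g x l m). Qed.

Lemma is_derive_minus_R (f g : R -> R) (x l m : R) : is_derive f x l -> is_derive g x m ->
  is_derive (fun x => f x - g x) x (l - m).
Proof. exact (is_derive_minus (V := R_NormedModule) f g x l m). Qed.

Lemma is_derive_scal_R (f : R -> R) (x c l : R) : is_derive f x l -> is_derive (fun x => c * f x) x (c * l).
Proof. exact (is_derive_scal f x c l). Qed.

Lemma is_derive_mult_R (f g : R -> R) (x l m : R) : is_derive f x l -> is_derive g x m ->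
  is_derive (fun x => f x * g x) x (l * g x + f x * m).
Proof. intros Hf Hg. apply (is_derive_mult (K := R_AbsRing) f g x l m Hf Hg). intros; apply Rmult_comm. Qed.

Lemma is_derive_cont (f : R -> R) (x l : R) : is_derive f x l -> continuous f x.
Proof. intros H. apply ex_derive_continuous_R. exists l. exact H. Qed.

Lemma continuous_shift_R (f : R -> R) (x v : R) : continuous f (x + v) -> continuous (fun v => f (x + v)) v.
Proof.
  intros H. apply (continuous_comp (fun v => x + v) f); [|exact H].
  apply continuous_plus_R. apply continuous_const. apply continuous_id.
Qed.

(** Integrating by parts removes the weight and expresses the average by antiderivatives of order
    one and two, which can be differentiated in x directly. *)
Lemma weight_by_parts (f F G : R -> R) (x : R) : (forall t, continuous f t) ->
  (forall t, is_derive F t (f t)) -> (forall t, is_derive G t (F t)) ->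
  RInt (fun v => (1 - v) * f (x + v)) 0 1 = G (x + 1) - G x - F x.
Proof.
  intros Hf HF HG. apply is_RInt_unique_R.
  replace (G (x + 1) - G x - F x) with
    ((fun v => (1 - v) * F (x + v) + G (x + v)) 1 - (fun v => (1 - v) * F (x + v) + G (x + v)) 0)
    by (rewrite Rplus_0_r; ring).
  apply (is_RInt_derive_R (fun v => (1 - v) * F (x + v) + G (x + v))). lra.
  - intros t _. replace ((1 - t) * f (x + t)) with ((-1 * F (x + t) + (1 - t) * f (x + t)) + F (x + t)) by ring.
    apply (is_derive_plus_R (fun v => (1 - v) * F (x + v)) (fun v => G (x + v))).
    apply (is_derive_mult_R (fun v => 1 - v) (fun v => F (x + v))).
    auto_derive; auto; ring. apply is_derive_shift, HF. apply is_derive_shift, HG.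
  - intros t _. apply continuous_mult_R. apply continuous_minus_R. apply continuous_const. apply continuous_id.
    apply continuous_shift_R, Hf.
Qed.

(** The facts feed each other. The integral of B_m over [x, x + 1] equals x^m, and this cancels the
    derivative of x^(m+1) in the recursion, leaving (m + 1) B_m; that derivative in turn turns the
    recursion into the unit-step integral for m + 1. *)
Lemma bern_facts (m : nat) :
  (forall t, continuous (bern m) t) /\
  (forall x, bern_prim m (x + 1) - bern_prim m x = x ^ m) /\
  (forall x, is_derive (bern (S m)) x (INR (S m) * bern m x)).
Proof.
  assert (DER : forall m, (forall t, continuous (bern m) t) ->
     (forall x, bern_prim m (x + 1) - bern_prim m x = x ^ m) ->
     forall x, is_derive (bern (S m)) x (INR (S m) * bern m x)).
  { intros p Hc Hp x.
    set (Q := fun x => RInt (bern_prim p) 0 x).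
    assert (dP : forall t, is_derive (bern_prim p) t (bern p t)) by (intros t; apply is_derive_prim, Hc).
    assert (dQ : forall t, is_derive Q t (bern_prim p t)).
    { intros t; apply is_derive_prim. intros u; apply (is_derive_cont _ _ _ (dP u)). }
    apply (is_derive_ext (fun x => x ^ S p - INR (S p) * (Q (x + 1) - Q x - bern_prim p x))).
    { intros t. symmetry. cbn [bern]. rewrite (weight_by_parts _ _ Q t Hc dP dQ). reflexivity. }
    replace (INR (S p) * bern p x) with (INR (S p) * x ^ p - INR (S p) * (bern_prim p (x + 1) - bern_prim p x - bern p x))
      by (rewrite Hp; ring).
    apply is_derive_minus_R.
    - replace (INR (S p) * x ^ p) with (INR (S p) * 1 * x ^ pred (S p)) by (simpl pred; ring).
      apply is_derive_pow. apply (is_derive_id (K := R_AbsRing)).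
    - apply is_derive_scal_R. apply is_derive_minus_R. apply is_derive_minus_R.
      apply (is_derive_ext (fun x => Q (1 + x))). intros t; f_equal; ring.
      apply is_derive_shift. replace (1 + x) with (x + 1) by ring. apply dQ. apply dQ. apply dP. }
  induction m as [|m (Hc & Hp & Hd)].
  - assert (Hc : forall t, continuous (bern 0) t) by (intros t; apply continuous_const).
    assert (Hp : forall x, bern_prim 0 (x + 1) - bern_prim 0 x = x ^ 0).
    { intros x. unfold bern_prim.
      rewrite (is_RInt_unique_R (bern 0) 0 (x+1) _ (is_RInt_const_R 1 0 (x + 1))).
      rewrite (is_RInt_unique_R (bern 0) 0 x _ (is_RInt_const_R 1 0 x)). simpl; ring. }
    split; [exact Hc|split; [exact Hp|]]. apply DER; assumption.
  - assert (Hc' : forall t, continuous (bern (S m)) t) by (intros t; apply (is_derive_cont _ _ _ (Hd t))).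
    assert (Hp' : forall x, bern_prim (S m) (x + 1) - bern_prim (S m) x = x ^ S m).
    { intros x.
      assert (dP : forall t, is_derive (bern_prim (S m)) t (bern (S m) t)) by (intros t; apply is_derive_prim, Hc').
      assert (W := weight_by_parts (fun t => INR (S m) * bern m t) (bern (S m)) (bern_prim (S m)) x
        (fun t => continuous_mult_R _ _ t (continuous_const _ t) (Hc t)) Hd dP).
      assert (W2 : RInt (fun v => (1 - v) * (INR (S m) * bern m (x + v))) 0 1 = INR (S m) * RInt (fun v => (1 - v) * bern m (x + v)) 0 1).
      { apply is_RInt_unique_R. apply (is_RInt_eq_R (fun v => INR (S m) * ((1 - v) * bern m (x + v)))). intros; ring.
        apply is_RInt_scal_R. apply continuous_is_RInt. intros t. apply continuous_mult_R.
        apply continuous_minus_R. apply continuous_const. apply continuous_id. apply continuous_shift_R, Hc. }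
      cbv beta in W. rewrite W2 in W.
      assert (B : bern (S m) x = x ^ S m - INR (S m) * RInt (fun v => (1 - v) * bern m (x + v)) 0 1) by reflexivity.
      lra. }
    split; [exact Hc'|split; [exact Hp'|]]. apply DER; assumption.
Qed.

Lemma bern_cont (m : nat) (t : R) : continuous (bern m) t.
Proof. apply bern_facts. Qed.

Lemma bern_diff (m : nat) (x : R) : bern (S m) (x + 1) - bern (S m) x = INR (S m) * x ^ m.
Proof.
  destruct (bern_facts m) as (Hc & Hp & Hd).
  assert (E : forall y, bern (S m) y = bern (S m) 0 + INR (S m) * bern_prim m y).
  { intros y.
    assert (I : is_RInt (fun t => INR (S m) * bern m t) 0 y (bern (S m) y - bern (S m) 0)).
    { apply (is_RInt_derive (V := R_CompleteNormedModule) (bern (S m))). intros t _; apply Hd.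
      intros t _. apply (continuous_mult_R (fun _ => INR (S m))). apply continuous_const. apply Hc. }
    assert (J := is_RInt_scal_R (bern m) 0 y (INR (S m)) _ (continuous_is_RInt _ 0 y Hc)).
    pose proof (is_RInt_unique_R _ _ _ _ I) as I'. rewrite (is_RInt_unique_R _ _ _ _ J) in I'. unfold bern_prim. lra. }
  rewrite (E (x + 1)), (E x), <- Hp. ring.
Qed.

Lemma zeta_reg_bern (m : nat) : forall p al, 0 < al -> zeta_reg (m + S p) (1 - RtoC (INR m)) al = RtoC (bern m al).
Proof.
  induction m as [|m IH]; intros p al hal.
  (* At s = 1 the factor s - 1 annihilates the average; what remains, al^0 = 1, is the residue of
     the zeta function. *)
  - simpl (0 + S p)%nat. simpl zeta_reg. simpl INR.
    replace (1 - (1 - RtoC 0))%C with (RtoC (INR 0)) by (simpl; C_parts).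
    rewrite cpow_INR by exact hal. simpl. C_parts.
  - rewrite Nat.add_succ_l.
    change (zeta_reg (S (m + S p)) (1 - RtoC (INR (S m))) al) with
     (cpow al (1 - (1 - RtoC (INR (S m)))) + (1 - RtoC (INR (S m)) - 1) * weight_avg (zeta_reg (m + S p) (1 - RtoC (INR (S m)) + 1)) al)%C.
    replace (1 - (1 - RtoC (INR (S m))))%C with (RtoC (INR (S m))) by ring.
    rewrite cpow_INR by exact hal.
    replace (1 - RtoC (INR (S m)) + 1)%C with (1 - RtoC (INR m))%C by (rewrite S_INR, RtoC_plus; ring).
    replace (weight_avg (zeta_reg (m + S p) (1 - RtoC (INR m))) al) with (RtoC (RInt (fun v => (1 - v) * bern m (al + v)) 0 1)).
    + cbn [bern]. rewrite RtoC_minus, RtoC_mult. ring.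
    + symmetry. apply Cint_eq.
      * apply (is_RInt_ext_R (fun v => (1 - v) * bern m (al + v))). lra.
        intros t ht. rewrite IH by lra. rewrite <- RtoC_mult. reflexivity.
        simpl. apply continuous_is_RInt. intros t. apply continuous_mult_R.
        apply continuous_minus_R. apply continuous_const. apply continuous_id. apply continuous_shift_R, bern_cont.
      * apply (is_RInt_ext_R (fun v => 0)). lra.
        intros t ht. rewrite IH by lra. rewrite <- RtoC_mult. reflexivity.
        apply is_RInt_0_R.
Qed.

Lemma hurwitz_zeta_neg (k : nat) (al : R) : (1 <= k)%nat -> 0 < al ->
  hurwitz_zeta (- RtoC (INR k)) al = RtoC (- (bern (S k) al / INR (S k))).
Proof.
  intros hk hal. assert (h0 : 0 < INR k) by (apply lt_0_INR; lia).
  rewrite <- RtoC_opp. rewrite hurwitz_zeta_eq by lra.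
  rewrite (hurwitz_fun_eq (S k + 1)); [|simpl Re; rewrite plus_INR, S_INR; simpl (INR 1); lra|exact hal].
  replace (RtoC (- INR k)) with (1 - RtoC (INR (S k)))%C by (rewrite S_INR, RtoC_plus, RtoC_opp; ring).
  rewrite zeta_reg_bern by exact hal.
  replace (1 - RtoC (INR (S k)) - 1)%C with (RtoC (- INR (S k))) by (rewrite RtoC_opp; ring).
  assert (h1 : INR (S k) <> 0) by (apply not_0_INR; lia).
  rewrite <- RtoC_div by lra. f_equal. field. exact h1.
Qed.

(** * Fourier coefficients of the Bernoulli polynomials *)

Section BernFourier.
Variables (x0 : R) (n : nat).
Let w := 2 * PI * INR (S n).
Let cc (m : nat) : R := RInt (fun t => bern m t * cos (w * (x0 - t))) 0 1.
Let ss (m : nat) : R := RInt (fun t => bern m t * sin (w * (x0 - t))) 0 1.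

Lemma bern_freq_pos : 0 < w.
Proof. unfold w. pose proof PI_RGT_0. pose proof (lt_0_INR (S n) ltac:(lia)). nra. Qed.

Lemma trig_one_period : cos (w * (x0 - 1)) = cos (w * x0) /\ sin (w * (x0 - 1)) = sin (w * x0).
Proof.
  replace (w * x0) with (w * (x0 - 1) + 2 * INR (S n) * PI) by (unfold w; ring).
  rewrite cos_period, sin_period. auto.
Qed.

Lemma bern_trig_continuous (m : nat) (t : R) :
  continuous (fun t => bern m t * cos (w * (x0 - t))) t /\ continuous (fun t => bern m t * sin (w * (x0 - t))) t.
Proof.
  split; (apply (continuous_mult_R (bern m)); [apply bern_cont|]); apply ex_derive_continuous_R; auto_derive; auto.
Qed.

Lemma is_RInt_parts (f df g dg : R -> R) (l : R) : (forall t, is_derive f t (df t)) -> (forall t, is_derive g t (dg t)) ->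
  (forall t, continuous df t) -> (forall t, continuous dg t) ->
  is_RInt (fun t => df t * g t) 0 1 l -> is_RInt (fun t => f t * dg t) 0 1 (f 1 * g 1 - f 0 * g 0 - l).
Proof.
  intros Hf Hg Cf Cg Hl.
  assert (I : is_RInt (fun t => df t * g t + f t * dg t) 0 1 (f 1 * g 1 - f 0 * g 0)).
  { apply (is_RInt_derive_R (fun t => f t * g t)). lra. intros t _. apply is_derive_mult_R; auto.
    intros t _. apply continuous_plus_R; apply continuous_mult_R; auto;
    [apply (is_derive_cont _ _ _ (Hg t))|apply (is_derive_cont _ _ _ (Hf t))]. }
  apply (is_RInt_eq_R (fun t => (df t * g t + f t * dg t) - df t * g t)). intros; ring.
  apply is_RInt_minus_R; assumption.
Qed.

Lemma bern_cos_coef_step (m : nat) : cc (S m) = - (bern (S m) 1 - bern (S m) 0) * sin (w * x0) / w + INR (S m) / w * ss m.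
Proof.
  pose proof bern_freq_pos as hw. apply is_RInt_unique_R.
  assert (Hl : is_RInt (fun t => INR (S m) * bern m t * (- sin (w * (x0 - t)) / w)) 0 1 (- INR (S m) / w * ss m)).
  { apply (is_RInt_eq_R (fun t => - INR (S m) / w * (bern m t * sin (w * (x0 - t))))). intros; field; lra.
    apply is_RInt_scal_R. apply continuous_is_RInt. intros t; exact (proj2 (bern_trig_continuous m t)). }
  apply (is_RInt_parts (bern (S m)) (fun t => INR (S m) * bern m t) (fun t => - sin (w * (x0 - t)) / w)
    (fun t => cos (w * (x0 - t)))) in Hl.
  - destruct trig_one_period as [_ E]. rewrite E in Hl. rewrite Rminus_0_r in Hl.
    replace (- (bern (S m) 1 - bern (S m) 0) * sin (w * x0) / w + INR (S m) / w * ss m)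
     with (bern (S m) 1 * (- sin (w * x0) / w) - bern (S m) 0 * (- sin (w * x0) / w) - - INR (S m) / w * ss m) by (field; lra).
    exact Hl.
  - apply bern_facts.
  - intros t. auto_derive. auto. unfold Rminus. field. lra.
  - intros t. apply (continuous_mult_R (fun _ => INR (S m))). apply continuous_const. apply bern_cont.
  - intros t. apply ex_derive_continuous_R. auto_derive. auto.
Qed.

Lemma bern_sin_coef_step (m : nat) : ss (S m) = (bern (S m) 1 - bern (S m) 0) * cos (w * x0) / w - INR (S m) / w * cc m.
Proof.
  pose proof bern_freq_pos as hw. apply is_RInt_unique_R.
  assert (Hl : is_RInt (fun t => INR (S m) * bern m t * (cos (w * (x0 - t)) / w)) 0 1 (INR (S m) / w * cc m)).
  { apply (is_RInt_eq_R (fun t => INR (S m) / w * (bern m t * cos (w * (x0 - t))))). intros; field; lra.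
    apply is_RInt_scal_R. apply continuous_is_RInt. intros t; exact (proj1 (bern_trig_continuous m t)). }
  apply (is_RInt_parts (bern (S m)) (fun t => INR (S m) * bern m t) (fun t => cos (w * (x0 - t)) / w)
    (fun t => sin (w * (x0 - t)))) in Hl.
  - destruct trig_one_period as [E _]. rewrite E in Hl. rewrite Rminus_0_r in Hl.
    replace ((bern (S m) 1 - bern (S m) 0) * cos (w * x0) / w - INR (S m) / w * cc m)
     with (bern (S m) 1 * (cos (w * x0) / w) - bern (S m) 0 * (cos (w * x0) / w) - INR (S m) / w * cc m) by (field; lra).
    exact Hl.
  - apply bern_facts.
  - intros t. auto_derive. auto. unfold Rminus. field. lra.
  - intros t. apply (continuous_mult_R (fun _ => INR (S m))). apply continuous_const. apply bern_cont.
  - intros t. apply ex_derive_continuous_R. auto_derive. auto.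
Qed.

(** The convention 0 ^ 0 = 1 encodes the jump of B_1; every other boundary term in the integrations
    by parts vanishes. *)
Lemma bern_endpoints (m : nat) : bern (S m) 1 - bern (S m) 0 = INR (S m) * 0 ^ m.
Proof. rewrite <- (bern_diff m 0), Rplus_0_l. reflexivity. Qed.

Lemma bern_sin_coef_0 : ss 0 = 0.
Proof.
  apply is_RInt_unique_R. pose proof bern_freq_pos as hw.
  assert (E0 : cos (w * (x0 - 1)) / w - cos (w * (x0 - 0)) / w = 0).
  { destruct trig_one_period as [E _]. rewrite E, Rminus_0_r. ring. }
  refine (eq_ind _ (is_RInt (fun t => bern 0 t * sin (w * (x0 - t))) 0 1) _ _ E0).
  apply (is_RInt_derive_R (fun t => cos (w * (x0 - t)) / w)). lra.
    intros t _. simpl bern. auto_derive. auto. unfold Rminus. field. lra.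
    intros t _. exact (proj2 (bern_trig_continuous 0 t)).
Qed.

Lemma bern_cos_coef_odd (q : nat) :
  cc (S (2 * q)) = (-1) ^ S q * INR (fact (S (2 * q))) * sin (w * x0) / w ^ S (2 * q).
Proof.
  pose proof bern_freq_pos as hw. induction q as [|q IH].
  - simpl (2 * 0)%nat. rewrite bern_cos_coef_step, bern_sin_coef_0, bern_endpoints. simpl. field. lra.
  - replace (S (2 * S q)) with (S (S (S (2 * q)))) by lia.
    rewrite bern_cos_coef_step, bern_sin_coef_step, IH, !bern_endpoints.
    rewrite (pow_i (S (S (2 * q)))), (pow_i (S (2 * q))) by lia.
    rewrite (fact_simpl (S (S (2 * q)))), (fact_simpl (S (2 * q))), !mult_INR.
    rewrite <- !tech_pow_Rmult. field. split. apply pow_nonzero; lra. lra.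
Qed.
End BernFourier.

Lemma bern_odd_fourier (q : nat) (x0 sg : R) : 0 <= x0 <= 1 -> (1 <= q)%nat ->
  is_series (fun n => sin (2 * PI * INR (S n) * x0) / INR (S n) ^ S (2 * q)) sg ->
  bern (S (2 * q)) x0 = 2 * ((-1) ^ S q * INR (fact (S (2 * q))) / (2 * PI) ^ S (2 * q) * sg).
Proof.
  intros hx hq Hs. pose proof PI_RGT_0.
  set (K := (-1) ^ S q * INR (fact (S (2 * q))) / (2 * PI) ^ S (2 * q)).
  rewrite (fourier_pointwise (bern (S (2 * q))) x0 (K * sg)).
  (* The mean over [0, 1] is the unit-step integral at 0, that is 0 ^ (2 q + 1) = 0. *)
  - destruct (bern_facts (S (2 * q))) as (_ & Hp & _). specialize (Hp 0).
    unfold bern_prim in Hp. rewrite RInt_point, Rplus_0_l, pow_i in Hp by lia.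
    change (RInt (bern (S (2 * q))) 0 1 - 0 = 0) in Hp. rewrite Rminus_0_r in Hp. rewrite Hp. ring.
  - intros t; apply bern_cont.
  - pose proof (bern_endpoints (2 * q)) as E. rewrite pow_i in E by lia. lra.
  - exact hx.
  - apply (is_series_ext_R (fun n => K * (sin (2 * PI * INR (S n) * x0) / INR (S n) ^ S (2 * q)))).
    2: { apply is_series_scal_R, Hs. }
    intros n. rewrite (bern_cos_coef_odd x0 n q). unfold K.
    rewrite (Rpow_mult_distr (2 * PI) (INR (S n))).
    assert (hA : (2 * PI) ^ S (2 * q) <> 0) by (apply pow_nonzero; lra).
    assert (hB : INR (S n) ^ S (2 * q) <> 0) by (apply pow_nonzero, not_0_INR; lia).
    revert hA hB. generalize ((2 * PI) ^ S (2 * q)), (INR (S n) ^ S (2 * q)). intros A B hA hB. field. auto.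
Qed.

Lemma sin_series_ex (p : nat) (x0 : R) : (1 <= p)%nat ->
  ex_series (fun n => sin (2 * PI * INR (S n) * x0) / INR (S n) ^ S p).
Proof.
  intros hp. apply (ex_series_le_R _ (fun n => Rpower (INR n + 1) (- INR (S p)))).
  - intros n. rewrite S_INR. pose proof (pos_INR n).
    rewrite Rpower_Ropp, Rpower_pow by lra. unfold Rdiv. rewrite Rabs_mult, Rabs_inv.
    rewrite (Rabs_pos_eq ((INR n + 1) ^ S p)) by (apply pow_le; lra).
    rewrite <- (Rmult_1_l (/ (INR n + 1) ^ S p)) at 2. apply Rmult_le_compat_r.
    left; apply Rinv_0_lt_compat, pow_lt; lra.
    apply Rabs_le. pose proof (SIN_bound (2 * PI * (INR n + 1) * x0)). lra.
  - apply ex_series_Rpower. lra. rewrite S_INR. pose proof (le_INR 1 p hp) as E. simpl in E. lra.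
Qed.

(** The sine series changes sign under th -> 1 - th, so the difference is twice one value; together
    with the 2 of the Fourier series this gives the factor 4. The denominator 2 q + 1 of the zeta
    value cancels against the factorial. *)
Lemma zeta_diff (q : nat) (th sg : R) : 0 < th < 1 -> (1 <= q)%nat ->
  is_series (fun n => sin (2 * PI * INR (S n) * th) / INR (S n) ^ S (2 * q)) sg ->
  (hurwitz_zeta (- RtoC (INR (2 * q))) th - hurwitz_zeta (- RtoC (INR (2 * q))) (1 - th))%C =
  RtoC (4 * ((-1) ^ q * INR (fact (2 * q)) / (2 * PI) ^ S (2 * q)) * sg).
Proof.
  intros hth hq Hs. pose proof PI_RGT_0.
  assert (Hs' : is_series (fun n => sin (2 * PI * INR (S n) * (1 - th)) / INR (S n) ^ S (2 * q)) (-1 * sg)).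
  { apply (is_series_ext_R (fun n => -1 * (sin (2 * PI * INR (S n) * th) / INR (S n) ^ S (2 * q)))).
    - intros n. replace (2 * PI * INR (S n) * (1 - th)) with (- (2 * PI * INR (S n) * th) + 2 * INR (S n) * PI) by ring.
      rewrite sin_period, sin_neg. field. apply pow_nonzero, not_0_INR. lia.
    - apply is_series_scal_R, Hs. }
  rewrite !hurwitz_zeta_neg by (lia || lra).
  rewrite (bern_odd_fourier q th sg), (bern_odd_fourier q (1 - th) (-1 * sg)) by (lra || lia || assumption).
  rewrite <- RtoC_minus. f_equal.
  rewrite fact_simpl, mult_INR. simpl ((-1) ^ S q). field.
  split. apply pow_nonzero; lra. apply not_0_INR; lia.
Qed.

(** * The Lipschitz summation formula *)

(** This is (a + 1)^a, an upper bound of t^a exp (- t). It is cruder than the maximum (a / e)^a, but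
    its logarithm ln (a + 1) causes no trouble at a = 0. *)
Definition exp_decay_const (a : R) : R := exp (a * ln (a + 1)).

Lemma Rpower_exp_bound (a t : R) : 0 <= a -> 0 < t -> Rpower t a * exp (- t) <= exp_decay_const a.
Proof.
  intros ha ht. unfold Rpower, exp_decay_const. rewrite <- exp_plus. apply exp_le.
  assert (E : ln (t / (a + 1)) <= t / (a + 1)).
  { pose proof (exp_ineq1_le (ln (t / (a + 1)))). rewrite exp_ln in H by (apply Rdiv_lt_0_compat; lra). lra. }
  rewrite ln_div in E by lra.
  assert (a * (t / (a + 1)) <= t).
  { replace t with ((a + 1) * (t / (a + 1))) at 2 by (field; lra).
    apply Rmult_le_compat_r. apply Rdiv_le_0_compat; lra. lra. }
  nra.
Qed.

Lemma exp_neg_le_Rpower (a y : R) : 0 <= a -> 0 < y -> exp (- y) <= exp_decay_const a * Rpower y (- a).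
Proof.
  intros ha hy. pose proof (Rpower_exp_bound a y ha hy).
  rewrite Rpower_Ropp. pose proof (Rpower_pos y a).
  apply Rmult_le_reg_r with (Rpower y a). lra. rewrite Rmult_assoc, Rinv_l by lra. lra.
Qed.

Definition pow_exp (k : nat) (c u : R) : R := u ^ k * exp (- c * u).

(** The free exponent p distributes the exponential decay: c^(-p) for one variable, y^(k-p) for the
    other. Choosing p suitably turns each double series below into one with a product majorant. *)
Lemma pow_exp_bound (k : nat) (c y p : R) : 0 < c -> 0 < y -> 0 <= p ->
  pow_exp k c y <= exp_decay_const p * Rpower c (- p) * Rpower y (- (p - INR k)).
Proof.
  intros hc hy hp. unfold pow_exp.
  pose proof (exp_neg_le_Rpower p (c * y) hp ltac:(nra)) as E.
  rewrite <- Rpower_mult_distr in E by assumption.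
  replace (- c * y) with (- (c * y)) by ring.
  replace (- (p - INR k)) with (INR k + - p) by ring. rewrite Rpower_plus, Rpower_pow by assumption.
  replace (exp_decay_const p * Rpower c (- p) * (y ^ k * Rpower y (- p)))
    with (y ^ k * (exp_decay_const p * (Rpower c (- p) * Rpower y (- p)))) by ring.
  apply Rmult_le_compat_l. apply pow_le; lra. exact E.
Qed.

Lemma ex_series_pow_exp_shift (k : nat) (c : R) : 0 < c ->
  ex_series (fun m => (INR m + 1) ^ k * exp (- c * INR m)).
Proof.
  intros hc. pose proof (pos_INR k).
  apply (ex_series_le_R _ (fun m => exp c * (exp_decay_const (INR k + 2) * Rpower c (- (INR k + 2))) * Rpower (INR m + 1) (Ropp 2))).
  - intros m. pose proof (pos_INR m). rewrite Rabs_pos_eq.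
    2: { apply Rmult_le_pos. apply pow_le; lra. left; apply exp_pos. }
    replace ((INR m + 1) ^ k * exp (- c * INR m)) with (exp c * pow_exp k c (INR m + 1)).
    2: { unfold pow_exp. rewrite <- (Rmult_comm (exp _)), <- Rmult_assoc, <- exp_plus, Rmult_comm. do 2 f_equal. ring. }
    rewrite Rmult_assoc. apply Rmult_le_compat_l. left; apply exp_pos.
    pose proof (pow_exp_bound k c (INR m + 1) (INR k + 2) hc ltac:(lra) ltac:(lra)) as E.
    replace (INR k + 2 - INR k) with 2 in E by ring. exact E.
  - apply (ex_series_scal_l (V := R_NormedModule) (exp c * (exp_decay_const (INR k + 2) * Rpower c (- (INR k + 2))))).
    apply ex_series_Rpower; lra.
Qed.

Definition lerch (k : nat) (c x : R) : R := Series (fun m => pow_exp k c (INR m + x)).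

Lemma pow_exp_unit_bound (k m : nat) (c x : R) : 0 < c -> 0 <= x <= 1 ->
  Rabs (pow_exp k c (INR m + x)) <= (INR m + 1) ^ k * exp (- c * INR m).
Proof.
  intros hc hx. pose proof (pos_INR m). unfold pow_exp. rewrite Rabs_pos_eq.
  2: { apply Rmult_le_pos. apply pow_le; lra. left; apply exp_pos. }
  apply Rmult_le_compat. apply pow_le; lra. left; apply exp_pos.
  apply pow_incr; lra. apply exp_le. nra.
Qed.

Lemma lerch_correct (k : nat) (c x : R) : 0 < c -> 0 <= x <= 1 ->
  is_series (fun m => pow_exp k c (INR m + x)) (lerch k c x).
Proof.
  intros hc hx. apply Series_correct. apply (ex_series_le_R _ (fun m => (INR m + 1) ^ k * exp (- c * INR m))).
  intros m. apply pow_exp_unit_bound; assumption. apply ex_series_pow_exp_shift, hc.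
Qed.

(** [fourier_pointwise] asks for continuity on the whole line, whereas the majorant of [lerch] is
    valid on [0, 1]; clamping extends the function by constants. *)
Definition clamp (t : R) : R := Rmax 0 (Rmin 1 t).

Lemma clamp_bounds (t : R) : 0 <= clamp t <= 1.
Proof. unfold clamp. split. apply Rmax_l. apply Rmax_lub. lra. apply Rmin_l. Qed.

Lemma clamp_id (t : R) : 0 <= t <= 1 -> clamp t = t.
Proof. intros h. unfold clamp. rewrite Rmin_right, Rmax_right; lra. Qed.

Lemma clamp_continuous (t : R) : continuous clamp t.
Proof.
  apply continuous_eps. intros eps he. exists eps. split. exact he. intros u hu.
  apply Rabs_def2 in hu.
  assert (K : forall t, t <= 0 /\ clamp t = 0 \/ 0 <= t <= 1 /\ clamp t = t \/ 1 <= t /\ clamp t = 1).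
  { intros v. unfold clamp. destruct (Rle_dec v 0). left. split. lra. rewrite Rmin_right, Rmax_left; lra.
    right. destruct (Rle_dec v 1). left. split. lra. rewrite Rmin_right, Rmax_right; lra.
    right. split. lra. rewrite Rmin_left, Rmax_right; lra. }
  destruct (K t) as [[? ->]|[[? ->]|[? ->]]], (K u) as [[? ->]|[[? ->]|[? ->]]]; apply Rabs_def1; lra.
Qed.

Lemma continuous_pow_exp (k : nat) (c u : R) : continuous (pow_exp k c) u.
Proof. apply ex_derive_continuous_R. unfold pow_exp. auto_derive. auto. Qed.

Lemma lerch_clamp_continuous (k : nat) (c t : R) : 0 < c -> continuous (fun t => lerch k c (clamp t)) t.
Proof.
  intros hc. apply (series_continuous (fun m t => pow_exp k c (INR m + clamp t))
    (fun m => (INR m + 1) ^ k * exp (- c * INR m)) t 1). lra.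
  - intros m. apply (continuous_comp (fun t => INR m + clamp t) (pow_exp k c)).
    apply continuous_plus_R. apply continuous_const. apply clamp_continuous. apply continuous_pow_exp.
  - intros m u _. apply pow_exp_unit_bound. exact hc. apply clamp_bounds.
  - apply ex_series_pow_exp_shift, hc.
Qed.

Lemma lerch_periodic (k : nat) (c : R) : 0 < c -> (1 <= k)%nat -> lerch k c 0 = lerch k c 1.
Proof.
  intros hc hk. unfold lerch. rewrite (Series_incr_1 (fun m => pow_exp k c (INR m + 0))).
  - simpl (INR 0). rewrite Rplus_0_l. unfold pow_exp at 1. rewrite pow_i by lia. rewrite Rmult_0_l, Rplus_0_l.
    apply Series_ext. intros m. rewrite S_INR, Rplus_0_r. reflexivity.
  - eexists. apply lerch_correct; lra.
Qed.

Section Coef.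
Variables (c w x0 : R) (n : nat).
Hypothesis hc : 0 < c.
Hypothesis hw : w = 2 * PI * INR n.
Let z : C := (c, w).

Lemma laplace_exponent_nz : z <> RtoC 0.
Proof. intros e. apply (f_equal fst) in e. simpl in e. lra. Qed.

(* Minus an antiderivative of u^k exp (- z u). *)
Fixpoint laplace_prim (k : nat) (u : R) : C :=
  match k with
  | O => cexp (- z * RtoC u) / z
  | S p => RtoC (u ^ S p) * cexp (- z * RtoC u) / z + RtoC (INR (S p)) / z * laplace_prim p u
  end%C.

Lemma Cder_laplace_exp (t : R) : Cder (fun u => cexp (- z * RtoC u)) t (- z * cexp (- z * RtoC t))%C.
Proof.
  unfold cexp, z. split; simpl; auto_derive; auto;
  rewrite ?Rmult_0_r, ?Rminus_0_r, ?Ropp_0, ?Rplus_0_r; ring.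
Qed.

Lemma Cder_ext_l (F : R -> C) (t : R) (l m : C) : l = m -> Cder F t l -> Cder F t m.
Proof. intros ->. auto. Qed.

Lemma Cder_laplace_prim (k : nat) (t : R) : Cder (laplace_prim k) t (- (RtoC (t ^ k) * cexp (- z * RtoC t)))%C.
Proof.
  pose proof laplace_exponent_nz as hz. induction k as [|k IH].
  - apply (Cder_ext_l _ _ (- z * cexp (- z * RtoC t) * / z + cexp (- z * RtoC t) * 0)%C).
    simpl pow. field. exact hz.
    apply (Cder_mult (fun u => cexp (- z * RtoC u)) (fun _ => / z)%C). apply Cder_laplace_exp. apply Cder_const.
  - assert (D1 : Cder (fun u => RtoC (u ^ S k)) t (RtoC (INR (S k) * t ^ k))).
    { apply Cder_RtoC. replace (INR (S k) * t ^ k) with (INR (S k) * 1 * t ^ pred (S k)) by (simpl pred; ring).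
      apply is_derive_pow. apply (is_derive_id (K := R_AbsRing)). }
    assert (D2 := Cder_mult _ _ t _ _ (Cder_mult _ _ t _ _ D1 (Cder_laplace_exp t)) (Cder_const (/ z) t)).
    assert (D3 := Cder_mult _ _ t _ _ (Cder_const (RtoC (INR (S k)) / z) t) IH).
    refine (Cder_ext_l _ _ _ _ _ (Cder_plus _ _ t _ _ D2 D3)).
    cbv beta. rewrite RtoC_mult. field. exact hz.
Qed.

Lemma laplace_prim_0 (k : nat) : laplace_prim k 0 = (RtoC (INR (fact k)) / z ^ S k)%C.
Proof.
  pose proof laplace_exponent_nz as hz. induction k as [|k IH].
  - simpl laplace_prim. replace (- z * 0)%C with (RtoC 0) by ring. rewrite cexp_0. simpl. field. exact hz.
  - cbn [laplace_prim]. rewrite IH, pow_i by lia. rewrite fact_simpl, mult_INR, RtoC_mult.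
    rewrite (Cpow_S z (S k)). field. split. apply Cpow_nz, hz. exact hz.
Qed.

Lemma laplace_prim_lim (k : nat) : is_lim_seq (fun m => Cmod (laplace_prim k (INR m))) 0.
Proof.
  assert (hz : 0 < Cmod z) by (apply Cmod_gt_0, laplace_exponent_nz).
  assert (T : forall p, is_lim_seq (fun m => INR m ^ p * exp (- c * INR m)) 0).
  { intros p. apply (is_lim_seq_le_le (fun _ => 0) _ (fun m => (INR m + 1) ^ p * exp (- c * INR m))).
    - intros m. pose proof (pos_INR m). split.
      apply Rmult_le_pos. apply pow_le; lra. left; apply exp_pos.
      apply Rmult_le_compat_r. left; apply exp_pos. apply pow_incr; lra.
    - apply is_lim_seq_const.
    - apply (ex_series_lim_0 _ (ex_series_pow_exp_shift p c hc)). }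
  assert (M : forall u, Cmod (cexp (- z * RtoC u)) = exp (- c * u)).
  { intros u. rewrite Cmod_cexp. f_equal. unfold z; simpl. ring. }
  induction k as [|k IH].
  - apply (is_lim_seq_ext (fun m => / Cmod z * (INR m ^ 0 * exp (- c * INR m)))).
    + intros m. simpl laplace_prim. rewrite Cmod_div by apply laplace_exponent_nz. rewrite M. simpl pow. field. lra.
    + replace (Finite 0) with (Rbar_mult (/ Cmod z) 0) by (simpl; f_equal; ring).
      apply is_lim_seq_scal_l. apply T.
  - apply (is_lim_seq_le_le (fun _ => 0) _ (fun m => / Cmod z * (INR m ^ S k * exp (- c * INR m)) + INR (S k) / Cmod z * Cmod (laplace_prim k (INR m)))).
    + intros m. split. apply Cmod_ge_0. cbn [laplace_prim]. eapply Rle_trans. apply Cmod_triangle.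
      right. rewrite Cmod_div, !Cmod_mult, Cmod_div, M, !Cmod_R by apply laplace_exponent_nz.
      rewrite (Rabs_pos_eq (INR m ^ S k)) by (apply pow_le, pos_INR).
      rewrite (Rabs_pos_eq (INR (S k))) by apply pos_INR. field. lra.
    + apply is_lim_seq_const.
    + replace (Finite 0) with (Finite (/ Cmod z * 0 + INR (S k) / Cmod z * 0)) by (f_equal; ring).
      apply is_lim_seq_plus'.
      * apply (is_lim_seq_scal_l _ (/ Cmod z) 0). apply T.
      * apply (is_lim_seq_scal_l _ (INR (S k) / Cmod z) 0). exact IH.
Qed.

Let ph : C := cexp (0, w * x0).

(** Unfolding: w being 2 pi times an integer, the phase at t and at m + t coincide, so the sum of
    integrals over [0, 1] is the Laplace integral over [0, oo). It is computed by telescoping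
    [laplace_prim] over the unit intervals. *)
Lemma lerch_coef (k : nat) :
  RInt (fun t => lerch k c (clamp t) * cos (w * (x0 - t))) 0 1 =
  Re (ph * (RtoC (INR (fact k)) / z ^ S k)).
Proof.
  set (f := fun (m : nat) t => (ph * (RtoC ((INR m + t) ^ k) * cexp (- z * RtoC (INR m + t))))%C).
  assert (cf : forall m t, cont_at (f m) t).
  { intros m t. unfold f. apply (cont_at_mult (fun _ => ph)). apply cont_at_const.
    apply (cont_at_shift (fun u => RtoC (u ^ k) * cexp (- z * RtoC u))%C).
    apply cont_at_mult. apply cont_at_RtoC. apply ex_derive_continuous_R. auto_derive; auto.
    apply (Cder_cont _ _ _ (Cder_laplace_exp _)). }
  assert (I : forall m, Cint (f m) 0 1 = (ph * laplace_prim k (INR m) - ph * laplace_prim k (INR (S m)))%C).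
  { intros m. unfold f.
    rewrite (Cint_FTC 0 1 Rle_0_1 (fun t => - ph * laplace_prim k (INR m + t))%C).
    - rewrite Rplus_0_r, S_INR. ring.
    - intros t _.
      assert (Dp : Cder (fun t => laplace_prim k (INR m + t)) t (- (RtoC ((INR m + t) ^ k) * cexp (- z * RtoC (INR m + t))))%C).
      { destruct (Cder_laplace_prim k (INR m + t)) as [D1 D2]. split.
        apply (is_derive_shift (fun u => Re (laplace_prim k u))). exact D1.
        apply (is_derive_shift (fun u => Im (laplace_prim k u))). exact D2. }
      refine (Cder_ext_l _ _ _ _ _ (Cder_mult _ _ t _ _ (Cder_const (- ph) t) Dp)). ring.
    - intros t _. apply (cf m t). }
  assert (R1 : forall m t, Re (f m t) = pow_exp k c (INR m + t) * cos (w * (x0 - t))).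
  { intros m t. unfold f, ph, cexp, z, pow_exp. simpl. rewrite exp_0.
    replace (- c * (INR m + t) - - w * 0) with (- c * (INR m + t)) by ring.
    replace (- c * 0 + - w * (INR m + t)) with (- (w * (INR m + t))) by ring.
    rewrite cos_neg, sin_neg.
    replace (cos (w * (x0 - t))) with (cos (w * x0 - w * (INR m + t))).
    (* Here w m = 2 pi n m is a multiple of the period. *)
    2: { rewrite <- (cos_period (w * x0 - w * (INR m + t)) (n * m)). f_equal. rewrite hw, mult_INR. ring. }
    rewrite cos_minus. ring. }
  assert (T := telescoping_C (fun m => ph * laplace_prim k (INR m))%C).
  assert (T2 : is_seriesC (fun m => ph * laplace_prim k (INR m) - ph * laplace_prim k (INR (S m)))%C (ph * laplace_prim k (INR 0))%C).
  { apply T. apply (is_lim_seq_ext (fun m => Cmod ph * Cmod (laplace_prim k (INR m)))). intros m; rewrite Cmod_mult; auto.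
    replace (Finite 0) with (Rbar_mult (Cmod ph) 0) by (simpl; f_equal; ring).
    apply is_lim_seq_scal_l. apply laplace_prim_lim. }
  simpl (INR 0) in T2. rewrite laplace_prim_0 in T2. apply is_series_C in T2. destruct T2 as [T2 _].
  rewrite <- (is_series_unique _ _ T2).
  assert (B : forall m t, 0 <= t <= 1 -> Rabs (Re (f m t)) <= (INR m + 1) ^ k * exp (- c * INR m)).
  { intros m t ht. rewrite R1, Rabs_mult. rewrite <- (Rmult_1_r (_ * exp _)).
    apply Rmult_le_compat; try apply Rabs_pos. apply pow_exp_unit_bound; assumption.
    apply Rabs_le. pose proof (COS_bound (w * (x0 - t))). lra. }
  assert (EQ : forall t, 0 <= t <= 1 -> Series (fun m => Re (f m t)) = lerch k c (clamp t) * cos (w * (x0 - t))).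
  { intros t ht. rewrite clamp_id by exact ht. unfold lerch. rewrite <- Series_scal_r.
    apply Series_ext. intros m. apply R1. }
  assert (EI : is_RInt (fun t => Series (fun m => Re (f m t))) 0 1 (RInt (fun t => lerch k c (clamp t) * cos (w * (x0 - t))) 0 1)).
  { apply (is_RInt_ext_R (fun t => lerch k c (clamp t) * cos (w * (x0 - t)))). lra.
    intros t ht. symmetry. apply EQ. lra.
    apply continuous_is_RInt. intros t. apply continuous_mult_R. apply lerch_clamp_continuous, hc.
    apply continuous_cos_shift. }
  rewrite <- (is_RInt_unique_R _ _ _ _ EI).
  symmetry. apply is_series_unique.
  apply (is_series_ext_R (fun m => RInt (fun t => Re (f m t)) 0 1)).
  { intros m. rewrite <- I. reflexivity. }
  apply (series_RInt (fun m t => Re (f m t)) (fun m => (INR m + 1) ^ k * exp (- c * INR m)) 0 1 Rle_0_1).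
  - intros m t _. exact (proj1 (cf m t)).
  - eexists. exact EI.
  - exact B.
  - apply ex_series_pow_exp_shift, hc.
Qed.
End Coef.

Definition freq (c : R) (n : nat) : C := (c, 2 * PI * INR n).

(** The terms of index n and - n of the two-sided formula are conjugate, hence twice a real part.
    The index 0 gives k! / c^(k+1). *)
Theorem lipschitz (k : nat) (c x l : R) : 0 < c -> (1 <= k)%nat -> 0 <= x <= 1 ->
  is_series (fun n => Re (cexp (0, 2 * PI * INR (S n) * x) / freq c (S n) ^ S k)) l ->
  lerch k c x = INR (fact k) / c ^ S k + 2 * (INR (fact k) * l).
Proof.
  intros hc hk hx Hl.
  rewrite <- (clamp_id x hx).
  rewrite (fourier_pointwise (fun t => lerch k c (clamp t)) x (INR (fact k) * l)).
  - f_equal.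
    assert (E := lerch_coef c 0 x 0 hc ltac:(simpl; ring) k).
    rewrite Rmult_0_l in E. change (0, 0) with (RtoC 0) in E. rewrite cexp_0, Cmult_1_l in E.
    change (c, 0) with (RtoC c) in E. rewrite <- RtoC_pow, <- RtoC_div in E by (apply pow_nonzero; lra).
    rewrite re_RtoC in E. rewrite <- E. apply RInt_ext_R. intros t. rewrite Rmult_0_l, cos_0. ring.
  - intros t. apply lerch_clamp_continuous, hc.
  - rewrite !clamp_id by lra. apply lerch_periodic; assumption.
  - exact hx.
  - apply (is_series_ext_R (fun n => INR (fact k) * Re (cexp (0, 2 * PI * INR (S n) * x) / freq c (S n) ^ S k))).
    2: apply is_series_scal_R, Hl.
    intros n. rewrite (lerch_coef c (2 * PI * INR (S n)) x (S n) hc eq_refl k).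
    change (c, 2 * PI * INR (S n)) with (freq c (S n)).
    rewrite <- re_scal_l. f_equal. unfold Cdiv. ring.
Qed.

(** * Transformation of the Lambert series *)

Lemma Series_sum_n (a : nat -> nat -> R) (N : nat) : (forall j, ex_series (fun i => a i j)) ->
  is_series (fun i => sum_n (a i) N) (sum_n (fun j => Series (fun i => a i j)) N).
Proof.
  intros H. induction N.
  - rewrite sum_O. apply (is_series_ext_R (fun i => a i O)). intros i; rewrite sum_O; auto.
    apply Series_correct, H.
  - rewrite sum_n_S_R. apply (is_series_ext_R (fun i => sum_n (a i) N + a i (S N))).
    intros i; rewrite sum_n_S_R; auto. apply is_series_plus_R. exact IHN. apply Series_correct, H.
Qed.

Section Swap.
Variables (a : nat -> nat -> R) (u v : nat -> R).
Hypothesis Hb : forall i j, Rabs (a i j) <= u i * v j.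
Hypothesis Hu : ex_series u.
Hypothesis Hv : ex_series v.
Hypothesis Hu0 : forall i, 0 <= u i.


Lemma swap_ex_col (j : nat) : ex_series (fun i => a i j).
Proof. apply (ex_series_le_R _ (fun i => u i * v j)). intros i; apply Hb. apply ex_series_scal_r, Hu. Qed.

Lemma swap_ex_sum : ex_series (fun i => Series (a i)).
Proof.
  apply (ex_series_le_R _ (fun i => u i * Series v)). 2: apply ex_series_scal_r, Hu.
  intros i. rewrite <- Series_scal_l. apply Series_abs_le. intros j; apply Hb.
  apply (ex_series_scal_l (V := R_NormedModule) (u i)), Hv.
Qed.

(** The remainder after N columns is at most [Series u] times the tail of [v], because the majorant
    is a product. *)
Lemma series_swap : is_series (fun j => Series (fun i => a i j)) (Series (fun i => Series (a i))).
Proof.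
  assert (hU : 0 <= Series u).
  { eapply Rle_trans; [|apply (sum_n_le_Series u O Hu0 Hu)]. rewrite sum_O. apply Hu0. }
  apply (is_series_of_tail _ v _ (Series u) hU). 2: exact Hv.
  intros N.
  assert (E := is_series_minus_R _ _ _ _ (Series_correct _ swap_ex_sum) (Series_sum_n a N swap_ex_col)).
  rewrite <- (is_series_unique _ _ E).
  rewrite <- Series_scal_r. apply Series_abs_le.
  - intros i. rewrite Rmult_minus_distr_l, <- Series_scal_l.
    replace (u i * sum_n v N) with (sum_n (fun j => u i * v j) N).
    + apply tail_bound. intros j; apply Hb. apply (ex_series_scal_l (V := R_NormedModule) (u i)), Hv.
    + apply sum_n_scal_R.
  - apply ex_series_scal_r, Hu.
Qed.
End Swap.

Section Sparse.
Variables (f : nat -> R) (p : nat).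
Hypothesis hp : (1 <= p)%nat.
Let f' (n : nat) : R := if Nat.eqb ((n + 1) mod p) 0 then f (n + 1)%nat else 0.
(** The sum over the shifted indices 1, ..., N, so that complete blocks end exactly at the multiples
    of p. *)
Let T (N : nat) : R := match N with O => 0 | S n => sum_n f' n end.

Lemma sparse_sum_S (n : nat) : T (S n) = T n + f' n.
Proof. destruct n; simpl. rewrite sum_O. ring. apply sum_n_S_R. Qed.

Lemma sparse_sum_flat (M i : nat) : (i < p)%nat -> T (p * M + i) = T (p * M).
Proof.
  induction i as [|i IH]; intros hi. f_equal; lia.
  rewrite Nat.add_succ_r, sparse_sum_S, IH by lia. unfold f'.
  replace ((p * M + i + 1) mod p)%nat with (S i).
  - simpl. ring.
  - apply (Nat.mod_unique _ p M); lia.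
Qed.

Lemma sparse_sum_mult (M : nat) : T (p * (M + 1)) = sum_n (fun m => f (p * (m + 1))%nat) M.
Proof.
  assert (St : forall M, T (p * (M + 1)) = T (p * M) + f (p * (M + 1))%nat).
  { intros K. replace (p * (K + 1))%nat with (S (p * K + (p - 1))) at 1 by nia.
    rewrite sparse_sum_S, sparse_sum_flat by lia. unfold f'.
    replace (p * K + (p - 1) + 1)%nat with ((K + 1) * p)%nat by nia.
    rewrite Nat.Div0.mod_mul. simpl Nat.eqb. cbv iota. rewrite (Nat.mul_comm p (K + 1)). reflexivity. }
  induction M.
  - rewrite sum_O, St, Nat.mul_0_r. simpl T. ring.
  - rewrite sum_n_S_R, <- IHM, St. replace (S M) with (M + 1)%nat by lia. reflexivity.
Qed.

(** Partial sums of [f'] change only at multiples of p, so the partial sums over the multiples form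
    a subsequence of them. *)
Lemma sparse_series : ex_series f' -> is_series (fun m => f (p * (m + 1))%nat) (Series f').
Proof.
  intros E. assert (L : is_lim_seq (sum_n f') (Series f')) by exact (Series_correct _ E).
  change (is_lim_seq (sum_n (fun m => f (p * (m + 1))%nat)) (Series f')).
  apply (is_lim_seq_ext (fun M => sum_n f' (p * (M + 1) - 1))).
  - intros M. rewrite <- sparse_sum_mult. destruct (p * (M + 1))%nat eqn:E1. nia.
    simpl. do 2 f_equal. lia.
  - apply (is_lim_seq_subseq (sum_n f') _ (fun M => (p * (M + 1) - 1)%nat)). 2: exact L.
    intros P [N HN]. exists N. intros n hn. apply HN. nia.
Qed.
End Sparse.

Lemma finite_series (f : nat -> R) (n : nat) : (forall j, (n < j)%nat -> f j = 0) -> is_series f (sum_n f n).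
Proof.
  intros H. change (is_lim_seq (sum_n f) (sum_n f n)).
  apply (is_lim_seq_ext_loc (fun _ => sum_n f n)).
  - exists n. intros m hm. induction hm. reflexivity. rewrite sum_n_S_R, <- IHhm, H by lia. symmetry. apply Rplus_0_r.
  - apply is_lim_seq_const.
Qed.

(** * From divisor sums to a double series over divisor and cofactor *)

Section Regroup.
Variables (k : nat) (th y : R).
Hypothesis hy : 0 < y.
Hypothesis hk : (1 <= k)%nat.

Let g (d n : nat) : R := INR d ^ k * sin (2 * PI * INR n * th / INR d) * exp (- y * INR n).
(** The divisor sums as rows of an infinite square table: row n belongs to the integer n + 1, column
    j to the candidate divisor j + 1. *)
Let b (n j : nat) : R := if Nat.eqb ((n + 1) mod (j + 1)) 0 then g (j + 1) (n + 1) else 0.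
Let e (j m : nat) : R := g (j + 1) ((j + 1) * (m + 1)).

Lemma divisor_term_bound (d n : nat) : Rabs (g d n) <= INR d ^ k * exp (- y * INR n).
Proof.
  unfold g. rewrite !Rabs_mult. rewrite (Rabs_pos_eq (INR d ^ k)) by (apply pow_le, pos_INR).
  rewrite (Rabs_pos_eq (exp _)) by (left; apply exp_pos).
  apply Rmult_le_compat_r. left; apply exp_pos. rewrite <- (Rmult_1_r (INR d ^ k)) at 2.
  apply Rmult_le_compat_l. apply pow_le, pos_INR. apply Rabs_le. pose proof (SIN_bound (2 * PI * INR n * th / INR d)). lra.
Qed.

(** A divisor does not exceed its multiple, so the factor (n + 1)^2 / (j + 1)^2 >= 1 may be
    inserted. Two powers of n, absorbed by the exponential, buy summability in j. *)
Lemma divisor_table_bound (n j : nat) : Rabs (b n j) <= (exp (- y) * ((INR n + 1) ^ (k + 2) * exp (- y * INR n))) * Rpower (INR j + 1) (Ropp 2).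
Proof.
  pose proof (pos_INR n). pose proof (pos_INR j).
  assert (R2 : Rpower (INR j + 1) (Ropp 2) = / (INR j + 1) ^ 2).
  { rewrite Rpower_Ropp. f_equal. replace 2 with (INR 2) by (simpl; ring). rewrite Rpower_pow by lra. simpl; ring. }
  assert (P2 : 0 < (INR j + 1) ^ 2) by (apply pow_lt; lra).
  unfold b. destruct (Nat.eqb ((n + 1) mod (j + 1)) 0) eqn:E0.
  - apply Nat.eqb_eq in E0. apply Nat.Div0.mod_divides in E0. destruct E0 as [t ht].
    assert (hjn : (j <= n)%nat) by (destruct t; nia). apply le_INR in hjn.
    eapply Rle_trans. apply divisor_term_bound. rewrite !plus_INR. simpl (INR 1).
    rewrite R2. apply Rmult_le_reg_r with ((INR j + 1) ^ 2). exact P2.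
    rewrite (Rmult_assoc (exp (- y) * _)), Rinv_l, Rmult_1_r by lra.
    replace (exp (- y * (INR n + 1))) with (exp (- y) * exp (- y * INR n)) by (rewrite <- exp_plus; f_equal; ring).
    replace ((INR j + 1) ^ k * (exp (- y) * exp (- y * INR n)) * (INR j + 1) ^ 2)
      with (exp (- y) * ((INR j + 1) ^ (k + 2) * exp (- y * INR n))) by (rewrite pow_add; ring).
    apply Rmult_le_compat_l. left; apply exp_pos. apply Rmult_le_compat_r. left; apply exp_pos.
    apply pow_incr. lra.
  - rewrite Rabs_R0, R2. apply Rmult_le_pos. apply Rmult_le_pos. left; apply exp_pos.
    apply Rmult_le_pos. apply pow_le; lra. left; apply exp_pos. left; apply Rinv_0_lt_compat, P2.
Qed.

Lemma grouped_term_eq (j m : nat) : e j m = (INR j + 1) ^ k * sin (2 * PI * (INR m + 1) * th) * exp (- y * ((INR j + 1) * (INR m + 1))).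
Proof.
  unfold e, g. rewrite mult_INR, !plus_INR. simpl (INR 1). pose proof (pos_INR j).
  replace (2 * PI * ((INR j + 1) * (INR m + 1)) * th / (INR j + 1)) with (2 * PI * (INR m + 1) * th) by (field; lra).
  reflexivity.
Qed.

Lemma grouped_term_bound (j m : nat) : Rabs (e j m) <=
  (exp_decay_const (INR k + 2) * Rpower y (- (INR k + 2)) * Rpower (INR j + 1) (Ropp 2)) * Rpower (INR m + 1) (- (INR k + 2)).
Proof.
  pose proof (pos_INR m). pose proof (pos_INR j). pose proof (pos_INR k).
  unfold e. eapply Rle_trans. apply divisor_term_bound. rewrite mult_INR, !plus_INR. simpl (INR 1).
  pose proof (pow_exp_bound k (y * (INR m + 1)) (INR j + 1) (INR k + 2) ltac:(nra) ltac:(lra) ltac:(lra)) as E.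
  rewrite <- Rpower_mult_distr in E by lra.
  replace (INR k + 2 - INR k) with 2 in E by ring. unfold pow_exp in E.
  replace (- (y * (INR m + 1)) * (INR j + 1)) with (- y * ((INR j + 1) * (INR m + 1))) in E by ring.
  lra.
Qed.

(** Two exchanges: from integers to divisors d and, once column d is rewritten over the multiples n
    = d m, from divisors to cofactors m. The sine then depends on m alone, and the sum over d is a
    [lerch] sum at 0. *)
Lemma lambert_regroup : is_series (fun n => divsum k th (n + 1) * exp (- INR (n + 1) * y))
  (Series (fun m => sin (2 * PI * INR (S m) * th) * lerch k (INR (S m) * y) 0)).
Proof.
  set (u := fun n => exp (- y) * ((INR n + 1) ^ (k + 2) * exp (- y * INR n))).
  set (v := fun j => Rpower (INR j + 1) (Ropp 2)).
  assert (Hu : ex_series u) by (apply (ex_series_scal_l (V := R_NormedModule) (exp (- y))); apply ex_series_pow_exp_shift, hy).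
  assert (Hv : ex_series v) by (apply ex_series_Rpower; lra).
  assert (Hu0 : forall n, 0 <= u n).
  { intros n. pose proof (pos_INR n). apply Rmult_le_pos. left; apply exp_pos. apply Rmult_le_pos. apply pow_le; lra. left; apply exp_pos. }
  assert (S1 : is_series (fun j => Series (fun n => b n j)) (Series (fun n => Series (b n)))).
  { apply (series_swap b u v); auto. apply divisor_table_bound. }
  set (K := exp_decay_const (INR k + 2) * Rpower y (- (INR k + 2))).
  set (u2 := fun j => K * Rpower (INR j + 1) (Ropp 2)). set (v2 := fun m => Rpower (INR m + 1) (- (INR k + 2))).
  assert (hK : 0 < K) by (apply Rmult_lt_0_compat; [apply exp_pos|apply Rpower_pos]).
  assert (S2 : is_series (fun m => Series (fun j => e j m)) (Series (fun j => Series (e j)))).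
  { apply (series_swap e u2 v2). apply grouped_term_bound.
    - apply (ex_series_scal_l (V := R_NormedModule) K). apply ex_series_Rpower; lra.
    - apply ex_series_Rpower. lra. pose proof (pos_INR k). lra.
    - intros i. apply Rmult_le_pos. lra. left; apply Rpower_pos. }
  assert (EQ1 : forall j, Series (e j) = Series (fun n => b n j)).
  { intros j. apply is_series_unique.
    apply (sparse_series (fun n => g (j + 1) n) (j + 1)). lia.
    apply (swap_ex_col b u v). apply divisor_table_bound. exact Hu. }
  assert (EQ2 : forall m, Series (fun j => e j m) = sin (2 * PI * INR (S m) * th) * lerch k (INR (S m) * y) 0).
  { intros m. assert (hm : 0 < INR (S m) * y) by (apply Rmult_lt_0_compat; [apply lt_0_INR; lia|exact hy]).
    (* The [lerch] sum starts at d = 0, the divisors at 1; the extra term carries 0 ^ k and vanishes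
       as k >= 1. *)
    unfold lerch. rewrite (Series_incr_1 (fun d => pow_exp k (INR (S m) * y) (INR d + 0))) by (eexists; apply lerch_correct; lra).
    simpl (INR 0). unfold pow_exp at 1. rewrite Rplus_0_r, pow_i, Rmult_0_l, Rplus_0_l by lia.
    rewrite <- Series_scal_l. apply Series_ext. intros j. rewrite grouped_term_eq. unfold pow_exp.
    rewrite !S_INR, Rplus_0_r. rewrite (Rmult_comm ((INR j + 1) ^ k)), Rmult_assoc. do 3 f_equal. ring. }
  assert (EQ3 : forall n, Series (b n) = divsum k th (n + 1) * exp (- INR (n + 1) * y)).
  { intros n. rewrite (is_series_unique _ _ (finite_series (b n) n ltac:(
      intros j hj; unfold b; rewrite Nat.mod_small by lia; replace (n + 1)%nat with (S n) by lia; reflexivity))).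
    unfold divsum. replace (n + 1 - 1)%nat with n by lia.
    rewrite Rmult_comm, <- sum_n_scal_R. apply sum_n_ext. intros j.
    unfold b, g. destruct (Nat.eqb _ 0); [|rewrite Rmult_0_r; reflexivity].
    rewrite Rmult_comm. do 2 f_equal. ring. }
  apply (is_series_ext_R (fun n => Series (b n)) _ _ EQ3).
  replace (Series (fun m => sin (2 * PI * INR (S m) * th) * lerch k (INR (S m) * y) 0)) with (Series (fun n => Series (b n))).
  - apply Series_correct. apply (swap_ex_sum b u v). apply divisor_table_bound. exact Hu. exact Hv.
  - rewrite <- (is_series_unique _ _ S1). rewrite <- (Series_ext _ _ EQ1), <- (is_series_unique _ _ S2).
    apply Series_ext, EQ2.
Qed.
End Regroup.

(** * The double series behind the transformation law *)

Lemma inv_pow_abs_bound (p : nat) (s t : R) : 0 < s -> 1 <= t -> (3 <= p)%nat ->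
  Cmod (/ ((s, t) : C) ^ p) <= Rpower (2 * s * t) (- (3 / 2)).
Proof.
  intros hs ht hp. set (z := (s, t) : C).
  assert (hz : z <> RtoC 0) by (intros e; apply (f_equal fst) in e; simpl in e; lra).
  assert (hr : 1 <= Cmod z).
  { pose proof (Im_le_Cmod z) as E. simpl in E. rewrite Rabs_pos_eq in E; lra. }
  rewrite Cmod_inv, Cmod_pow by (apply Cpow_nz, hz). rewrite Rpower_Ropp.
  apply Rinv_le_contravar. apply Rpower_pos.
  (* As |z| >= 1 the power can be lowered to 3; then s^2 + t^2 >= 2 s t separates the variables and
     halves the exponent to 3 / 2, still above 1. *)
  apply Rle_trans with (Cmod z ^ 3). 2: apply Rle_pow; assumption.
  assert (E : Rpower (Cmod z * Cmod z) (3 / 2) = Cmod z ^ 3).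
  { unfold Rpower. rewrite ln_mult by lra. replace (3 / 2 * (ln (Cmod z) + ln (Cmod z))) with (INR 3 * ln (Cmod z)) by (simpl; field).
    rewrite <- Rpower_pow by lra. reflexivity. }
  rewrite <- E. apply Rle_Rpower_l. lra. split. nra. rewrite Cmod_sqr. simpl. pose proof (Rle_0_sqr (s - t)) as Q. unfold Rsqr in Q. lra.
Qed.

Lemma Ci_pow_odd (q : nat) : (Ci ^ S (2 * q))%C = (RtoC ((-1) ^ q) * Ci)%C.
Proof.
  rewrite Cpow_S, Cpow_mult_r. replace (Ci ^ 2)%C with (RtoC (-1)) by (simpl; C_parts).
  rewrite <- RtoC_pow. ring.
Qed.

Lemma Cinv_conj_Re (z : C) : z <> RtoC 0 -> Re (/ Cconj z) = Re (/ z).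
Proof. intros h. rewrite <- Cinv_conj by exact h. apply re_conj. Qed.

(* With c + i w = 2 pi i (m - i beta), the factor i^(k+1) = (-1)^q i turns the odd part of the
   Lipschitz formula into a sine series with real coefficients. *)
Lemma freq_odd_part (q m n : nat) (th y : R) : 0 < y ->
  let c := 4 * PI ^ 2 * INR (S n) / y in
  Re (cexp (0, 2 * PI * INR (S m) * th) / freq c (S m) ^ S (2 * q)) - Re (cexp (0, 2 * PI * INR (S m) * (1 - th)) / freq c (S m) ^ S (2 * q))
  = 2 * ((-1) ^ q * y ^ S (2 * q) / (2 * PI) ^ S (2 * q)) *
    (sin (2 * PI * INR (S m) * th) * Re (/ freq (INR (S m) * y) (S n) ^ S (2 * q))).
Proof.
  intros hy c. pose proof PI_RGT_0 as hpi.
  assert (hm : 0 < INR (S m)) by (apply lt_0_INR; lia). assert (hn : 0 < INR (S n)) by (apply lt_0_INR; lia).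
  set (p := S (2 * q)). set (w := 2 * PI * INR (S m)).
  set (Z := freq (INR (S m) * y) (S n)).
  assert (hmy : INR (S m) * y <> 0) by nra.
  assert (hZ : Z <> RtoC 0) by (intros e; apply (f_equal fst) in e; exact (hmy e)).
  assert (hZc : Cconj Z <> RtoC 0) by (intros e; apply (f_equal fst) in e; exact (hmy e)).
  (* The duality behind the transformation law: c + 2 pi i m is 2 pi i / y times the conjugate of m
     y + 2 pi i n, so both Lipschitz expansions run over the same pairs (m, n). *)
  assert (hcp : freq c (S m) = (RtoC (2 * PI / y) * (Ci * Cconj Z))%C).
  { unfold freq, Z, c. apply C_ext; simpl; unfold freq; simpl; field; lra. }
  assert (hk0 : RtoC (2 * PI / y) <> RtoC 0).
  { intros e. apply (f_equal fst) in e. simpl in e. assert (0 < 2 * PI / y) by (apply Rdiv_lt_0_compat; lra). lra. }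
  set (e1 := cexp (0, w * th)). set (e2 := cexp (0, w * (1 - th))).
  assert (D : (e1 - e2)%C = (RtoC (2 * sin (w * th)) * Ci)%C).
  { unfold e1, e2, cexp. simpl.
    replace (w * (1 - th)) with (- (w * th) + 2 * INR (S m) * PI) by (unfold w; ring).
    rewrite cos_period, sin_period, cos_neg, sin_neg, exp_0. C_parts. }
  unfold Rminus at 1. rewrite <- re_opp, <- re_plus.
  replace (e1 / freq c (S m) ^ p + - (e2 / freq c (S m) ^ p))%C
    with ((e1 - e2) / freq c (S m) ^ p)%C by (unfold Cdiv; ring).
  rewrite D, hcp, !Cpow_mult_l. unfold p at 2. rewrite Ci_pow_odd, <- RtoC_pow.
  assert (hs : (-1) ^ q * (-1) ^ q = 1).
  { rewrite <- Rpow_mult_distr. replace (-1 * -1) with 1 by ring. apply pow1. }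
  assert (hs0 : (-1) ^ q <> 0) by (apply pow_nonzero; lra).
  replace (RtoC (2 * sin (w * th)) * Ci / (RtoC ((2 * PI / y) ^ p) * (RtoC ((-1) ^ q) * Ci * Cconj Z ^ p)))%C
    with (RtoC (2 * ((-1) ^ q * y ^ p / (2 * PI) ^ p) * sin (w * th)) * / Cconj (Z ^ p))%C.
  - rewrite re_scal_l, Cinv_conj_Re by (apply Cpow_nz, hZ). ring.
  - rewrite Cpow_conj.
    assert (E : 2 * ((-1) ^ q * y ^ p / (2 * PI) ^ p) * sin (w * th) = 2 * sin (w * th) / ((2 * PI / y) ^ p * (-1) ^ q)).
    { assert (Ep : (2 * PI / y) ^ p = (2 * PI) ^ p / y ^ p) by (unfold Rdiv; rewrite Rpow_mult_distr, pow_inv; reflexivity).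
      rewrite Ep.
      assert (y ^ p <> 0) by (apply pow_nonzero; lra). assert ((2 * PI) ^ p <> 0) by (apply pow_nonzero; lra).
      apply Rmult_eq_reg_r with ((-1) ^ q); [|exact hs0].
      replace (2 * ((-1) ^ q * y ^ p / (2 * PI) ^ p) * sin (w * th) * (-1) ^ q)
        with (2 * (((-1) ^ q * (-1) ^ q) * y ^ p / (2 * PI) ^ p) * sin (w * th)) by (unfold Rdiv; ring).
      rewrite hs. field. repeat split; assumption. }
    assert (hpw : (2 * PI / y) ^ p <> 0).
    { apply pow_nonzero. apply Rgt_not_eq. apply Rdiv_lt_0_compat; lra. }
    rewrite E, RtoC_div, RtoC_mult by (apply Rmult_integral_contrapositive; split; assumption).
    rewrite (RtoC_mult ((2 * PI / y) ^ p)).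
    field. repeat split;
      first [exact (Cpow_nz _ _ hZc) | exact Ci_nz | exact (fun e => hs0 (RtoC_inj _ _ e)) | exact (fun e => hpw (RtoC_inj _ _ e))].
Qed.

Lemma freq_inv_bound (q m n : nat) (y : R) : 0 < y -> (1 <= q)%nat ->
  Cmod (/ freq (INR (S m) * y) (S n) ^ S (2 * q)) <=
  (Rpower (4 * PI * y) (- (3 / 2)) * Rpower (INR m + 1) (- (3 / 2))) * Rpower (INR n + 1) (- (3 / 2)).
Proof.
  intros hy hq. pose proof (pos_INR m). pose proof (pos_INR n). pose proof PI2_3_2. 
  assert (hm : 0 < INR (S m)) by (apply lt_0_INR; lia).
  eapply Rle_trans. apply inv_pow_abs_bound. nra.
  { rewrite S_INR. apply Rle_trans with (2 * PI * 1). lra. apply Rmult_le_compat_l; lra. }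
  lia. rewrite !S_INR.
  replace (2 * ((INR m + 1) * y) * (2 * PI * (INR n + 1))) with (4 * PI * y * (INR m + 1) * (INR n + 1)) by ring.
  assert (h4 : 0 < 4 * PI * y) by (apply Rmult_lt_0_compat; lra).
  rewrite <- (Rpower_mult_distr _ (INR n + 1)), <- (Rpower_mult_distr (4 * PI * y));
    try lra. apply Rmult_lt_0_compat; lra.
Qed.

(** One double series over (m, n) is summed in two ways: by rows it is the Lambert series, through
    the Lipschitz formula at 0; by columns it is the odd part of that formula at th. *)
Theorem lambert_modular (q : nat) (th y sg : R) : 0 < y -> 0 < th < 1 -> (1 <= q)%nat ->
  is_series (fun n => sin (2 * PI * INR (S n) * th) / INR (S n) ^ S (2 * q)) sg ->
  exists Gs Ph,
    is_series (fun r => lerch (2 * q) (4 * PI ^ 2 * INR (S r) / y) th - lerch (2 * q) (4 * PI ^ 2 * INR (S r) / y) (1 - th)) Gs /\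
    is_series (fun n => divsum (2 * q) th (n + 1) * exp (- INR (n + 1) * y)) Ph /\
    y ^ S (2 * q) * Ph / 2 = INR (fact (2 * q)) * sg / 2 + (-1) ^ q * (2 * PI) ^ S (2 * q) / 4 * Gs.
Proof.
  intros hy hth hq Hsg. pose proof PI_RGT_0 as hpi.
  set (k := (2 * q)%nat) in *. set (p := S k) in *. set (Fk := INR (fact k)).
  assert (hF : 0 < Fk) by (apply lt_0_INR, Factorial.lt_O_fact).
  set (a := fun m n => sin (2 * PI * INR (S m) * th) * Re (/ freq (INR (S m) * y) (S n) ^ p)).
  set (u := fun m => Rpower (4 * PI * y) (- (3 / 2)) * Rpower (INR m + 1) (- (3 / 2))).
  set (v := fun n => Rpower (INR n + 1) (- (3 / 2))).
  assert (Hv : ex_series v) by (apply ex_series_Rpower; lra).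
  assert (Hu : ex_series u) by (apply (ex_series_scal_l (V := R_NormedModule) (Rpower (4 * PI * y) (- (3 / 2)))), Hv).
  assert (Hu0 : forall m, 0 <= u m) by (intros m; apply Rmult_le_pos; left; apply Rpower_pos).
  assert (Hre : forall m n, Rabs (Re (/ freq (INR (S m) * y) (S n) ^ p)) <= u m * v n).
  { intros m n. eapply Rle_trans. apply Re_le_Cmod. apply freq_inv_bound; assumption. }
  assert (Ha : forall m n, Rabs (a m n) <= u m * v n).
  { intros m n. unfold a. rewrite Rabs_mult. rewrite <- (Rmult_1_l (u m * v n)).
    apply Rmult_le_compat; try apply Rabs_pos. apply Rabs_le.
    pose proof (SIN_bound (2 * PI * INR (S m) * th)). lra. apply Hre. }
  assert (SW := series_swap a u v Ha Hu Hv Hu0).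
  set (Sd := Series (fun m => Series (a m))) in *.
  (* The zero frequency of the Lipschitz formula is singled out here; summed over m it becomes the
     constant term. *)
  assert (Row : forall m, sin (2 * PI * INR (S m) * th) * lerch k (INR (S m) * y) 0 =
    Fk / y ^ p * (sin (2 * PI * INR (S m) * th) / INR (S m) ^ p) + 2 * Fk * Series (a m)).
  { intros m. assert (hm : 0 < INR (S m)) by (apply lt_0_INR; lia).
    assert (Er : ex_series (fun n => Re (/ freq (INR (S m) * y) (S n) ^ p))).
    { apply (ex_series_le_R _ (fun n => u m * v n)). intros n; apply Hre.
      apply (ex_series_scal_l (V := R_NormedModule) (u m)), Hv. }
    rewrite (lipschitz k (INR (S m) * y) 0 (Series (fun n => Re (/ freq (INR (S m) * y) (S n) ^ p)))).
    - unfold a. rewrite Series_scal_l. fold p Fk. rewrite Rpow_mult_distr. field.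
      split; apply pow_nonzero; lra.
    - nra.
    - unfold k; lia.
    - lra.
    - apply (is_series_ext_R (fun n => Re (/ freq (INR (S m) * y) (S n) ^ p))). 2: apply Series_correct, Er.
      intros n. rewrite Rmult_0_r. change (0, 0) with (RtoC 0). rewrite cexp_0. f_equal. unfold Cdiv, p. ring. }
  assert (HP : is_series (fun m => sin (2 * PI * INR (S m) * th) * lerch k (INR (S m) * y) 0) (Fk / y ^ p * sg + 2 * Fk * Sd)).
  { apply (is_series_ext_R _ _ _ (fun m => eq_sym (Row m))). apply is_series_plus_R; apply is_series_scal_R.
    exact Hsg. apply Series_correct. apply (swap_ex_sum a u v Ha Hu Hv). }
  set (K := (-1) ^ q * y ^ p / (2 * PI) ^ p).
  exists (4 * Fk * K * Sd), (Fk / y ^ p * sg + 2 * Fk * Sd). split; [|split].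
  - apply (is_series_ext_R (fun n => 4 * Fk * K * Series (fun m => a m n))). 2: apply is_series_scal_R, SW.
    intros n. set (c := 4 * PI ^ 2 * INR (S n) / y).
    assert (hc : 0 < c).
    { apply Rdiv_lt_0_compat; [|exact hy]. apply Rmult_lt_0_compat. nra. apply lt_0_INR; lia. }
    assert (Ew : forall x, ex_series (fun m => Re (cexp (0, 2 * PI * INR (S m) * x) / freq c (S m) ^ p))).
    { intros x. apply (ex_series_le_R _ (fun m => Rpower (2 * c * (2 * PI)) (- (3 / 2)) * Rpower (INR m + 1) (- (3 / 2)))).
      - intros m. eapply Rle_trans. apply Re_le_Cmod. unfold Cdiv. rewrite Cmod_mult, Cmod_cexp. simpl (Re (0, _)).
        rewrite exp_0, Rmult_1_l. pose proof (pos_INR m). pose proof PI2_3_2.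
        eapply Rle_trans. apply inv_pow_abs_bound. exact hc.
        { rewrite S_INR. apply Rle_trans with (2 * PI * 1). lra. apply Rmult_le_compat_l; lra. }
        unfold p, k; lia.
        rewrite S_INR. rewrite Rpower_mult_distr by nra. right. f_equal. ring.
      - apply (ex_series_scal_l (V := R_NormedModule) (Rpower (2 * c * (2 * PI)) (- (3 / 2)))). exact Hv. }
    rewrite (lipschitz k c th _ hc ltac:(unfold k; lia) ltac:(lra) (Series_correct _ (Ew th))).
    rewrite (lipschitz k c (1 - th) _ hc ltac:(unfold k; lia) ltac:(lra) (Series_correct _ (Ew (1 - th)))).
    fold Fk p.
    assert (E : Series (fun m => Re (cexp (0, 2 * PI * INR (S m) * th) / freq c (S m) ^ p)) -
            Series (fun m => Re (cexp (0, 2 * PI * INR (S m) * (1 - th)) / freq c (S m) ^ p)) =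
            2 * K * Series (fun m => a m n)).
    { rewrite <- Series_minus by apply Ew. rewrite <- Series_scal_l. apply Series_ext. intros m.
      apply (freq_odd_part q m n th y hy). }
    replace (4 * Fk * K * Series (fun m => a m n)) with (2 * Fk * (2 * K * Series (fun m => a m n))) by ring.
    rewrite <- E. ring.
  - rewrite <- (is_series_unique _ _ HP). apply lambert_regroup. exact hy. unfold k; lia.
  - assert (hs : (-1) ^ q * (-1) ^ q = 1).
    { rewrite <- Rpow_mult_distr. replace (-1 * -1) with 1 by ring. apply pow1. }
    assert (hyp : y ^ p <> 0) by (apply pow_nonzero; lra).
    assert (hpp : (2 * PI) ^ p <> 0) by (apply pow_nonzero; lra).
    unfold K.
    replace ((-1) ^ q * (2 * PI) ^ p / 4 * (4 * Fk * ((-1) ^ q * y ^ p / (2 * PI) ^ p) * Sd))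
      with (((-1) ^ q * (-1) ^ q) * Fk * y ^ p * Sd) by (field; exact hpp).
    rewrite hs. field. exact hyp.
Qed.

(** * Improper integrals, Gamma and Bessel functions *)

Definition cont_pos (f : R -> R) : Prop := forall t, 0 < t -> continuous f t.

Lemma cont_pos_ex (f : R -> R) (a b : R) : cont_pos f -> 0 < a -> a <= b -> is_RInt f a b (RInt f a b).
Proof. intros H ha hab. apply continuous_on_is_RInt. exact hab. intros t ht. apply H. lra. Qed.

Lemma cont_pos_Chasles (f : R -> R) (a b c : R) : cont_pos f -> 0 < a -> a <= b -> b <= c ->
  RInt f a c = RInt f a b + RInt f b c.
Proof.
  intros H ha hab hbc. apply is_RInt_unique_R. apply (is_RInt_Chasles_R f a b c); apply cont_pos_ex; auto; lra.
Qed.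

(** Both endpoints move independently, as for [RInt_gen]. The requirement A < B guarantees a < b for
    the intervals considered. *)
Definition improper_lim (f : R -> R) (l : R) : Prop :=
  forall eps, 0 < eps -> exists A B, 0 < A /\ A < B /\
    forall a b, 0 < a -> a < A -> B < b -> Rabs (RInt f a b - l) < eps.

Lemma improper_lim_unique (f : R -> R) (l m : R) : improper_lim f l -> improper_lim f m -> l = m.
Proof.
  intros H1 H2. apply Rminus_diag_uniq, cond_eq. intros eps he. rewrite Rminus_0_r.
  destruct (H1 (eps / 2)) as (A1 & B1 & h1 & h1' & K1). lra.
  destruct (H2 (eps / 2)) as (A2 & B2 & h2 & h2' & K2). lra.
  set (a := Rmin A1 A2 / 2). set (b := Rmax B1 B2 + 1).
  pose proof (Rmin_l A1 A2). pose proof (Rmin_r A1 A2). pose proof (Rmax_l B1 B2). pose proof (Rmax_r B1 B2).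
  assert (0 < Rmin A1 A2) by (apply Rmin_pos; assumption).
  specialize (K1 a b ltac:(unfold a; lra) ltac:(unfold a; lra) ltac:(unfold b; lra)).
  specialize (K2 a b ltac:(unfold a; lra) ltac:(unfold a; lra) ltac:(unfold b; lra)).
  apply Rabs_def2 in K1. apply Rabs_def2 in K2. apply Rabs_def1; lra.
Qed.

Lemma improper_lim_is_RInt_gen (f : R -> R) (l : R) : cont_pos f -> improper_lim f l ->
  is_RInt_gen f (at_right 0) (Rbar_locally p_infty) l.
Proof.
  intros Hc H P [eps HP]. destruct (H eps (cond_pos eps)) as (A & B & hA & hAB & K).
  apply (Filter_prod _ _ _ (fun a => 0 < a < A) (fun b => B < b)).
  - exists (mkposreal A hA). intros a ha h0. split. exact h0.
    unfold ball in ha; simpl in ha; unfold AbsRing_ball, abs, minus, plus, opp in ha; simpl in ha.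
    apply Rabs_def2 in ha. lra.
  - exists B. auto.
  - intros a b [h1 h2] h3. exists (RInt f a b). split. apply cont_pos_ex; auto; simpl; lra.
    apply HP. apply (K a b h1 h2 h3).
Qed.

Lemma improper_lim_ext (f g : R -> R) (l : R) : (forall t, 0 < t -> f t = g t) -> improper_lim f l -> improper_lim g l.
Proof.
  intros E H eps he. destruct (H eps he) as (A & B & hA & hAB & K). exists A, B. repeat split; auto.
  intros a b ha ha' hb. rewrite <- (RInt_ext (V := R_CompleteNormedModule) f g). apply K; auto.
  intros t. rewrite Rmin_left, Rmax_right by lra. intros ht. apply E. lra.
Qed.

Lemma improper_lim_scal (f : R -> R) (c l : R) : cont_pos f -> improper_lim f l -> improper_lim (fun t => c * f t) (c * l).
Proof.
  intros Hc H eps he. pose proof (Rabs_pos c).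
  destruct (H (eps / (Rabs c + 1))) as (A & B & hA & hAB & K). apply Rdiv_lt_0_compat; lra.
  exists A, B. repeat split; auto. intros a b ha ha' hb. specialize (K a b ha ha' hb).
  rewrite (is_RInt_unique_R _ _ _ _ (is_RInt_scal_R f a b c _ (cont_pos_ex f a b Hc ha ltac:(lra)))).
  rewrite <- Rmult_minus_distr_l, Rabs_mult.
  apply (Rmult_lt_compat_r (Rabs c + 1)) in K; [|lra].
  replace (eps / (Rabs c + 1) * (Rabs c + 1)) with eps in K by (field; lra).
  pose proof (Rabs_pos (RInt f a b - l)). nra.
Qed.

Lemma improper_lim_plus (f g : R -> R) (l m : R) : cont_pos f -> cont_pos g -> improper_lim f l -> improper_lim g m ->
  improper_lim (fun t => f t + g t) (l + m).
Proof.
  intros Cf Cg H1 H2 eps he.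
  destruct (H1 (eps / 2)) as (A1 & B1 & h1 & h1' & K1). lra.
  destruct (H2 (eps / 2)) as (A2 & B2 & h2 & h2' & K2). lra.
  pose proof (Rmin_l A1 A2). pose proof (Rmin_r A1 A2). pose proof (Rmax_l B1 B2). pose proof (Rmax_r B1 B2).
  exists (Rmin A1 A2), (Rmax B1 B2). split. apply Rmin_pos; assumption. split. lra.
  intros a b ha ha' hb. specialize (K1 a b ha ltac:(lra) ltac:(lra)). specialize (K2 a b ha ltac:(lra) ltac:(lra)).
  rewrite (is_RInt_unique_R _ _ _ _ (is_RInt_plus_R f g a b _ _ (cont_pos_ex f a b Cf ha ltac:(lra)) (cont_pos_ex g a b Cg ha ltac:(lra)))).
  apply Rabs_def2 in K1. apply Rabs_def2 in K2. apply Rabs_def1; lra.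
Qed.

Lemma improper_lim_dilate (f : R -> R) (c l : R) : cont_pos f -> 0 < c -> improper_lim f l -> improper_lim (fun t => c * f (c * t)) l.
Proof.
  intros Hc hc H eps he. destruct (H eps he) as (A & B & hA & hAB & K).
  exists (A / c), (B / c). split. apply Rdiv_lt_0_compat; lra. split.
  apply Rmult_lt_compat_r. apply Rinv_0_lt_compat, hc. exact hAB.
  intros a b ha ha' hb.
  assert (ca : c * a < A) by (apply (Rmult_lt_compat_l c) in ha'; [|lra]; replace (c * (A / c)) with A in ha' by (field; lra); lra).
  assert (cb : B < c * b) by (apply (Rmult_lt_compat_l c) in hb; [|lra]; replace (c * (B / c)) with B in hb by (field; lra); lra).
  assert (ca0 : 0 < c * a) by nra.
  assert (I := is_RInt_comp_lin (V := R_NormedModule) f c 0 a b (RInt f (c * a) (c * b))).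
  rewrite !Rplus_0_r in I. specialize (I (cont_pos_ex f (c * a) (c * b) Hc ca0 ltac:(lra))).
  rewrite (is_RInt_unique_R (fun t => c * f (c * t)) a b (RInt f (c * a) (c * b))).
  apply K; assumption.
  apply (is_RInt_eq_R (fun y => scal c (f (c * y + 0)))). intros t. rewrite Rplus_0_r. reflexivity. exact I.
Qed.

(** * Domination and termwise improper integration *)

Section Dominated.
Variables (G : R -> R) (IG : R).
Hypothesis HGc : cont_pos G.
Hypothesis HG0 : forall t, 0 < t -> 0 <= G t.
Hypothesis HGi : improper_lim G IG.

Lemma dom_nonneg (a b : R) : 0 < a -> a <= b -> 0 <= RInt G a b.
Proof.
  intros ha hab. apply RInt_ge_0. exact hab. exists (RInt G a b). apply cont_pos_ex; auto.
  intros t ht. apply HG0. lra.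
Qed.

Lemma dom_le (a b : R) : 0 < a -> a <= b -> RInt G a b <= IG.
Proof.
  intros ha hab. apply Rle_plus_epsilon. intros eps he.
  destruct (HGi eps he) as (A & B & hA & hAB & K).
  set (a' := Rmin a (A / 2)). set (b' := Rmax b (B + 1)).
  assert (ha' : 0 < a') by (apply Rmin_pos; lra).
  assert (h1 : a' <= a) by apply Rmin_l. assert (h2 : a' <= A / 2) by apply Rmin_r.
  assert (h3 : b <= b') by apply Rmax_l. assert (h4 : B + 1 <= b') by apply Rmax_r.
  specialize (K a' b' ha' ltac:(lra) ltac:(lra)). apply Rabs_def2 in K.
  assert (E : RInt G a' b' = RInt G a' a + RInt G a b + RInt G b b').
  { rewrite (cont_pos_Chasles G a' b b'), (cont_pos_Chasles G a' a b); auto; lra. }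
  pose proof (dom_nonneg a' a ha' h1). pose proof (dom_nonneg b b' ltac:(lra) h3).
  lra.
Qed.

Lemma dom_defect (eps : R) : 0 < eps -> exists A B, 0 < A /\ A < B /\
  forall a b, 0 < a -> a < A -> B < b -> IG - RInt G a b < eps.
Proof.
  intros he. destruct (HGi eps he) as (A & B & hA & hAB & K). exists A, B. repeat split; auto.
  intros a b ha ha' hb. specialize (K a b ha ha' hb). apply Rabs_def2 in K. lra.
Qed.

Lemma dom_diff (f : R -> R) (c a b a' b' : R) : cont_pos f -> (forall t, 0 < t -> Rabs (f t) <= c * G t) ->
  0 < a' -> a' <= a -> a <= b -> b <= b' ->
  Rabs (RInt f a' b' - RInt f a b) <= c * (RInt G a' b' - RInt G a b).
Proof.
  intros Hf Hd h1 h2 h3 h4.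
  rewrite (cont_pos_Chasles f a' b b'), (cont_pos_Chasles f a' a b) by (auto; lra).
  rewrite (cont_pos_Chasles G a' b b'), (cont_pos_Chasles G a' a b) by (auto; lra).
  assert (K : forall u v, 0 < u -> u <= v -> Rabs (RInt f u v) <= c * RInt G u v).
  { intros u v hu huv. apply (is_RInt_abs_le f (fun t => c * G t) u v _ _ huv). intros t ht. apply Hd. lra.
    apply cont_pos_ex; auto. apply is_RInt_scal_R. apply cont_pos_ex; auto. }
  pose proof (K a' a h1 h2). pose proof (K b b' ltac:(lra) h4).
  replace (RInt f a' a + RInt f a b + RInt f b b' - RInt f a b) with (RInt f a' a + RInt f b b') by ring.
  eapply Rle_trans. apply Rabs_triang. lra.
Qed.

Lemma improper_lim_of_defect (f : R -> R) (l c : R) : 0 <= c ->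
  (forall a b, 0 < a -> a <= b -> Rabs (RInt f a b - l) <= c * (IG - RInt G a b)) -> improper_lim f l.
Proof.
  intros hc H eps he. destruct (dom_defect (eps / (c + 1))) as (A & B & hA & hAB & K).
  apply Rdiv_lt_0_compat; lra.
  exists A, B. repeat split; auto. intros a b ha ha' hb.
  eapply Rle_lt_trans. apply H; lra. specialize (K a b ha ha' hb).
  apply (Rmult_lt_compat_r (c + 1)) in K; [|lra].
  replace (eps / (c + 1) * (c + 1)) with eps in K by (field; lra).
  pose proof (dom_le a b ha ltac:(lra)). nra.
Qed.

(** Besides the limit, the rate is kept: the error on [a, b] is c times the mass of [G] outside
    [a, b]. It is this rate that [improper_exchange] sums over n. *)
Lemma improper_lim_dominated (f : R -> R) (c : R) : 0 <= c -> cont_pos f -> (forall t, 0 < t -> Rabs (f t) <= c * G t) ->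
  exists l, improper_lim f l /\ forall a b, 0 < a -> a <= b -> Rabs (RInt f a b - l) <= c * (IG - RInt G a b).
Proof.
  intros hc Hf Hd.
  set (al := fun n => / (INR n + 1)). set (be := fun n => INR n + 1).
  assert (al0 : forall n, 0 < al n) by (intros n; apply Rinv_0_lt_compat; pose proof (pos_INR n); lra).
  assert (alm : forall n m, (n <= m)%nat -> al m <= al n).
  { intros n m hnm. apply le_INR in hnm. pose proof (pos_INR n). apply Rinv_le_contravar; lra. }
  assert (bem : forall n m, (n <= m)%nat -> be n <= be m) by (intros n m hnm; apply le_INR in hnm; unfold be; lra).
  assert (ab : forall n, al n <= be n).
  { intros n. pose proof (pos_INR n). unfold al, be. apply Rle_trans with 1; [|lra].
    rewrite <- Rinv_1. apply Rinv_le_contravar; lra. }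
  assert (small : forall A, 0 < A -> exists N, forall n, (N <= n)%nat -> al n < A).
  { intros A hA. destruct (nfloor_ex (/ A)) as [N [_ HN]]. left; apply Rinv_0_lt_compat, hA.
    exists N. intros n hn. apply le_INR in hn. unfold al. rewrite <- (Rinv_inv A).
    apply Rinv_lt_contravar. apply Rmult_lt_0_compat. apply Rinv_0_lt_compat, hA. pose proof (pos_INR n); lra. lra. }
  assert (large : forall B, exists N, forall n, (N <= n)%nat -> B < be n).
  { intros B. destruct (nfloor_ex (Rabs B)) as [N [_ HN]]. apply Rabs_pos.
    exists N. intros n hn. apply le_INR in hn. unfold be. pose proof (Rle_abs B). lra. }
  assert (CH : ex_finite_lim_seq (fun n => RInt f (al n) (be n))).
  { apply ex_lim_seq_cauchy_corr. intros eps.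
    destruct (dom_defect (eps / (c + 1))) as (A & B & hA & hAB & K). apply Rdiv_lt_0_compat; [apply cond_pos|lra].
    destruct (small A hA) as [N1 HN1]. destruct (large B) as [N2 HN2].
    assert (Q : forall n m, (N1 <= n)%nat -> (N2 <= n)%nat -> (n <= m)%nat -> Rabs (RInt f (al m) (be m) - RInt f (al n) (be n)) < eps).
    { intros n m h1 h2 hnm. eapply Rle_lt_trans. apply (dom_diff f c); auto.
      specialize (K (al n) (be n) (al0 n) (HN1 n h1) (HN2 n h2)).
      pose proof (dom_le (al m) (be m) (al0 m) (ab m)).
      apply (Rmult_lt_compat_r (c + 1)) in K; [|lra].
      replace (eps / (c + 1) * (c + 1)) with (pos eps) in K by (field; lra).
      pose proof (dom_le (al n) (be n) (al0 n) (ab n)). nra. }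
    exists (max N1 N2). intros n m hn hm. destruct (Nat.le_ge_cases n m).
    - rewrite Rabs_minus_sym. apply Q; lia.
    - apply Q; lia. }
  destruct CH as [l Hl]. exists l.
  assert (Bd : forall a b, 0 < a -> a <= b -> Rabs (RInt f a b - l) <= c * (IG - RInt G a b)).
  { intros a b ha hab. apply Rle_plus_epsilon. intros eps he.
    apply is_lim_seq_spec in Hl. destruct (Hl (mkposreal eps he)) as [N0 HN0]. simpl in HN0.
    destruct (small a ha) as [N1 HN1]. destruct (large b) as [N2 HN2].
    set (n := max N0 (max N1 N2)). specialize (HN0 n ltac:(lia)). specialize (HN1 n ltac:(lia)). specialize (HN2 n ltac:(lia)).
    pose proof (dom_diff f c a b (al n) (be n) Hf Hd (al0 n) ltac:(lra) hab ltac:(lra)) as E.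
    pose proof (dom_le (al n) (be n) (al0 n) (ab n)).
    assert (c * (RInt G (al n) (be n) - RInt G a b) <= c * (IG - RInt G a b)) by (apply Rmult_le_compat_l; lra).
    replace (RInt f a b - l) with (- (RInt f (al n) (be n) - RInt f a b) + (RInt f (al n) (be n) - l)) by ring.
    eapply Rle_trans. apply Rabs_triang. rewrite Rabs_Ropp. lra. }
  split. apply (improper_lim_of_defect f l c); auto. exact Bd.
Qed.

Lemma dom_bounded_loc (t0 : R) : 0 < t0 -> exists K, 0 <= K /\ forall t, Rabs (t - t0) < t0 / 2 -> G t <= K.
Proof.
  intros ht. destruct (continuous_bounded G (t0 / 2) (2 * t0)) as (K & hK & HK). lra.
  intros t h; apply HGc; lra. exists K. split. exact hK. intros t h. apply Rabs_def2 in h.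
  eapply Rle_trans. apply Rle_abs. apply HK. lra.
Qed.

Section Exchange.
Variables (f : nat -> R -> R) (c : nat -> R).
Hypothesis Hf : forall n, cont_pos (f n).
Hypothesis Hd : forall n t, 0 < t -> Rabs (f n t) <= c n * G t.
Hypothesis Hc : ex_series c.
Hypothesis Hc0 : forall n, 0 <= c n.

Lemma improper_exchange_cont : cont_pos (fun t => Series (fun n => f n t)).
Proof.
  intros t0 ht. destruct (dom_bounded_loc t0 ht) as (K & hK & HK).
  apply (series_continuous f (fun n => c n * K) t0 (t0 / 2)). lra.
  - intros n. apply Hf, ht.
  - intros n t h. eapply Rle_trans. apply Hd. apply Rabs_def2 in h; lra.
    apply Rmult_le_compat_l. apply Hc0. apply HK, h.
  - apply ex_series_scal_r, Hc.
Qed.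

(** The truncation error of the n-th integral is [c n] times a defect that does not depend on n, so
    the errors add up to [Series c] times that defect. *)
Lemma improper_exchange (l : nat -> R) : (forall n, improper_lim (f n) (l n)) ->
  ex_series l /\ improper_lim (fun t => Series (fun n => f n t)) (Series l).
Proof.
  intros Hl.
  assert (B : forall n a b, 0 < a -> a <= b -> Rabs (RInt (f n) a b - l n) <= c n * (IG - RInt G a b)).
  { intros n. destruct (improper_lim_dominated (f n) (c n) (Hc0 n) (Hf n) (Hd n)) as (l' & H1 & H2).
    rewrite (improper_lim_unique _ _ _ (Hl n) H1). exact H2. }
  assert (El : ex_series l).
  { apply (ex_series_le_R _ (fun n => c n * IG)). 2: apply ex_series_scal_r, Hc.
    (* On the degenerate interval [1, 1] the rate reads |l n| <= c n IG, whence summability. *)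
    intros n. specialize (B n 1 1 Rlt_0_1 (Rle_refl 1)). rewrite !RInt_point in B.
    change (Rabs (0 - l n) <= c n * (IG - 0)) in B. rewrite Rminus_0_r, Rminus_0_l, Rabs_Ropp in B. exact B. }
  split. exact El.
  apply (improper_lim_of_defect _ _ (Series c)).
  { eapply Rle_trans; [|apply (sum_n_le_Series c O Hc0 Hc)]. rewrite sum_O. apply Hc0. }
  intros a b ha hab.
  destruct (continuous_bounded G a b hab) as (K & hK & HK). intros t ht; apply HGc; lra.
  assert (SI := series_RInt f (fun n => c n * K) a b hab
    (fun n t ht => Hf n t ltac:(lra))
    ltac:(exists (RInt (fun t => Series (fun n => f n t)) a b); apply cont_pos_ex; [exact improper_exchange_cont|exact ha|exact hab])
    ltac:(intros n t ht; eapply Rle_trans; [apply Hd; lra|]; apply Rmult_le_compat_l; [apply Hc0|]; eapply Rle_trans; [apply Rle_abs|apply HK; exact ht])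
    ltac:(apply ex_series_scal_r, Hc)).
  rewrite <- (is_series_unique _ _ (is_series_minus_R _ _ _ _ SI (Series_correct _ El))).
  rewrite <- Series_scal_r. apply Series_abs_le. intros n. apply B; assumption.
  apply ex_series_scal_r, Hc.
Qed.
End Exchange.
End Dominated.

(** * Complex improper integrals and a concrete dominating function *)

Definition Ccont (f : R -> C) : Prop := forall t, 0 < t -> cont_at f t.

Definition impC (f : R -> C) (l : C) : Prop := improper_lim (fun t => Re (f t)) (Re l) /\ improper_lim (fun t => Im (f t)) (Im l).

Lemma impC_unique (f : R -> C) (l m : C) : impC f l -> impC f m -> l = m.
Proof. intros [H1 H2] [H3 H4]. apply C_ext; eapply improper_lim_unique; eassumption. Qed.

Lemma impC_ext (f g : R -> C) (l : C) : (forall t, 0 < t -> f t = g t) -> impC f l -> impC g l.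
Proof.
  intros E [H1 H2]. split; [apply (improper_lim_ext (fun t => Re (f t)))|apply (improper_lim_ext (fun t => Im (f t)))]; auto;
  intros t ht; rewrite E; auto.
Qed.

Lemma impC_scal (c : C) (f : R -> C) (l : C) : Ccont f -> impC f l -> impC (fun t => c * f t)%C (c * l)%C.
Proof.
  intros Hf [H1 H2].
  assert (cR : cont_pos (fun t => Re (f t))) by (intros t ht; exact (proj1 (Hf t ht))).
  assert (cI : cont_pos (fun t => Im (f t))) by (intros t ht; exact (proj2 (Hf t ht))).
  assert (K : forall (u v : R) g h lg lh, cont_pos g -> cont_pos h -> improper_lim g lg -> improper_lim h lh ->
    improper_lim (fun t => u * g t + v * h t) (u * lg + v * lh)).
  { intros u v g h lg lh cg ch Hg Hh. apply (improper_lim_plus (fun t => u * g t) (fun t => v * h t)).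
    intros t ht. apply continuous_mult_R. apply continuous_const. auto.
    intros t ht. apply continuous_mult_R. apply continuous_const. auto.
    apply improper_lim_scal; auto. apply improper_lim_scal; auto. }
  split.
  - apply (improper_lim_ext (fun t => Re c * Re (f t) + (- Im c) * Im (f t))). intros t _. rewrite re_mult. ring.
    replace (Re (c * l)) with (Re c * Re l + (- Im c) * Im l) by (rewrite re_mult; ring). apply K; auto.
  - apply (improper_lim_ext (fun t => Re c * Im (f t) + Im c * Re (f t))). intros t _. rewrite im_mult. ring.
    replace (Im (c * l)) with (Re c * Im l + Im c * Re l) by (rewrite im_mult; ring). apply K; auto.
Qed.

Lemma impC_plus (f g : R -> C) (l m : C) : Ccont f -> Ccont g -> impC f l -> impC g m ->
  impC (fun t => f t + g t)%C (l + m)%C.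
Proof.
  intros Hf Hg [H1 H2] [H3 H4]. split.
  - exact (improper_lim_plus _ _ _ _ (fun t ht => proj1 (Hf t ht)) (fun t ht => proj1 (Hg t ht)) H1 H3).
  - exact (improper_lim_plus _ _ _ _ (fun t ht => proj2 (Hf t ht)) (fun t ht => proj2 (Hg t ht)) H2 H4).
Qed.

(* A dominating function with the explicit bounded antiderivative - 1 / (p (1 + t^p)). *)
Definition dominator (p t : R) : R := Rpower t (p - 1) / (1 + Rpower t p) ^ 2.

Lemma one_plus_Rpower_pos (t p : R) : 0 < 1 + Rpower t p.
Proof. pose proof (Rpower_pos t p). lra. Qed.

Lemma dominator_cont (p : R) : cont_pos (dominator p).
Proof.
  intros t ht. unfold dominator, Rpower. apply ex_derive_continuous_R. auto_derive.
  pose proof (one_plus_Rpower_pos t p) as H. unfold Rpower in H.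
  repeat split; auto; nra.
Qed.

Lemma dominator_nonneg (p t : R) : 0 < t -> 0 <= dominator p t.
Proof.
  intros _. unfold dominator. apply Rdiv_le_0_compat. left; apply Rpower_pos.
  apply pow_lt, one_plus_Rpower_pos.
Qed.

Lemma dominator_impr (p : R) : 0 < p -> improper_lim (dominator p) (/ p).
Proof.
  intros hp. set (F := fun t => - (/ (p * (1 + Rpower t p)))).
  assert (I : forall a b, 0 < a -> a <= b -> RInt (dominator p) a b = F b - F a).
  { intros a b ha hab. apply is_RInt_unique_R. apply (is_RInt_derive_R F); auto.
    - intros t ht. unfold F, dominator, Rpower. auto_derive.
      + pose proof (one_plus_Rpower_pos t p) as H. unfold Rpower in H. split. lra. split; [apply Rgt_not_eq; nra|auto].
      + replace ((p - 1) * ln t) with (p * ln t + - ln t) by ring. rewrite exp_plus, exp_Ropp, exp_ln by lra.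
        pose proof (exp_pos (p * ln t)). field. repeat split; lra.
    - intros t ht. apply dominator_cont. lra. }
  intros eps he.
  (* A and B are where the end contributions t^p / p near 0 and 1 / (p t^p) near infinity fall to
     eps / 2. *)
  set (X := / (eps * p)). assert (hX : 0 < X) by (apply Rinv_0_lt_compat; nra).
  set (A := Rmin 1 (Rpower (eps * p / 2) (/ p))).
  set (B := Rmax 2 (Rpower (2 * X) (/ p))).
  assert (hA0 : 0 < A) by (apply Rmin_pos; [lra|apply Rpower_pos]).
  assert (hA1 : A <= 1) by apply Rmin_l. assert (hA2 : A <= Rpower (eps * p / 2) (/ p)) by apply Rmin_r.
  assert (hB1 : 2 <= B) by apply Rmax_l. assert (hB2 : Rpower (2 * X) (/ p) <= B) by apply Rmax_r.
  exists A, B. split. exact hA0. split. lra. intros a b ha haA hbB.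
  assert (P1 : Rpower a p < eps * p / 2).
  { rewrite <- (Rpower_1 (eps * p / 2)) by nra. replace 1 with (/ p * p) by (field; lra).
    rewrite <- Rpower_mult. apply Rlt_Rpower_l. exact hp. lra. }
  assert (P2 : 2 * X < Rpower b p).
  { rewrite <- (Rpower_1 (2 * X)) by lra. replace 1 with (/ p * p) by (field; lra).
    rewrite <- Rpower_mult. apply Rlt_Rpower_l. exact hp. split. apply Rpower_pos. lra. }
  rewrite I by lra. unfold F. pose proof (Rpower_pos a p). pose proof (Rpower_pos b p).
  set (xa := Rpower a p) in *. set (xb := Rpower b p) in *.
  replace (- / (p * (1 + xb)) - - / (p * (1 + xa)) - / p) with (- (/ (p * (1 + xb)) + xa / (p * (1 + xa)))) by (field; lra).
  assert (E1 : 0 < / (p * (1 + xb)) < eps / 2).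
  { split. apply Rinv_0_lt_compat; nra.
    replace (eps / 2) with (/ (p * (2 * X))) by (unfold X; field; lra).
    apply Rinv_lt_contravar. apply Rmult_lt_0_compat; nra. nra. }
  assert (E2 : 0 < xa / (p * (1 + xa)) < eps / 2).
  { split. apply Rdiv_lt_0_compat; nra. apply Rmult_lt_reg_r with (p * (1 + xa)). nra.
    unfold Rdiv at 1. rewrite Rmult_assoc, Rinv_l, Rmult_1_r by nra. nra. }
  rewrite Rabs_Ropp, Rabs_pos_eq by lra. lra.
Qed.

(** The coefficients 1, 2, 1 come from expanding (1 + t^p)^2, the denominator of [dominator]; exp (-
    t) absorbs each resulting power of t. *)
Definition dom_const (p q : R) : R := exp_decay_const q + 2 * exp_decay_const (q + p) + exp_decay_const (q + 2 * p).

Lemma gamma_dominated (p q t : R) : 0 < p -> 0 <= q -> 0 < t ->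
  Rpower t (p - 1 + q) * exp (- t) <= dom_const p q * dominator p t.
Proof.
  intros hp hq ht. unfold dom_const, dominator.
  pose proof (one_plus_Rpower_pos t p). set (D := (1 + Rpower t p) ^ 2).
  assert (hD : 0 < D) by (apply pow_lt; assumption).
  apply Rmult_le_reg_r with D. exact hD.
  replace ((exp_decay_const q + 2 * exp_decay_const (q + p) + exp_decay_const (q + 2 * p)) * (Rpower t (p - 1) / D) * D)
    with (Rpower t (p - 1) * (exp_decay_const q + 2 * exp_decay_const (q + p) + exp_decay_const (q + 2 * p))) by (field; lra).
  rewrite Rpower_plus, !Rmult_assoc. apply Rmult_le_compat_l. left; apply Rpower_pos.
  pose proof (Rpower_exp_bound q t hq ht). pose proof (Rpower_exp_bound (q + p) t ltac:(lra) ht).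
  pose proof (Rpower_exp_bound (q + 2 * p) t ltac:(lra) ht).
  rewrite Rpower_plus in H1. replace (2 * p) with (p + p) in H2 at 1 by ring. rewrite !Rpower_plus in H2.
  unfold D. replace (Rpower t q * (exp (- t) * (1 + Rpower t p) ^ 2)) with
    (Rpower t q * exp (- t) + 2 * (Rpower t q * Rpower t p * exp (- t)) + Rpower t q * (Rpower t p * Rpower t p) * exp (- t)) by ring.
  lra.
Qed.

Lemma dom_const_pos (p q : R) : 0 < dom_const p q.
Proof.
  unfold dom_const. assert (forall x, 0 < exp_decay_const x) by (intros; apply exp_pos).
  pose proof (H q). pose proof (H (q + p)). pose proof (H (q + 2 * p)). lra.
Qed.

Lemma impC_dominated (p : R) (f : R -> C) (c : R) : 0 < p -> 0 <= c -> Ccont f ->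
  (forall t, 0 < t -> Cmod (f t) <= c * dominator p t) -> exists l, impC f l.
Proof.
  intros hp hc Hf Hd.
  destruct (improper_lim_dominated (dominator p) (/ p) (dominator_cont p) (dominator_nonneg p) (dominator_impr p hp) (fun t => Re (f t)) c hc) as (l1 & H1 & _).
  intros t ht; exact (proj1 (Hf t ht)). intros t ht. eapply Rle_trans. apply Re_le_Cmod. auto.
  destruct (improper_lim_dominated (dominator p) (/ p) (dominator_cont p) (dominator_nonneg p) (dominator_impr p hp) (fun t => Im (f t)) c hc) as (l2 & H2 & _).
  intros t ht; exact (proj2 (Hf t ht)). intros t ht. eapply Rle_trans. apply Im_le_Cmod. auto.
  exists (l1, l2). split; assumption.
Qed.

Lemma improper_exchangeC (p : R) (f : nat -> R -> C) (c : nat -> R) (l : nat -> C) : 0 < p ->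
  (forall n, Ccont (f n)) -> (forall n t, 0 < t -> Cmod (f n t) <= c n * dominator p t) ->
  ex_series c -> (forall n, 0 <= c n) -> (forall n, impC (f n) (l n)) ->
  is_seriesC l (CSeries l) /\ impC (fun t => CSeries (fun n => f n t)) (CSeries l) /\ Ccont (fun t => CSeries (fun n => f n t)).
Proof.
  intros hp Hf Hd Hc Hc0 Hl.
  assert (cR : forall n, cont_pos (fun t => Re (f n t))) by (intros n t ht; exact (proj1 (Hf n t ht))).
  assert (cI : forall n, cont_pos (fun t => Im (f n t))) by (intros n t ht; exact (proj2 (Hf n t ht))).
  assert (dR : forall n t, 0 < t -> Rabs (Re (f n t)) <= c n * dominator p t).
  { intros n t ht. eapply Rle_trans. apply Re_le_Cmod. auto. }
  assert (dI : forall n t, 0 < t -> Rabs (Im (f n t)) <= c n * dominator p t).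
  { intros n t ht. eapply Rle_trans. apply Im_le_Cmod. auto. }
  destruct (improper_exchange (dominator p) (/ p) (dominator_cont p) (dominator_nonneg p) (dominator_impr p hp)
    (fun n t => Re (f n t)) c cR dR Hc Hc0 (fun n => Re (l n)) (fun n => proj1 (Hl n))) as [E1 I1].
  destruct (improper_exchange (dominator p) (/ p) (dominator_cont p) (dominator_nonneg p) (dominator_impr p hp)
    (fun n t => Im (f n t)) c cI dI Hc Hc0 (fun n => Im (l n)) (fun n => proj2 (Hl n))) as [E2 I2].
  split; [|split].
  - apply is_series_C. split; apply Series_correct; assumption.
  - split; assumption.
  - intros t ht. split.
    + apply (improper_exchange_cont (dominator p) (dominator_cont p) (fun n t => Re (f n t)) c cR dR Hc Hc0 t ht).
    + apply (improper_exchange_cont (dominator p) (dominator_cont p) (fun n t => Im (f n t)) c cI dI Hc Hc0 t ht).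
Qed.

Lemma impC_CInt (f : R -> C) (l : C) : Ccont f -> impC f l -> CInt_0_oo (at_right 0) f = l.
Proof.
  intros Hf [H1 H2]. apply C_ext; apply (is_RInt_gen_unique (V := R_CompleteNormedModule)); apply improper_lim_is_RInt_gen; auto;
  intros t ht; [exact (proj1 (Hf t ht))|exact (proj2 (Hf t ht))].
Qed.

(** * The Gamma integral *)

Lemma gamma_integrand_cont (s : C) (b : R) : Ccont (fun t => cpow t (s - 1) * RtoC (exp (- (b * t))))%C.
Proof.
  intros t ht. apply cont_at_mult. apply cont_at_cpow, ht. apply cont_at_RtoC.
  apply ex_derive_continuous_R. auto_derive. auto.
Qed.

Lemma Gamma_correct (s : C) : 0 < Re s -> impC (fun t => cpow t (s - 1) * RtoC (exp (- t)))%C (Gamma s).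
Proof.
  intros hs.
  assert (Hc : Ccont (fun t => cpow t (s - 1) * RtoC (exp (- t)))%C).
  { intros t ht. apply (cont_at_ext (fun t => cpow t (s - 1) * RtoC (exp (- (1 * t))))%C).
    intros u; rewrite Rmult_1_l; reflexivity. apply gamma_integrand_cont, ht. }
  destruct (impC_dominated (Re s) (fun t => cpow t (s - 1) * RtoC (exp (- t)))%C (dom_const (Re s) 0) hs) as [l Hl].
  - left; apply dom_const_pos.
  - exact Hc.
  - intros t ht. rewrite Cmod_mult, Cmod_cpow, Cmod_R, Rabs_pos_eq by (left; apply exp_pos).
    pose proof (gamma_dominated (Re s) 0 t hs (Rle_refl 0) ht) as E.
    replace (Re (s - 1)) with (Re s - 1 + 0). exact E. simpl. unfold Re. ring.
  - unfold Gamma. rewrite (impC_CInt _ l Hc Hl). exact Hl.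
Qed.

Lemma cpow_nz (u : R) (s : C) : cpow u s <> RtoC 0.
Proof. apply cexp_nz. Qed.

Lemma cpow_mult_base (u v : R) (s : C) : 0 < u -> 0 < v -> cpow (u * v) s = (cpow u s * cpow v s)%C.
Proof. intros hu hv. unfold cpow. rewrite ln_mult, <- cexp_plus, RtoC_plus by assumption. f_equal. ring. Qed.

Lemma cpow_1 (u : R) : 0 < u -> cpow u 1 = RtoC u.
Proof. intros hu. change (RtoC 1) with (RtoC (INR 1)). rewrite cpow_INR by exact hu. f_equal. ring. Qed.

Lemma Gamma_scaled (s : C) (b : R) : 0 < Re s -> 0 < b ->
  impC (fun t => cpow t (s - 1) * RtoC (exp (- (b * t))))%C (Gamma s / cpow b s)%C.
Proof.
  intros hs hb.
  assert (G0 := Gamma_correct s hs).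
  set (phi := fun t => (cpow t (s - 1) * RtoC (exp (- t)))%C) in *.
  assert (Hc : Ccont phi).
  { intros t ht. apply (cont_at_ext (fun t => cpow t (s - 1) * RtoC (exp (- (1 * t))))%C).
    intros u; rewrite Rmult_1_l; reflexivity. apply gamma_integrand_cont, ht. }
  assert (G1 : impC (fun t => RtoC b * phi (b * t)%R)%C (Gamma s)).
  { destruct G0 as [H1 H2]. split.
    - apply (improper_lim_ext (fun t => b * Re (phi (b * t)))). intros t _. rewrite re_scal_l. reflexivity.
      apply (improper_lim_dilate (fun t => Re (phi t)) b (Re (Gamma s))); [intros t ht; exact (proj1 (Hc t ht))|exact hb|exact H1].
    - apply (improper_lim_ext (fun t => b * Im (phi (b * t)))). intros t _. rewrite im_scal_l. reflexivity.
      apply (improper_lim_dilate (fun t => Im (phi t)) b (Im (Gamma s))); [intros t ht; exact (proj2 (Hc t ht))|exact hb|exact H2]. }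
  assert (E : forall t, 0 < t -> (RtoC b * phi (b * t)%R)%C = (cpow b s * (cpow t (s - 1) * RtoC (exp (- (b * t)))))%C).
  { intros t ht. unfold phi. rewrite cpow_mult_base by assumption.
    replace (cpow b s) with (cpow b 1 * cpow b (s - 1))%C by (rewrite <- cpow_plus; f_equal; ring).
    rewrite cpow_1 by exact hb. ring. }
  assert (G2 := impC_ext _ _ _ E G1).
  assert (G3 := impC_scal (/ cpow b s) _ _ ltac:(intros t ht; apply (cont_at_mult (fun _ => cpow b s)); [apply cont_at_const|apply gamma_integrand_cont, ht]) G2).
  replace (Gamma s / cpow b s)%C with (/ cpow b s * Gamma s)%C by (unfold Cdiv; ring).
  apply (impC_ext _ _ _ (fun t ht => eq_trans (Cmult_assoc _ _ _) (eq_trans (f_equal (fun z => z * _)%C (Cinv_l _ (cpow_nz b s))) (Cmult_1_l _))) G3).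
Qed.

(** * The Bessel function as a Mellin integral *)

Definition bessel_integrand (nu : C) (c t : R) : C := (cpow t (nu - 1) * RtoC (exp (- (t + c / t))))%C.

Lemma bessel_integrand_cont (nu : C) (c : R) : Ccont (bessel_integrand nu c).
Proof.
  intros t ht. apply cont_at_mult. apply cont_at_cpow, ht. apply cont_at_RtoC.
  apply ex_derive_continuous_R. auto_derive. lra.
Qed.

Lemma ln_exp_half (z u : R) : 0 < z -> ln (z / 2 * exp u) = ln (z / 2) + u.
Proof. intros hz. rewrite ln_mult, ln_exp; [reflexivity|lra|apply exp_pos]. Qed.

Lemma bessel_subst (nu : C) (z u : R) : 0 < z ->
  (RtoC (z / 2 * exp u) * bessel_integrand nu (z * z / 4) (z / 2 * exp u))%C =
  (cpow (z / 2) nu * (RtoC (exp (- z * cosh u)) * cexp (nu * RtoC u)))%C.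
Proof.
  intros hz. unfold bessel_integrand. pose proof (exp_pos u).
  assert (ht : 0 < z / 2 * exp u) by (apply Rmult_lt_0_compat; lra).
  rewrite Cmult_assoc. rewrite <- (cpow_1 (z / 2 * exp u)) at 1 by exact ht. rewrite <- cpow_plus.
  replace (1 + (nu - 1))%C with nu by ring.
  replace (exp (- (z / 2 * exp u + z * z / 4 / (z / 2 * exp u)))) with (exp (- z * cosh u)).
  - unfold cpow. rewrite ln_exp_half by exact hz. rewrite RtoC_plus.
    replace (nu * (RtoC (ln (z / 2)) + RtoC u))%C with (nu * RtoC (ln (z / 2)) + nu * RtoC u)%C by ring.
    rewrite cexp_plus. ring.
  - f_equal. unfold cosh. rewrite exp_Ropp. field. lra.
Qed.

(** The substitution t = (z / 2) exp u carries the integral over (0, oo) to the whole line, where t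
    + z^2 / (4 t) becomes z cosh u; folding u with - u produces cosh (nu u) and the factor 2. *)
Lemma BesselK_integral (nu : C) (z : R) (M : C) : 0 < z -> impC (bessel_integrand nu (z * z / 4)) M ->
  BesselK nu z = (/ (2 * cpow (z / 2) nu) * M)%C.
Proof.
  intros hz [M1 M2].
  set (psi := bessel_integrand nu (z * z / 4)) in *.
  assert (Hpsi : Ccont psi) by apply bessel_integrand_cont.
  set (C0 := (2 * cpow (z / 2) nu)%C).
  assert (hC0 : C0 <> RtoC 0).
  { apply Cmult_neq_0. intros e. apply (f_equal fst) in e; simpl in e; lra. apply cpow_nz. }
  set (kap := fun t => (RtoC (exp (- z * cosh t)) * ccosh (nu * RtoC t))%C).
  assert (Ek : forall u, (C0 * kap u)%C = (RtoC (z / 2 * exp u) * psi (z / 2 * exp u)%R - RtoC (- (z / 2 * exp (- u))) * psi (z / 2 * exp (- u))%R)%C).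
  { intros u. rewrite RtoC_opp.
    replace (RtoC (z / 2 * exp u) * psi (z / 2 * exp u)%R - - RtoC (z / 2 * exp (- u)) * psi (z / 2 * exp (- u))%R)%C
     with (RtoC (z / 2 * exp u) * psi (z / 2 * exp u)%R + RtoC (z / 2 * exp (- u)) * psi (z / 2 * exp (- u))%R)%C by ring.
    unfold psi. rewrite !bessel_subst by exact hz. unfold kap, C0, ccosh.
    replace (cosh (- u)) with (cosh u) by (unfold cosh; rewrite Ropp_involutive; f_equal; ring).
    replace (nu * RtoC (- u))%C with (- (nu * RtoC u))%C by (rewrite RtoC_opp; ring).
    field. }
  (* The folding is exact for finite b: the arms u and - u together cover the interval from (z / 2)
     exp (- b) to (z / 2) exp b, glued at z / 2. *)
  assert (comp : forall (g : R -> R) b, 0 < b -> cont_pos g ->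
    is_RInt (fun u => (z / 2 * exp u) * g (z / 2 * exp u) - (- (z / 2 * exp (- u))) * g (z / 2 * exp (- u))) 0 b
      (RInt g (z / 2 * exp (- b)) (z / 2 * exp b))).
  { intros g b hb Hg.
    assert (e0 : forall u, 0 < z / 2 * exp u) by (intros u; apply Rmult_lt_0_compat; [lra|apply exp_pos]).
    assert (J1 := is_RInt_comp (V := R_CompleteNormedModule) g (fun u => z / 2 * exp u) (fun u => z / 2 * exp u) 0 b
      (fun u _ => Hg _ (e0 u))
      ltac:(intros u _; split; [auto_derive; [auto|ring]|apply ex_derive_continuous_R; auto_derive; auto])).
    assert (J2 := is_RInt_comp (V := R_CompleteNormedModule) g (fun u => z / 2 * exp (- u)) (fun u => - (z / 2 * exp (- u))) 0 b
      (fun u _ => Hg _ (e0 (- u)))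
      ltac:(intros u _; split; [auto_derive; [auto|ring]|apply ex_derive_continuous_R; auto_derive; auto])).
    cbv beta in J1, J2. rewrite Ropp_0 in J2. rewrite exp_0, Rmult_1_r in J1, J2.
    assert (J := is_RInt_minus_R _ _ _ _ _ _ J1 J2).
    replace (RInt g (z / 2 * exp (- b)) (z / 2 * exp b)) with (RInt g (z / 2) (z / 2 * exp b) - RInt g (z / 2) (z / 2 * exp (- b))).
    exact J.
    assert (h1 : exp (- b) < 1) by (rewrite <- exp_0; apply exp_increasing; lra).
    assert (h2 : 1 < exp b) by (rewrite <- exp_0; apply exp_increasing; lra).
    pose proof (exp_pos (- b)).
    rewrite (cont_pos_Chasles g (z / 2 * exp (- b)) (z / 2) (z / 2 * exp b)) by (auto; nra).
    rewrite <- (opp_RInt_swap (V := R_CompleteNormedModule) g (z / 2 * exp (- b)) (z / 2)).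
    change (RInt g (z / 2) (z / 2 * exp b) - - RInt g (z / 2 * exp (- b)) (z / 2) = RInt g (z / 2 * exp (- b)) (z / 2) + RInt g (z / 2) (z / 2 * exp b)). ring.
    exists (RInt g (z / 2 * exp (- b)) (z / 2)). apply cont_pos_ex; auto. nra. }
  assert (KI : forall b, 0 < b ->
    let I := (/ C0 * Cint psi (z / 2 * exp (- b)) (z / 2 * exp b))%C in
    is_RInt (fun u => Re (kap u)) 0 b (Re I) /\ is_RInt (fun u => Im (kap u)) 0 b (Im I)).
  { intros b hb I.
    assert (R1 : is_RInt (fun u => Re (C0 * kap u)) 0 b (Re (Cint psi (z / 2 * exp (- b)) (z / 2 * exp b)))).
    { apply (is_RInt_eq_R _ _ _ _ _ (fun u => eq_sym (eq_trans (f_equal Re (Ek u)) (eq_trans (re_plus _ _) (f_equal2 Rplus (re_scal_l _ _) (eq_trans (re_opp _) (f_equal Ropp (re_scal_l _ _)))))))).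
      apply (comp (fun t => Re (psi t)) b hb). intros t ht; exact (proj1 (Hpsi t ht)). }
    assert (R2 : is_RInt (fun u => Im (C0 * kap u)) 0 b (Im (Cint psi (z / 2 * exp (- b)) (z / 2 * exp b)))).
    { apply (is_RInt_eq_R _ _ _ _ _ (fun u => eq_sym (eq_trans (f_equal Im (Ek u)) (eq_trans (im_plus _ _) (f_equal2 Rplus (im_scal_l _ _) (eq_trans (im_opp _) (f_equal Ropp (im_scal_l _ _)))))))).
      apply (comp (fun t => Im (psi t)) b hb). intros t ht; exact (proj2 (Hpsi t ht)). }
    assert (EI : forall u, kap u = (/ C0 * (C0 * kap u))%C).
    { intros u. rewrite Cmult_assoc, Cinv_l, Cmult_1_l by exact hC0. reflexivity. }
    split.
    - apply (is_RInt_eq_R (fun u => Re (/ C0) * Re (C0 * kap u) - Im (/ C0) * Im (C0 * kap u))).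
      intros u. rewrite (EI u) at 3. rewrite (re_mult (/ C0)). reflexivity.
      unfold I. rewrite re_mult. apply is_RInt_minus_R; apply is_RInt_scal_R; assumption.
    - apply (is_RInt_eq_R (fun u => Re (/ C0) * Im (C0 * kap u) + Im (/ C0) * Re (C0 * kap u))).
      intros u. rewrite (EI u) at 3. rewrite (im_mult (/ C0)). reflexivity.
      unfold I. rewrite im_mult. apply is_RInt_plus_R; apply is_RInt_scal_R; assumption. }
  assert (LIM : forall eps, 0 < eps -> exists B, 0 < B /\ forall b, B < b ->
    Cmod (/ C0 * Cint psi (z / 2 * exp (- b)) (z / 2 * exp b) - / C0 * M) < eps).
  { intros eps he. set (K := Cmod (/ C0)). assert (hK : 0 < K).
    { unfold K. rewrite Cmod_inv by exact hC0. apply Rinv_0_lt_compat, Cmod_gt_0, hC0. }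
    destruct (M1 (eps / (2 * K))) as (A1 & B1 & hA1 & hAB1 & K1). apply Rdiv_lt_0_compat; lra.
    destruct (M2 (eps / (2 * K))) as (A2 & B2 & hA2 & hAB2 & K2). apply Rdiv_lt_0_compat; lra.
    set (A := Rmin A1 A2). set (B := Rmax B1 B2).
    assert (hA : 0 < A) by (apply Rmin_pos; assumption).
    pose proof (Rmin_l A1 A2). pose proof (Rmin_r A1 A2). pose proof (Rmax_l B1 B2). pose proof (Rmax_r B1 B2).
    (* Beyond this b the point (z / 2) exp (- b) is below A and (z / 2) exp b above B. *)
    exists (Rabs (ln (2 * A / z)) + Rabs (ln (2 * B / z)) + 1).
    pose proof (Rabs_pos (ln (2 * A / z))). pose proof (Rabs_pos (ln (2 * B / z))).
    split. lra. intros b hb.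
    assert (hB : 0 < B) by (unfold B; lra).
    assert (T1 : z / 2 * exp (- b) < A).
    { replace A with (z / 2 * (2 * A / z)) by (field; lra). apply Rmult_lt_compat_l. lra.
      rewrite <- (exp_ln (2 * A / z)) by (apply Rdiv_lt_0_compat; lra). apply exp_increasing.
      pose proof (Rle_abs (- ln (2 * A / z))). rewrite Rabs_Ropp in *. lra. }
    assert (T2 : B < z / 2 * exp b).
    { replace B with (z / 2 * (2 * B / z)) by (field; lra). apply Rmult_lt_compat_l. lra.
      rewrite <- (exp_ln (2 * B / z)) by (apply Rdiv_lt_0_compat; lra). apply exp_increasing.
      pose proof (Rle_abs (ln (2 * B / z))). lra. }
    assert (T0 : 0 < z / 2 * exp (- b)) by (apply Rmult_lt_0_compat; [lra|apply exp_pos]).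
    unfold A, B in *.
    specialize (K1 _ _ T0 ltac:(lra) (Rle_lt_trans _ _ _ H1 T2)). specialize (K2 _ _ T0 ltac:(lra) (Rle_lt_trans _ _ _ H2 T2)).
    set (J := Cint psi (z / 2 * exp (- b)) (z / 2 * exp b)).
    replace (/ C0 * J - / C0 * M)%C with (/ C0 * (J - M))%C by ring.
    rewrite Cmod_mult. fold K.
    assert (Cmod (J - M) < eps / K).
    { eapply Rle_lt_trans. apply Cmod_le_parts.
      change (Rabs (RInt (fun t => Re (psi t)) (z / 2 * exp (- b)) (z / 2 * exp b) - Re M) +
              Rabs (RInt (fun t => Im (psi t)) (z / 2 * exp (- b)) (z / 2 * exp b) - Im M) < eps / K).
      replace (eps / K) with (eps / (2 * K) + eps / (2 * K)) by (field; lra). lra. }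
    apply (Rmult_lt_compat_l K) in H5; [|exact hK]. replace (K * (eps / K)) with eps in H5 by (field; lra). exact H5. }
  assert (GEN : forall (pr : C -> R), (forall w, Rabs (pr w) <= Cmod w) -> (forall v w, pr (v - w)%C = pr v - pr w) ->
    (forall b, 0 < b -> is_RInt (fun u => pr (kap u)) 0 b (pr (/ C0 * Cint psi (z / 2 * exp (- b)) (z / 2 * exp b))%C)) ->
    is_RInt_gen (fun u => pr (kap u)) (at_point 0) (Rbar_locally p_infty) (pr (/ C0 * M)%C)).
  { intros pr p1 p2 p3 P [eps HP]. destruct (LIM eps (cond_pos eps)) as (B & hB & HB).
    apply (Filter_prod _ _ _ (fun a => a = 0) (fun b => B < b)).
    - reflexivity.
    - exists B. auto.
    - intros a b -> hb. exists (pr (/ C0 * Cint psi (z / 2 * exp (- b)) (z / 2 * exp b))%C). split. apply (p3 b); lra. apply HP.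
      specialize (HB b hb).
      change (Rabs (pr (/ C0 * Cint psi (z / 2 * exp (- b)) (z / 2 * exp b))%C - pr (/ C0 * M)%C) < eps).
      rewrite <- p2. eapply Rle_lt_trans. apply p1. exact HB. }
  unfold BesselK, CInt_0_oo. apply C_ext.
  - apply (is_RInt_gen_unique (V := R_CompleteNormedModule)).
    apply (GEN Re Re_le_Cmod). reflexivity. intros b hb. apply (KI b hb).
  - apply (is_RInt_gen_unique (V := R_CompleteNormedModule)).
    apply (GEN Im Im_le_Cmod). reflexivity. intros b hb. apply (KI b hb).
Qed.

(** * The Bessel series *)

Lemma is_seriesC_RtoC (f : nat -> R) (l : R) : is_series f l -> is_seriesC (fun n => RtoC (f n)) (RtoC l).
Proof. intros Hf. apply is_series_C. split. exact Hf. exact is_series_0_R. Qed.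

Lemma divsum_bound (k : nat) (th : R) (n : nat) : Rabs (divsum k th (n + 1)) <= (INR n + 1) ^ (k + 1).
Proof.
  unfold divsum. replace (n + 1 - 1)%nat with n by lia. pose proof (pos_INR n) as hn.
  set (f := fun j : nat => if Nat.eqb ((n + 1) mod (j + 1)) 0
    then INR (j + 1) ^ k * sin (2 * PI * INR (n + 1) * th / INR (j + 1)) else 0).
  assert (B : forall M, (M <= n)%nat -> Rabs (sum_n f M) <= (INR M + 1) * (INR n + 1) ^ k).
  { assert (T : forall j, (j <= n)%nat -> Rabs (f j) <= (INR n + 1) ^ k).
    { intros j hj. apply le_INR in hj. pose proof (pos_INR j). unfold f. destruct (Nat.eqb _ 0).
      - rewrite Rabs_mult, plus_INR. simpl (INR 1). rewrite Rabs_pos_eq by (apply pow_le; lra).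
        rewrite <- (Rmult_1_r ((INR n + 1) ^ k)). apply Rmult_le_compat. apply pow_le; lra. apply Rabs_pos.
        apply pow_incr; lra. apply Rabs_le.
        match goal with |- _ <= sin ?z <= _ => pose proof (SIN_bound z) end. lra.
      - rewrite Rabs_R0. apply pow_le; lra. }
    induction M as [|M IH]; intros hM.
    - rewrite sum_O. simpl (INR 0). rewrite Rplus_0_l, Rmult_1_l. apply T. lia.
    - rewrite sum_n_S_R, S_INR. specialize (IH ltac:(lia)). specialize (T (S M) hM).
      eapply Rle_trans. apply Rabs_triang. lra. }
  eapply Rle_trans. apply (B n (le_n n)). rewrite pow_add, pow_1. right; ring.
Qed.


Lemma C2_nz : RtoC 2 <> RtoC 0.
Proof. intros e. apply RtoC_inj in e. lra. Qed.

(** At z = a sqrt (N x) one has (z / 2)^nu = A^(nu/2) N^(nu/2) with A = a^2 x / 4: the weight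
    N^(nu/2) of the series cancels and a power of A independent of N remains. *)
Lemma bessel_term (nu M : C) (a x N : R) : 0 < a -> 0 < x -> 0 < N ->
  impC (bessel_integrand nu (a ^ 2 * x / 4 * N)) M ->
  (cpow N (nu / 2) * BesselK nu (a * sqrt (N * x)))%C = (/ 2 * cpow (a ^ 2 * x / 4) (- (nu / 2)) * M)%C.
Proof.
  intros ha hx hN HM.
  assert (hNx : 0 < N * x) by nra. assert (hs : 0 < sqrt (N * x)) by (apply sqrt_lt_R0, hNx).
  set (z := a * sqrt (N * x)). assert (hz : 0 < z) by (apply Rmult_lt_0_compat; assumption).
  set (A := a ^ 2 * x / 4) in *. assert (hA : 0 < A) by (unfold A; apply Rdiv_lt_0_compat; [apply Rmult_lt_0_compat; [apply pow_lt|]|]; lra).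
  assert (hzz : z * z / 4 = A * N).
  { unfold z, A. replace (a * sqrt (N * x) * (a * sqrt (N * x)) / 4) with (a * a * (sqrt (N * x) * sqrt (N * x)) / 4) by field.
    rewrite sqrt_sqrt by lra. field. }
  rewrite <- hzz in HM. rewrite (BesselK_integral nu z M hz HM).
  assert (E : cpow (z / 2) nu = (cpow A (nu / 2) * cpow N (nu / 2))%C).
  { rewrite <- cpow_mult_base by assumption. rewrite <- hzz. unfold cpow.
    replace (z * z / 4) with (z / 2 * (z / 2)) by field. rewrite ln_mult by lra. rewrite RtoC_plus. f_equal.
    field. }
  rewrite E.
  assert (E2 : cpow A (- (nu / 2)) = (/ cpow A (nu / 2))%C).
  { unfold cpow. rewrite <- cexp_opp. f_equal. ring. }
  rewrite E2. field. repeat split; first [apply cpow_nz | exact C2_nz].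
Qed.

Lemma RtoC_nz (r : R) : r <> 0 -> RtoC r <> RtoC 0.
Proof. intros h e. apply h, RtoC_inj, e. Qed.

Lemma cont_at_ext_pos (f g : R -> C) (t : R) : (forall u, 0 < u -> f u = g u) -> 0 < t ->
  cont_at f t -> cont_at g t.
Proof.
  intros E ht [H1 H2].
  assert (L : forall pr : C -> R, locally t (fun u => pr (f u) = pr (g u))).
  { intros pr. exists (mkposreal t ht). intros u hu. rewrite E. reflexivity.
    apply Rabs_def2 in hu. simpl in hu. unfold minus, plus, opp in hu; simpl in hu. lra. }
  split.
  - apply (continuous_ext_loc _ (fun t => Re (f t))). exact (L Re). exact H1.
  - apply (continuous_ext_loc _ (fun t => Im (f t))). exact (L Im). exact H2.
Qed.

(** * The Mellin transform of the transformation law *)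

Section Assembly.
Variables (A th : R) (k : nat) (nu : C).
Hypothesis hA : 0 < A.
Hypothesis hth : 0 < th < 1.
Hypothesis hk : (1 <= k)%nat.
Hypothesis hnu : 0 < Re nu.
Let sg := Re nu.

Definition lambert_at (t : R) : R := Series (fun n => divsum k th (n + 1) * exp (- INR (n + 1) * (A / t))).

Lemma bessel_sum :
  (forall t, 0 < t -> ex_series (fun n => divsum k th (n + 1) * exp (- INR (n + 1) * (A / t)))) ->
  exists (M : nat -> C), (forall n, impC (bessel_integrand nu (A * INR (n + 1))) (M n)) /\
    is_seriesC (fun n => RtoC (divsum k th (n + 1)) * M n)%C (CSeries (fun n => RtoC (divsum k th (n + 1)) * M n)%C) /\
    impC (fun t => cpow t (nu - 1) * RtoC (exp (- t)) * RtoC (lambert_at t))%C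
      (CSeries (fun n => RtoC (divsum k th (n + 1)) * M n)%C).
Proof.
  intros Hex. pose proof (pos_INR k) as hk0.
  assert (Mex : forall n, exists l, impC (bessel_integrand nu (A * INR (n + 1))) l).
  { intros n. apply (impC_dominated sg _ (dom_const sg 0) hnu). left; apply dom_const_pos. apply bessel_integrand_cont.
    intros t ht. unfold bessel_integrand. rewrite Cmod_mult, Cmod_cpow, Cmod_R, Rabs_pos_eq by (left; apply exp_pos).
    eapply Rle_trans; [|apply (gamma_dominated sg 0 t hnu (Rle_refl 0) ht)].
    replace (Re (nu - 1)) with (sg - 1 + 0) by (unfold sg; simpl; unfold Re; ring).
    apply Rmult_le_compat_l. left; apply Rpower_pos. apply exp_le.
    assert (0 <= A * INR (n + 1) / t) by (apply Rdiv_le_0_compat; [apply Rmult_le_pos; [lra|apply pos_INR]|lra]). lra. }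
  set (M := fun n => proj1_sig (constructive_indefinite_description _ (Mex n))).
  assert (HM : forall n, impC (bessel_integrand nu (A * INR (n + 1))) (M n)).
  { intros n. exact (proj2_sig (constructive_indefinite_description _ (Mex n))). }
  exists M. split. exact HM.
  (* The divisor sum is at most (n + 1)^(k+1), so the decay exponent k + 3 leaves (n + 1)^(-2); the
     factor (t / A)^q it costs is absorbed by exp (- t). *)
  set (q := INR k + 3).
  set (f := fun n t => (RtoC (divsum k th (n + 1)) * bessel_integrand nu (A * INR (n + 1)) t)%C).
  set (c := fun n : nat => exp_decay_const q * Rpower A (- q) * dom_const sg q * Rpower (INR n + 1) (Ropp 2)).
  assert (hc : 0 < exp_decay_const q * Rpower A (- q) * dom_const sg q).
  { repeat apply Rmult_lt_0_compat; [apply exp_pos|apply Rpower_pos|apply dom_const_pos]. }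
  destruct (improper_exchangeC sg f c (fun n => RtoC (divsum k th (n + 1)) * M n)%C hnu) as (E1 & E2 & _).
  - intros n t ht. apply (cont_at_mult (fun _ => RtoC (divsum k th (n + 1)))). apply cont_at_const. apply bessel_integrand_cont, ht.
  - intros n t ht. unfold f, bessel_integrand, c. pose proof (pos_INR n) as hn.
    rewrite Cmod_mult, Cmod_mult, Cmod_cpow, !Cmod_R, (Rabs_pos_eq (exp _)) by (left; apply exp_pos).
    replace (Re (nu - 1)) with (sg - 1) by (unfold sg; simpl; unfold Re; ring).
    assert (P : pow_exp (k + 1) (A / t) (INR n + 1) <= exp_decay_const q * Rpower (A / t) (- q) * Rpower (INR n + 1) (- (q - INR (k + 1)))).
    { apply pow_exp_bound. apply Rdiv_lt_0_compat; lra. lra. unfold q; lra. }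
    replace (- (q - INR (k + 1))) with (Ropp 2) in P by (unfold q; rewrite plus_INR; simpl; ring).
    assert (RA : Rpower (A / t) (- q) = Rpower A (- q) * Rpower t q).
    { unfold Rdiv. rewrite <- Rpower_mult_distr by (lra || apply Rinv_0_lt_compat; lra). f_equal.
      unfold Rpower. f_equal. rewrite ln_Rinv by exact ht. ring. }
    rewrite RA in P.
    replace (exp (- (t + A * INR (n + 1) / t))) with (exp (- t) * exp (- (A / t) * (INR n + 1))).
    2: { rewrite <- exp_plus. f_equal. rewrite plus_INR. simpl (INR 1). field. lra. }
    pose proof (divsum_bound k th n) as Db. pose proof (gamma_dominated sg q t hnu ltac:(unfold q; lra) ht) as Gd.
    rewrite Rpower_plus in Gd. unfold pow_exp in P.
    set (e1 := exp (- (A / t) * (INR n + 1))) in *. assert (0 < e1) by apply exp_pos.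
    assert (0 < exp (- t)) by apply exp_pos. pose proof (Rpower_pos t (sg - 1)).
    apply Rle_trans with ((INR n + 1) ^ (k + 1) * e1 * (Rpower t (sg - 1) * exp (- t))).
    + replace (Rabs (divsum k th (n + 1)) * (Rpower t (sg - 1) * (exp (- t) * e1))) with
        (Rabs (divsum k th (n + 1)) * (e1 * (Rpower t (sg - 1) * exp (- t)))) by ring.
      rewrite (Rmult_assoc ((INR n + 1) ^ (k + 1))). apply Rmult_le_compat_r; [|exact Db].
      repeat apply Rmult_le_pos; lra.
    + apply Rle_trans with (exp_decay_const q * (Rpower A (- q) * Rpower t q) * Rpower (INR n + 1) (Ropp 2) * (Rpower t (sg - 1) * exp (- t))).
      * apply Rmult_le_compat_r. apply Rmult_le_pos; lra. exact P.
      * replace (exp_decay_const q * (Rpower A (- q) * Rpower t q) * Rpower (INR n + 1) (Ropp 2) * (Rpower t (sg - 1) * exp (- t)))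
          with (exp_decay_const q * Rpower A (- q) * Rpower (INR n + 1) (Ropp 2) * (Rpower t (sg - 1) * Rpower t q * exp (- t))) by ring.
        replace (exp_decay_const q * Rpower A (- q) * dom_const sg q * Rpower (INR n + 1) (Ropp 2) * dominator sg t)
          with (exp_decay_const q * Rpower A (- q) * Rpower (INR n + 1) (Ropp 2) * (dom_const sg q * dominator sg t)) by ring.
        apply Rmult_le_compat_l; [|exact Gd]. repeat apply Rmult_le_pos; left; (apply exp_pos || apply Rpower_pos).
  - apply (ex_series_scal_l (V := R_NormedModule) (exp_decay_const q * Rpower A (- q) * dom_const sg q)).
    apply ex_series_Rpower; lra.
  - intros n. apply Rmult_le_pos. lra. left; apply Rpower_pos.
  - intros n. apply impC_scal. apply bessel_integrand_cont. apply HM.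
  - split. exact E1. refine (impC_ext _ _ _ _ E2). intros t ht. cbv beta. apply is_seriesC_unique.
    apply (is_seriesC_ext (fun n => (cpow t (nu - 1) * RtoC (exp (- t))) * RtoC (divsum k th (n + 1) * exp (- INR (n + 1) * (A / t))))%C).
    + intros n. unfold f, bessel_integrand.
      replace (exp (- (t + A * INR (n + 1) / t))) with (exp (- t) * exp (- INR (n + 1) * (A / t))).
      rewrite !RtoC_mult. ring. rewrite <- exp_plus. f_equal. field. lra.
    + apply is_seriesC_scal. apply is_seriesC_RtoC. apply Series_correct, Hex, ht.
Qed.

(** For A = a^2 x / 4 this is the 16 pi^2 / (a^2 x) of the theorem. It appears because the decay
    rate 4 pi^2 r / y at y = A / t is B r t. *)
Let B := 4 * PI ^ 2 / A.
Let s := (1 + nu + RtoC (INR k))%C.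

Lemma theta_scale_pos : 0 < B.
Proof. unfold B. pose proof PI_RGT_0. apply Rdiv_lt_0_compat; [|exact hA]. apply Rmult_lt_0_compat. lra. apply pow_lt; lra. Qed.

Lemma Re_gamma_exponent : Re s = 1 + sg + INR k.
Proof. unfold s, sg. rewrite !re_plus, !re_RtoC. reflexivity. Qed.

Definition zterm (b u : R) : C := (RtoC (u ^ k) / cpow (1 + b * u) s)%C.

Definition gweight (t : R) : C := (cpow t (s - 1) * RtoC (exp (- t)))%C.

Lemma gweight_cont : Ccont gweight.
Proof.
  intros t ht. apply (cont_at_ext (fun t => cpow t (s - 1) * RtoC (exp (- (1 * t))))%C).
  intros u; rewrite Rmult_1_l; reflexivity. apply gamma_integrand_cont, ht.
Qed.

Lemma zterm_bound (b u : R) : 0 < b -> 0 < u ->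
  Cmod (zterm b u) <= Rpower b (- (1 + sg + INR k)) * Rpower u (- (1 + sg)).
Proof.
  intros hb hu. unfold zterm. rewrite Cmod_div, Cmod_R, Cmod_cpow by apply cpow_nz. rewrite Re_gamma_exponent.
  rewrite Rabs_pos_eq by (apply pow_le; lra). pose proof (pos_INR k).
  unfold Rdiv. rewrite <- Rpower_Ropp.
  replace (Rpower b (- (1 + sg + INR k)) * Rpower u (- (1 + sg))) with (u ^ k * Rpower (b * u) (- (1 + sg + INR k))).
  - apply Rmult_le_compat_l. apply pow_le; lra. apply Rpower_antitone. nra. lra. unfold sg; lra.
  - rewrite <- Rpower_mult_distr by assumption.
    replace (- (1 + sg)) with (INR k + - (1 + sg + INR k)) by ring. rewrite Rpower_plus, Rpower_pow by exact hu. ring.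
Qed.

(** Divides Re nu in half. Against t^(sg+k) exp (- t) the factor (b t)^(-p) leaves t^(sg/2-1),
    integrable at 0; u^(k-p) = u^(-(1+sg/2)) is summable over m, and b^(-p) over r. *)
Let p := INR k + 1 + sg / 2.
Let K := exp_decay_const p * dom_const (sg / 2) 0.

Lemma zterm_const_pos : 0 < K.
Proof. apply Rmult_lt_0_compat. apply exp_pos. apply dom_const_pos. Qed.

Lemma zterm_impC (b u : R) : 0 < b -> 0 < u ->
  impC (fun t => gweight t * RtoC (pow_exp k (b * t) u))%C (Gamma s * zterm b u)%C.
Proof.
  intros hb hu.
  assert (hs : 0 < Re s) by (rewrite Re_gamma_exponent; pose proof (pos_INR k); unfold sg; lra).
  assert (hbu : 0 < 1 + b * u) by nra.
  assert (G1 := impC_scal (RtoC (u ^ k)) _ _ (gamma_integrand_cont s (1 + b * u)) (Gamma_scaled s (1 + b * u) hs hbu)).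
  replace (Gamma s * zterm b u)%C with (RtoC (u ^ k) * (Gamma s / cpow (1 + b * u) s))%C by (unfold zterm, Cdiv; ring).
  refine (impC_ext _ _ _ _ G1). intros t ht. cbv beta. unfold gweight, pow_exp.
  replace (exp (- ((1 + b * u) * t))) with (exp (- t) * exp (- (b * t) * u)) by (rewrite <- exp_plus; f_equal; ring).
  rewrite !RtoC_mult. ring.
Qed.

Lemma zterm_dom (b u t : R) : 0 < b -> 0 < u -> 0 < t ->
  Cmod (gweight t * RtoC (pow_exp k (b * t) u)) <= K * Rpower b (- p) * Rpower u (- (1 + sg / 2)) * dominator (sg / 2) t.
Proof.
  intros hb hu ht. pose proof (pos_INR k). unfold gweight.
  rewrite !Cmod_mult, Cmod_cpow, !Cmod_R, (Rabs_pos_eq (exp _)) by (left; apply exp_pos).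
  assert (hpe : 0 <= pow_exp k (b * t) u) by (apply Rmult_le_pos; [apply pow_le; lra|left; apply exp_pos]).
  rewrite (Rabs_pos_eq (pow_exp _ _ _)) by exact hpe.
  replace (Re (s - 1)) with (sg + INR k) by (unfold Cminus; rewrite re_plus, re_opp, Re_gamma_exponent, re_RtoC; ring).
  assert (P := pow_exp_bound k (b * t) u p ltac:(nra) hu ltac:(unfold p, sg in *; lra)).
  replace (- (p - INR k)) with (- (1 + sg / 2)) in P by (unfold p; ring).
  rewrite <- Rpower_mult_distr in P by assumption.
  assert (Gd := gamma_dominated (sg / 2) 0 t ltac:(unfold sg; lra) (Rle_refl 0) ht).
  pose proof (Rpower_pos t (sg + INR k)). pose proof (exp_pos (- t)).
  apply Rle_trans with (Rpower t (sg + INR k) * exp (- t) * (exp_decay_const p * (Rpower b (- p) * Rpower t (- p)) * Rpower u (- (1 + sg / 2)))).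
  apply Rmult_le_compat_l. apply Rmult_le_pos; lra. exact P.
  replace (Rpower t (sg + INR k) * exp (- t) * (exp_decay_const p * (Rpower b (- p) * Rpower t (- p)) * Rpower u (- (1 + sg / 2))))
    with (exp_decay_const p * Rpower b (- p) * Rpower u (- (1 + sg / 2)) * (Rpower t (sg + INR k) * Rpower t (- p) * exp (- t))) by ring.
  rewrite <- Rpower_plus. replace (sg + INR k + - p) with (sg / 2 - 1 + 0) by (unfold p; field).
  unfold K.
  replace (exp_decay_const p * dom_const (sg / 2) 0 * Rpower b (- p) * Rpower u (- (1 + sg / 2)) * dominator (sg / 2) t)
    with (exp_decay_const p * Rpower b (- p) * Rpower u (- (1 + sg / 2)) * (dom_const (sg / 2) 0 * dominator (sg / 2) t)) by ring.
  apply Rmult_le_compat_l; [|exact Gd]. repeat apply Rmult_le_pos; left; (apply exp_pos || apply Rpower_pos).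
Qed.

Definition zterm_odd (b : R) (m : nat) : C := (zterm b (INR m + th) - zterm b (INR m + (1 - th)))%C.

Let V (e : R) (m : nat) : R := Rpower (INR m + th) (- (1 + e)) + Rpower (INR m + (1 - th)) (- (1 + e)).

Lemma zterm_pair_ex (e : R) : 0 < e -> ex_series (V e).
Proof.
  intros he. apply (ex_series_plus (V := R_NormedModule) (fun m => Rpower (INR m + th) (- (1 + e))));
  apply ex_series_Rpower; lra.
Qed.

Lemma zterm_pair_nonneg (e : R) (m : nat) : 0 <= V e m.
Proof. apply Rplus_le_le_0_compat; left; apply Rpower_pos. Qed.

Lemma zterm_odd_bound (b : R) (m : nat) : 0 < b -> Cmod (zterm_odd b m) <= Rpower b (- (1 + sg + INR k)) * V sg m.
Proof.
  intros hb. pose proof (pos_INR m). unfold zterm_odd, V. unfold Cminus.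
  eapply Rle_trans. apply Cmod_triangle. rewrite Cmod_opp, Rmult_plus_distr_l.
  apply Rplus_le_compat; apply zterm_bound; lra.
Qed.

Lemma zterm_odd_series (b : R) : 0 < b -> is_seriesC (zterm_odd b) (CSeries (zterm_odd b)).
Proof.
  intros hb. apply (CSeries_correct _ (fun m => Rpower b (- (1 + sg + INR k)) * V sg m)).
  intros m; apply zterm_odd_bound, hb.
  apply (ex_series_scal_l (V := R_NormedModule) (Rpower b (- (1 + sg + INR k)))). apply zterm_pair_ex. exact hnu.
Qed.

Definition lerch_odd (b t : R) : R := lerch k (b * t) th - lerch k (b * t) (1 - th).

(** This settles the inner sum over m. Continuity and the bound are exported for the outer exchange
    over r, which needs one [dominator] for all r and the decay b^(-p). *)
Lemma zterm_odd_integral (b : R) : 0 < b ->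
  impC (fun t => gweight t * RtoC (lerch_odd b t))%C (Gamma s * CSeries (zterm_odd b))%C /\
  Ccont (fun t => gweight t * RtoC (lerch_odd b t))%C /\
  forall t, 0 < t -> Cmod (gweight t * RtoC (lerch_odd b t)) <= 2 * K * Series (V (sg / 2)) * Rpower b (- p) * dominator (sg / 2) t.
Proof.
  intros hb. assert (hs2 : 0 < sg / 2) by (unfold sg; lra). pose proof zterm_const_pos as hK.
  pose proof (Rpower_pos b (- p)) as hbp.
  set (g := fun u t => (gweight t * RtoC (pow_exp k (b * t) u))%C).
  set (f := fun (m : nat) t => (g (INR m + th)%R t - g (INR m + (1 - th))%R t)%C).
  assert (cg : forall u, Ccont (g u)).
  { intros u t ht. apply cont_at_mult. apply gweight_cont, ht. apply cont_at_RtoC. unfold pow_exp.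
    apply ex_derive_continuous_R. auto_derive. auto. }
  assert (cf : forall m, Ccont (f m)).
  { intros m t ht. apply (cont_at_minus (g (INR m + th)) (g (INR m + (1 - th)))). apply (cg _ t ht). apply (cg _ t ht). }
  assert (Ef : forall t, 0 < t -> is_seriesC (fun m => f m t) (gweight t * RtoC (lerch_odd b t))%C).
  { intros t ht. apply (is_seriesC_ext (fun m => gweight t * RtoC (pow_exp k (b * t) (INR m + th) - pow_exp k (b * t) (INR m + (1 - th))))%C).
    intros m. unfold f, g. rewrite RtoC_minus. ring.
    apply is_seriesC_scal. apply is_seriesC_RtoC. apply is_series_minus_R; apply lerch_correct; try lra; nra. }
  assert (df : forall m t, 0 < t -> Cmod (f m t) <= K * Rpower b (- p) * V (sg / 2) m * dominator (sg / 2) t).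
  { intros m t ht. pose proof (pos_INR m). unfold f, V, Cminus. eapply Rle_trans. apply Cmod_triangle. rewrite Cmod_opp.
    pose proof (zterm_dom b (INR m + th) t hb ltac:(lra) ht). pose proof (zterm_dom b (INR m + (1 - th)) t hb ltac:(lra) ht).
    unfold g. lra. }
  assert (HV : ex_series (fun m => K * Rpower b (- p) * V (sg / 2) m)).
  { apply (ex_series_scal_l (V := R_NormedModule) (K * Rpower b (- p))). apply zterm_pair_ex, hs2. }
  destruct (improper_exchangeC (sg / 2) f (fun m => K * Rpower b (- p) * V (sg / 2) m) (fun m => Gamma s * zterm_odd b m)%C hs2 cf df HV) as (E1 & E2 & E3).
  - intros m. apply Rmult_le_pos. apply Rmult_le_pos; lra. apply zterm_pair_nonneg.
  - intros m. pose proof (pos_INR m).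
    assert (Z1 := zterm_impC b (INR m + th) hb ltac:(lra)).
    assert (Z2 := impC_scal (- (1))%C _ _ (cg _) (zterm_impC b (INR m + (1 - th)) hb ltac:(lra))).
    assert (Z := impC_plus _ _ _ _ (cg _) (fun t ht => cont_at_mult (fun _ => (- (1))%C) _ t (cont_at_const _ t) (cg _ t ht)) Z1 Z2).
    replace (Gamma s * zterm_odd b m)%C with (Gamma s * zterm b (INR m + th) + - (1) * (Gamma s * zterm b (INR m + (1 - th))))%C by (unfold zterm_odd; ring).
    refine (impC_ext _ _ _ _ Z). intros t ht. cbv beta. unfold f, g. ring.
  - split; [|split].
    + replace (Gamma s * CSeries (zterm_odd b))%C with (CSeries (fun m => Gamma s * zterm_odd b m)%C).
      apply (impC_ext _ _ _ (fun t ht => is_seriesC_unique _ _ (Ef t ht)) E2).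
      apply is_seriesC_unique. apply is_seriesC_scal. apply zterm_odd_series, hb.
    + intros t ht. apply (cont_at_ext_pos (fun t => CSeries (fun m => f m t))); auto.
      intros u hu. apply is_seriesC_unique, Ef, hu.
    + intros t ht.
      replace (2 * K * Series (V (sg / 2)) * Rpower b (- p) * dominator (sg / 2) t)
        with (2 * Series (fun m => K * Rpower b (- p) * V (sg / 2) m * dominator (sg / 2) t))
        by (rewrite Series_scal_r, Series_scal_l; ring).
      apply (is_seriesC_bound _ _ _ (Ef t ht)). intros m; apply df, ht.
      apply ex_series_scal_r, HV.
Qed.

(** At y = A / t the transformation law equates two integrands on (0, oo). Each side has been
    integrated termwise, so uniqueness of the improper limit equates the sums. *)
Lemma bessel_series_identity (q : nat) : k = (2 * q)%nat -> (1 <= q)%nat ->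
  exists (M : nat -> C) (I1 : C) (sg0 : R) (Tsum : C),
    (forall n, impC (bessel_integrand nu (A * INR (n + 1))) (M n)) /\
    is_seriesC (fun n => RtoC (divsum k th (n + 1)) * M n)%C I1 /\
    is_series (fun n => sin (2 * PI * INR (S n) * th) / INR (S n) ^ S (2 * q)) sg0 /\
    is_seriesC (fun r => CSeries (zterm_odd (B * INR (S r)))) Tsum /\
    (RtoC (A ^ S k / 2) * I1)%C =
      (RtoC (INR (fact k) * sg0 / 2) * Gamma s + RtoC ((-1) ^ q * (2 * PI) ^ S k / 4) * (Gamma s * Tsum))%C.
Proof.
  intros hkq hq. pose proof theta_scale_pos as hB. pose proof (pos_INR k) as hk0. pose proof PI_RGT_0 as hpi.
  assert (hs2 : 0 < sg / 2) by (unfold sg; lra).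
  destruct (sin_series_ex (2 * q) th ltac:(lia)) as [sg0 Hsg].
  assert (LM : forall t, 0 < t -> exists Gs,
    is_series (fun r => lerch_odd (B * INR (S r)) t) Gs /\
    is_series (fun n => divsum k th (n + 1) * exp (- INR (n + 1) * (A / t))) (lambert_at t) /\
    (A / t) ^ S k * lambert_at t / 2 = INR (fact k) * sg0 / 2 + (-1) ^ q * (2 * PI) ^ S k / 4 * Gs).
  { intros t ht. destruct (lambert_modular q th (A / t) sg0 ltac:(apply Rdiv_lt_0_compat; lra) hth hq Hsg) as (Gs & Ph & L1 & L2 & L3).
    rewrite <- hkq in L1, L2, L3. exists Gs.
    assert (E : lambert_at t = Ph) by (apply is_series_unique; exact L2). rewrite E. split; [|split; assumption].
    apply (is_series_ext_R _ _ _ (fun r => eq_refl _)) in L1.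
    eapply is_series_ext_R; [|exact L1]. intros r. cbv beta. unfold lerch_odd.
    replace (4 * PI ^ 2 * INR (S r) / (A / t)) with (B * INR (S r) * t) by (unfold B; field; lra). reflexivity. }
  destruct bessel_sum as (M & HM & HS & HI).
  { intros t ht. destruct (LM t ht) as (Gs & _ & L2 & _). eexists; exact L2. }
  assert (hb : forall r, 0 < B * INR (S r)) by (intros r; apply Rmult_lt_0_compat; [exact hB|apply lt_0_INR; lia]).
  assert (Sr : forall r e, Rpower (B * INR (S r)) (- e) = Rpower B (- e) * Rpower (INR r + 1) (- e)).
  { intros r e. rewrite S_INR. pose proof (pos_INR r). rewrite Rpower_mult_distr by lra. reflexivity. }
  assert (HT : is_seriesC (fun r => CSeries (zterm_odd (B * INR (S r)))) (CSeries (fun r => CSeries (zterm_odd (B * INR (S r)))))).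
  { apply (CSeries_correct _ (fun r => 2 * (Rpower B (- (1 + sg + INR k)) * Series (V sg)) * Rpower (INR r + 1) (- (1 + sg + INR k)))).
    - intros r.
      replace (2 * (Rpower B (- (1 + sg + INR k)) * Series (V sg)) * Rpower (INR r + 1) (- (1 + sg + INR k)))
        with (2 * Series (fun m => Rpower (B * INR (S r)) (- (1 + sg + INR k)) * V sg m))
        by (rewrite Series_scal_l, Sr; ring).
      apply (is_seriesC_bound _ _ _ (zterm_odd_series _ (hb r))). intros m; apply zterm_odd_bound, hb.
      apply (ex_series_scal_l (V := R_NormedModule) (Rpower (B * INR (S r)) (- (1 + sg + INR k)))). apply zterm_pair_ex. exact hnu.
    - apply (ex_series_scal_l (V := R_NormedModule) (2 * (Rpower B (- (1 + sg + INR k)) * Series (V sg)))).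
      apply ex_series_Rpower. lra. unfold sg. lra. }
  set (Tsum := CSeries (fun r => CSeries (zterm_odd (B * INR (S r))))) in *.
  set (h := fun r t => (gweight t * RtoC (lerch_odd (B * INR (S r)) t))%C).
  set (D := 2 * K * Series (V (sg / 2)) * Rpower B (- p)).
  assert (hV : 0 <= Series (V (sg / 2))).
  { eapply Rle_trans; [|apply (sum_n_le_Series (V (sg / 2)) O (zterm_pair_nonneg _) (zterm_pair_ex _ hs2))]. rewrite sum_O. apply zterm_pair_nonneg. }
  assert (hD : 0 <= D).
  { pose proof zterm_const_pos. apply Rmult_le_pos; [|left; apply Rpower_pos]. apply Rmult_le_pos; lra. }
  assert (hp1 : 1 < p) by (unfold p; lra).
  destruct (improper_exchangeC (sg / 2) h (fun r => D * Rpower (INR r + 1) (- p)) (fun r => Gamma s * CSeries (zterm_odd (B * INR (S r))))%C hs2) as (E1 & E2 & E3).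
  - intros r. apply (zterm_odd_integral _ (hb r)).
  - intros r t ht. destruct (zterm_odd_integral _ (hb r)) as (_ & _ & Hd). specialize (Hd t ht).
    rewrite Sr in Hd. unfold D. unfold h. lra.
  - apply (ex_series_scal_l (V := R_NormedModule) D). apply ex_series_Rpower; lra.
  - intros r. apply Rmult_le_pos. exact hD. left; apply Rpower_pos.
  - intros r. apply (zterm_odd_integral _ (hb r)).
  - assert (EG : CSeries (fun r => Gamma s * CSeries (zterm_odd (B * INR (S r))))%C = (Gamma s * Tsum)%C).
    { apply is_seriesC_unique. apply is_seriesC_scal. exact HT. }
    rewrite EG in E2.
    assert (hs : 0 < Re s) by (rewrite Re_gamma_exponent; unfold sg; lra).
    assert (W := impC_scal (RtoC (INR (fact k) * sg0 / 2)) _ _ gweight_cont (Gamma_correct s hs)).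
    assert (X := impC_scal (RtoC ((-1) ^ q * (2 * PI) ^ S k / 4)) _ _ E3 E2).
    assert (Y := impC_plus _ _ _ _ (fun t ht => cont_at_mult (fun _ => RtoC (INR (fact k) * sg0 / 2)) _ t (cont_at_const _ t) (gweight_cont t ht))
      (fun t ht => cont_at_mult (fun _ => RtoC ((-1) ^ q * (2 * PI) ^ S k / 4)) _ t (cont_at_const _ t) (E3 t ht)) W X).
    exists M, (CSeries (fun n => RtoC (divsum k th (n + 1)) * M n)%C), sg0, Tsum.
    split; [exact HM|split; [exact HS|split; [exact Hsg|split; [exact HT|]]]].
    assert (hAk : 0 < A ^ S k / 2) by (apply Rdiv_lt_0_compat; [apply pow_lt|]; lra).
    assert (Z : impC (fun t => cpow t (nu - 1) * RtoC (exp (- t)) * RtoC (lambert_at t))%C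
       (/ RtoC (A ^ S k / 2) * (RtoC (INR (fact k) * sg0 / 2) * Gamma s + RtoC ((-1) ^ q * (2 * PI) ^ S k / 4) * (Gamma s * Tsum)))%C).
    { refine (impC_ext _ _ _ _ (impC_scal (/ RtoC (A ^ S k / 2)) _ _ _ Y)).
      2: { intros t ht. apply cont_at_plus; apply (cont_at_mult (fun _ => _)); try apply cont_at_const.
           apply gweight_cont, ht. apply E3, ht. }
      intros t ht. cbv beta. destruct (LM t ht) as (Gs & L1 & _ & L3).
      assert (EH : CSeries (fun r => h r t) = (gweight t * RtoC Gs)%C).
      { apply is_seriesC_unique. apply is_seriesC_scal. apply is_seriesC_RtoC. exact L1. }
      rewrite EH. fold (gweight t).
      replace (RtoC (INR (fact k) * sg0 / 2) * gweight t + RtoC ((-1) ^ q * (2 * PI) ^ S k / 4) * (gweight t * RtoC Gs))%C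
        with (gweight t * RtoC (INR (fact k) * sg0 / 2 + (-1) ^ q * (2 * PI) ^ S k / 4 * Gs))%C
        by (rewrite RtoC_plus, (RtoC_mult _ Gs); ring).
      rewrite <- L3. unfold gweight.
      (* The law carries (A / t)^(k+1). Its t^(k+1), moved to the other side, raises the exponent nu
         - 1 to nu + k = s - 1; hence Gamma (nu + k + 1). *)
      replace (cpow t (s - 1)) with (cpow t (nu - 1) * RtoC (t ^ S k))%C.
      2: { rewrite <- cpow_INR by exact ht. rewrite <- cpow_plus. f_equal. unfold s. rewrite S_INR, RtoC_plus. ring. }
      replace ((A / t) ^ S k * lambert_at t / 2) with (A ^ S k / 2 * / t ^ S k * lambert_at t).
      2: { unfold Rdiv. rewrite Rpow_mult_distr, pow_inv. ring. }
      assert (ht0 : t ^ S k <> 0) by (apply pow_nonzero; lra).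
      rewrite !(RtoC_mult _ (lambert_at t)), (RtoC_mult (A ^ S k / 2) (/ t ^ S k)), RtoC_inv by exact ht0.
      field. split. apply RtoC_nz, ht0. apply RtoC_nz; lra. }
    rewrite (impC_unique _ _ _ HI Z). field. apply RtoC_nz. lra.
Qed.
End Assembly.

Theorem theorem2p3 (a x theta : R) (k : nat) (nu : C)
  (ha : 0 < a) (hx : 0 < x) (ht0 : 0 < theta) (ht1 : theta < 1)
  (hk : (2 <= k)%nat) (hkeven : Nat.even k = true) (hnu : 0 < Re nu) :
  exists (S : C) (T : nat -> C) (Tsum : C),
    is_series (fun n : nat =>
       let N := (n + 1)%nat in
       (cpow (INR N) (nu / 2) * BesselK nu (a * sqrt (INR N * x))
        * RtoC (divsum k theta N))%C) S /\
    (forall r : nat,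
       let R0 := INR (r + 1) in
       is_series (fun m : nat =>
         (RtoC ((INR m + theta) ^ k)
            / cpow (1 + 16 * PI ^ 2 * R0 / (a ^ 2 * x) * (INR m + theta))
                   (1 + nu + RtoC (INR k))
          - RtoC ((INR m + 1 - theta) ^ k)
            / cpow (1 + 16 * PI ^ 2 * R0 / (a ^ 2 * x) * (INR m + 1 - theta))
                   (1 + nu + RtoC (INR k)))%C) (T r)) /\
    is_series T Tsum /\
    (cpow (a ^ 2 * x / 4) (nu / 2 + RtoC (INR k) + 1) * S)%C =
      (RtoC ((-1) ^ (k / 2) * 2 ^ k * PI ^ (k + 1) / 4)
         * Gamma (nu + RtoC (INR k) + 1)
         * (hurwitz_zeta (- RtoC (INR k)) theta
            - hurwitz_zeta (- RtoC (INR k)) (1 - theta))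
       + RtoC ((-1) ^ (k / 2) / 4 * (2 * PI) ^ (k + 1))
         * Gamma (nu + RtoC (INR k) + 1) * Tsum)%C.
Proof.
  set (A := a ^ 2 * x / 4).
  assert (ha2 : 0 < a ^ 2) by (apply pow_lt; exact ha).
  assert (hA : 0 < A) by (unfold A; apply Rdiv_lt_0_compat; [apply Rmult_lt_0_compat|]; lra).
  set (q := (k / 2)%nat).
  assert (hkq : k = (2 * q)%nat).
  { apply Nat.even_spec in hkeven. destruct hkeven as [j hj]. unfold q. rewrite hj, (Nat.mul_comm 2 j), Nat.div_mul; lia. }
  assert (hq : (1 <= q)%nat) by lia.
  pose proof PI_RGT_0 as hpi.
  destruct (bessel_series_identity A theta k nu hA (conj ht0 ht1) ltac:(lia) hnu q hkq hq) as (M & I1 & sg0 & Tsum & HM & HI & Hsg & HT & HE).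
  set (B := 4 * PI ^ 2 / A) in *.
  assert (hB : 0 < B) by (apply Rdiv_lt_0_compat; [apply Rmult_lt_0_compat; [lra|apply pow_lt; lra]|exact hA]).
  (* The constant in front of [I1] is the one that [bessel_term] leaves outside each integral. *)
  exists (/ 2 * cpow A (- (nu / 2)) * I1)%C, (fun r => CSeries (zterm_odd theta k nu (B * INR (S r)))), Tsum.
  split; [|split; [|split]].
  - apply (is_seriesC_ext (fun n => (/ 2 * cpow A (- (nu / 2))) * (RtoC (divsum k theta (n + 1)) * M n))%C).
    + intros n. cbv zeta.
      rewrite (bessel_term nu (M n) a x (INR (n + 1)) ha hx ltac:(apply lt_0_INR; lia) (HM n)). fold A. ring.
    + apply is_seriesC_scal. exact HI.
  - intros r. cbv zeta.
    assert (hb : 0 < B * INR (S r)) by (apply Rmult_lt_0_compat; [exact hB|apply lt_0_INR; lia]).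
    apply (is_seriesC_ext (zterm_odd theta k nu (B * INR (S r)))).
    + intros m. unfold zterm_odd, zterm.
      replace (16 * PI ^ 2 * INR (r + 1) / (a ^ 2 * x)) with (B * INR (S r)).
      replace (INR m + (1 - theta)) with (INR m + 1 - theta) by ring. reflexivity.
      unfold B, A. rewrite Nat.add_1_r. field. split; lra.
    + apply zterm_odd_series; auto; lia.
  - exact HT.
  - rewrite Nat.add_1_r.
    replace (nu + RtoC (INR k) + 1)%C with (1 + nu + RtoC (INR k))%C by ring.
    assert (Ez : (hurwitz_zeta (- RtoC (INR k)) theta - hurwitz_zeta (- RtoC (INR k)) (1 - theta))%C =
      RtoC (4 * ((-1) ^ q * INR (fact k) / (2 * PI) ^ S k) * sg0)).
    { rewrite hkq. apply zeta_diff; auto. }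
    rewrite Ez.
    (* The powers A^(nu/2) and A^(-nu/2) cancel; only the real power A^(k+1) of the transformation
       law remains. *)
    replace (cpow A (nu / 2 + RtoC (INR k) + 1) * (/ 2 * cpow A (- (nu / 2)) * I1))%C with (RtoC (A ^ S k / 2) * I1)%C.
    2: { replace (nu / 2 + RtoC (INR k) + 1)%C with (nu / 2 + RtoC (INR (S k)))%C by (rewrite S_INR, RtoC_plus; ring).
         rewrite cpow_plus, cpow_INR by exact hA.
         assert (E0 : (cpow A (nu / 2) * cpow A (- (nu / 2)))%C = RtoC 1).
         { rewrite <- cpow_plus. replace (nu / 2 + - (nu / 2))%C with (RtoC (INR 0)) by (simpl; ring).
           rewrite cpow_INR by exact hA. reflexivity. }
         replace (cpow A (nu / 2) * RtoC (A ^ S k) * (/ 2 * cpow A (- (nu / 2)) * I1))%C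
           with (RtoC (A ^ S k) * / 2 * (cpow A (nu / 2) * cpow A (- (nu / 2))) * I1)%C by ring.
         rewrite E0, RtoC_div by lra. unfold Cdiv. ring. }
    rewrite HE.
    assert (hsq : (-1) ^ q * (-1) ^ q = 1).
    { rewrite <- Rpow_mult_distr. replace (-1 * -1) with 1 by ring. apply pow1. }
    (* The sine series rewritten as the zeta difference: the sign of [zeta_diff] meets the sign in
       front of the theorem's first term, and their product is 1. *)
    assert (EC : INR (fact k) * sg0 / 2 = (-1) ^ q * 2 ^ k * PI ^ S k / 4 * (4 * ((-1) ^ q * INR (fact k) / (2 * PI) ^ S k) * sg0)).
    { rewrite Rpow_mult_distr.
      replace ((-1) ^ q * 2 ^ k * PI ^ S k / 4 * (4 * ((-1) ^ q * INR (fact k) / (2 ^ S k * PI ^ S k)) * sg0))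
        with (((-1) ^ q * (-1) ^ q) * 2 ^ k * INR (fact k) * sg0 / 2 ^ S k)
        by (field; repeat split; apply pow_nonzero; lra).
      rewrite hsq. simpl. field. apply pow_nonzero; lra. }
    rewrite EC, (RtoC_mult ((-1) ^ q * 2 ^ k * PI ^ S k / 4)).
    replace ((-1) ^ q / 4 * (2 * PI) ^ S k) with ((-1) ^ q * (2 * PI) ^ S k / 4) by field.
    ring.
Qed.
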